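(* Let $\psi\in\widehat\Delta$ be odd with $\psi\neq\omega$, and let $f_\psi$ be as defined in the context. Then the homomorphism $\mathcal I\to L^*/(L^* )^{p^{k(\psi)}}$, $\mathfrak A\mapsto f_\psi(\mathfrak A)\bmod (L^* )^{p^{k(\psi)}}$, induces (via $A\simeq\mathcal I/(\mathcal I^{p^m}\mathcal P)$ and passing to $\psi$-components) an isomorphism of groups $$A(\psi)\simeq\Big(\frac{W(L^* )^{p^{k(\psi)}}}{(L^* )^{p^{k(\psi)}}}\Big)(\psi).$$
   Context: Let $p\geq5$ be prime, $L=\mathbb Q(\zeta_p)$, $\mathcal O=\mathbb Z[\zeta_p]$, $\Delta=\mathrm{Gal}(L/\mathbb Q)$, $\sigma_a(\zeta_p)=\zeta_p^a$, $\widehat\Delta=\mathrm{Hom}(\Delta,\mathbb Z_p^* )$, $\omega$ the Teichmüller character, $\psi$ odd if $\psi(\sigma_{-1})=-1$, $e_\rho=\frac1{p-1}\sum_\delta\rho^{-1}(\delta)\delta\in\mathbb Z_p[\Delta]$, and for a $\mathbb Z_p[\Delta]$-module (or a $\mathbb Z[\Delta]$-module killed by a power of $p$) $M$, $M(\rho)=e_\rho M$. Let $Cl(L)$ be the class group, $A$ its $p$-Sylow subgroup, $\mathcal I$ the group of fractional ideals prime to $p$, $\mathcal P$ the principal ones. Let $p^{k(\psi)}$ be the exponent of $A(\psi)$. Fix an embedding $L\subset K=\mathbb Q_p(\zeta_p)$, $\pi=\zeta_p-1$, $U=1+\pi^2\mathbb Z_p[\zeta_p]$. $\mathcal W$ is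 the set of $f\in\mathrm{Hom}_{\mathbb Z[\Delta]}(\mathcal I,L^* )$ with $f(\mathcal I)\subset U$ and such that there is $\beta(f)\in\mathbb Z[\Delta]$ with $f(\alpha\mathcal O)=\alpha^{\beta(f)}$ for all $\alpha\in L^*\cap U$ ($\beta(f)$ unique, $\beta$ injective); $\mathcal W$ is a $\mathbb Z[\Delta]$-module under pointwise multiplication, $(\sigma f)(\mathfrak A)=\sigma(f(\mathfrak A))$, and $\mathcal W^-=\{f:\sigma_{-1}f=f^{-1}\}$. $W$ is the $\mathbb Z[\Delta]$-submodule of $L^*$ generated by all $f(\mathfrak A)$, $f\in\mathcal W$, $\mathfrak A\in\mathcal I$. Let $m\ge1$ with $p^m>|A|$, $n=|Cl(L)|/|A|$, $e_m(\psi)\in\mathbb Z[\Delta]^-$ with $e_m(\psi)\equiv e_\psi\pmod{p^m}$, and $\beta_\psi=2np^{k(\psi)}e_m(\psi)$. Then $f_\psi$ is the unique element of $\mathcal W^-$ with $\beta(f_\psi)=\beta_\psi$ (it exists). *)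

(* Defs.v *)
From HB Require Import structures.
From mathcomp Require Import all_boot all_order all_algebra all_fingroup.
From mathcomp Require Import all_field.
From mathcomp Require Import boolp classical_sets functions cardinality.

Set Implicit Arguments.
Unset Strict Implicit.
Unset Printing Implicit Defensive.

Import Order.TTheory GRing.Theory Num.Theory.
Local Open Scope classical_set_scope.
Local Open Scope ring_scope.

(* The ring of p-adic integers as the inverse limit of the Z/p^n: the n-th
   coordinate is the representative in [0, p^n) of the class modulo p^n. The
   (otherwise unused) primality proof is a parameter of the type so that the
   integral domain structure can be declared unconditionally. *)
Definition coherent (p : nat) (x : nat -> int) : Prop :=
  forall n, x n = (x n.+1 %% (p ^ n)%N)%Z.

Record padic (p : nat) (p_pr : prime p) := Padic {
  padic_coord :> nat -> int;
  padic_coherent : coherent p padic_coord }.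

HB.instance Definition _ p p_pr := gen_eqMixin (@padic p p_pr).
HB.instance Definition _ p p_pr := gen_choiceMixin (@padic p p_pr).

Section PadicRing.
Variables (p : nat) (p_pr : prime p).
Notation Zp := (padic p_pr).

Lemma padic_ext (x y : Zp) : (forall n, x n = y n) -> x = y.
Proof.
case: x y => [x cx] [y cy] /= exy; have {}exy : x = y by apply/funext.
by subst y; rewrite (Prop_irrelevance cx cy).
Qed.

Lemma padic_mod (x : Zp) n : (x n %% (p ^ n)%N)%Z = x n.
Proof. by rewrite (padic_coherent x n) modz_mod. Qed.

Lemma padic_step (x : Zp) n : (x n.+1 = x n %[mod (p ^ n)%N])%Z.
Proof. by rewrite (padic_coherent x n) modz_mod. Qed.

Lemma modz_pow (a b : int) n :
  (a = b %[mod (p ^ n.+1)%N])%Z -> (a = b %[mod (p ^ n)%N])%Z.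
Proof.
move=> /eqP; rewrite eqz_mod_dvd => h; apply/eqP; rewrite eqz_mod_dvd.
by apply: dvdz_trans h; rewrite expnSr PoszM dvdz_mulr.
Qed.

Lemma reduce_coherent (f : nat -> int) :
  (forall n, f n.+1 = f n %[mod (p ^ n)%N])%Z ->
  coherent p (fun n => f n %% (p ^ n)%N)%Z.
Proof.
move=> hf n /=; rewrite -hf.
by apply/modz_pow; rewrite modz_mod.
Qed.

Definition padic_reduce (f : nat -> int)
    (hf : (forall n, f n.+1 = f n %[mod (p ^ n)%N])%Z) : Zp :=
  Padic p_pr (reduce_coherent hf).

Lemma modzD_congr (a b c d m : int) :
  (a = b %[mod m] -> c = d %[mod m] -> a + c = b + d %[mod m])%Z.
Proof. by move=> h1 h2; rewrite -modzDm h1 h2 modzDm. Qed.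

Lemma modzM_congr (a b c d m : int) :
  (a = b %[mod m] -> c = d %[mod m] -> a * c = b * d %[mod m])%Z.
Proof. by move=> h1 h2; rewrite -modzMm h1 h2 modzMm. Qed.

Lemma padic_add_subproof (x y : Zp) n :
  (x n.+1 + y n.+1 = x n + y n %[mod (p ^ n)%N])%Z.
Proof. by apply: modzD_congr; apply: padic_step. Qed.

Lemma padic_mul_subproof (x y : Zp) n :
  (x n.+1 * y n.+1 = x n * y n %[mod (p ^ n)%N])%Z.
Proof. by apply: modzM_congr; apply: padic_step. Qed.

Lemma padic_opp_subproof (x : Zp) n :
  (- x n.+1 = - x n %[mod (p ^ n)%N])%Z.
Proof. by rewrite -modzNm padic_step modzNm. Qed.

Definition padic_add (x y : Zp) : Zp := padic_reduce (padic_add_subproof x y).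
Definition padic_mul (x y : Zp) : Zp := padic_reduce (padic_mul_subproof x y).
Definition padic_opp (x : Zp) : Zp := padic_reduce (padic_opp_subproof x).
Definition padic_zero : Zp := padic_reduce (f := fun=> 0) (fun=> erefl).
Definition padic_one : Zp := padic_reduce (f := fun=> 1) (fun=> erefl).

Fact padic_addA : associative padic_add.
Proof.
by move=> x y z; apply: padic_ext => n /=; rewrite modzDml modzDmr addrA.
Qed.
Fact padic_addC : commutative padic_add.
Proof. by move=> x y; apply: padic_ext => n /=; rewrite addrC. Qed.
Fact padic_add0 : left_id padic_zero padic_add.
Proof.
by move=> x; apply: padic_ext => n /=; rewrite modzDml add0r padic_mod.
Qed.
Fact padic_addN : left_inverse padic_zero padic_opp padic_add.
Proof.
by move=> x; apply: padic_ext => n /=; rewrite modzDml addNr.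
Qed.

HB.instance Definition _ :=
  GRing.isZmodule.Build Zp padic_addA padic_addC padic_add0 padic_addN.

Fact padic_mulA : associative padic_mul.
Proof.
by move=> x y z; apply: padic_ext => n /=; rewrite modzMml modzMmr mulrA.
Qed.
Fact padic_mulC : commutative padic_mul.
Proof. by move=> x y; apply: padic_ext => n /=; rewrite mulrC. Qed.
Fact padic_mul1 : left_id padic_one padic_mul.
Proof.
by move=> x; apply: padic_ext => n /=; rewrite modzMml mul1r padic_mod.
Qed.
Fact padic_mulDl : left_distributive padic_mul padic_add.
Proof.
by move=> x y z; apply: padic_ext => n /=; rewrite modzMml modzDm mulrDl.
Qed.
Fact padic_oner_neq0 : padic_one != padic_zero.
Proof.
apply/eqP => /(congr1 (fun x : Zp => x 1%N)) /=.
rewrite expn1 mod0z modz_small //=.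
by rewrite ltz_nat prime_gt1.
Qed.

HB.instance Definition _ :=
  GRing.Zmodule_isComNzRing.Build Zp padic_mulA padic_mulC padic_mul1
    padic_mulDl padic_oner_neq0.

Definition padic_unit : {pred Zp} := fun x => `[< exists y : Zp, y * x = 1 >].
Definition padic_inv (x : Zp) : Zp :=
  if pselect (exists y : Zp, y * x = 1) is left ex then projT1 (cid ex) else x.

Fact padic_mulVx : {in padic_unit, left_inverse 1 padic_inv *%R}.
Proof.
move=> x /asboolP ux; rewrite /padic_inv.
by case: pselect => // ex; case: (cid ex).
Qed.
Fact padic_unitPl (x y : Zp) : y * x = 1 -> padic_unit x.
Proof. by move=> yx; apply/asboolP; exists y. Qed.
Fact padic_invr_out : {in [predC padic_unit], padic_inv =1 id}.
Proof.
move=> x nux; rewrite /padic_inv; case: pselect => // ex.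
by case/negP: nux; apply/asboolP.
Qed.

HB.instance Definition _ :=
  GRing.ComNzRing_hasMulInverse.Build Zp padic_mulVx padic_unitPl
    padic_invr_out.

Lemma padic_le (x : Zp) n k : (x (n + k)%N = x n %[mod (p ^ n)%N])%Z.
Proof.
elim: k => [|k IH]; first by rewrite addn0.
rewrite addnS -IH; have := padic_step x (n + k).
move=> /eqP; rewrite eqz_mod_dvd => h; apply/eqP; rewrite eqz_mod_dvd.
by apply: dvdz_trans h; rewrite expnD PoszM dvdz_mulr.
Qed.

Lemma padic_neq0 (x : Zp) : x != 0 ->
  exists n, forall k, ~~ ((p ^ n)%N %| x (n + k)%N)%Z.
Proof.
move=> x0; have [n xn] : exists n, x n <> 0.
  apply: contrapT => h; move/eqP: x0; apply; apply: padic_ext => n /=.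
  by rewrite mod0z; apply: contrapT => xn; apply: h; exists n.
exists n => k; apply/negP => /dvdz_mod0P h; apply: xn.
by rewrite -padic_mod -(padic_le x n k).
Qed.

Fact padic_mulf_eq0 : GRing.integral_domain_axiom Zp.
Proof.
move=> x y xy0; apply/norP => -[/padic_neq0[n hx] /padic_neq0[m hy]].
have /(_ m) := hx => {hx}; have /(_ n) := hy => {hy}.
rewrite (addnC m n); set N := (n + m)%N.
have: (x * y) N = (0 : Zp) N by rewrite xy0.
rewrite /= mod0z => /dvdz_mod0P.
rewrite !dvdzE /= abszM expnD; move: `|x N|%N `|y N|%N => a b dab nb na.
have a0 : (0 < a)%N by rewrite lt0n; apply: contraNneq na => ->.
have b0 : (0 < b)%N by rewrite lt0n; apply: contraNneq nb => ->.
move: dab na nb; rewrite -expnD !pfactor_dvdn ?muln_gt0 ?a0 //.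
rewrite lognM // -!ltnNge => h1 h2 h3.
by move: (leq_ltn_trans h1 (leq_add h2 (ltnW h3))); rewrite ltnn.
Qed.

HB.instance Definition _ :=
  GRing.ComUnitRing_isIntegral.Build Zp padic_mulf_eq0.

End PadicRing.

Definition zp_congr (p : nat) (p_pr : prime p) (N : nat) (x y : padic p_pr) :=
  exists c, x - y = p%:R ^+ N * c.

(* Z[D]-modules for a finite group D, written multiplicatively, given by a set
   gset inside an ambient type together with the raw operations. No law is
   bundled: for the ideal groups below the laws are theorems about Z[zeta]
   (every nonzero fractional ideal is invertible). *)
Record gmod (D : finGroupType) := GMod {
  gsort :> Type;
  gset : set gsort;
  gmul : gsort -> gsort -> gsort;
  gone : gsort;
  ginv : gsort -> gsort;
  gact : D -> gsort -> gsort }.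

Arguments gset {D} M : rename.
Arguments gmul {D} M x y : rename.
Arguments gone {D} M : rename.
Arguments ginv {D} M x : rename.
Arguments gact {D} M d x : rename.

Section GroupModules.
Variable D : finGroupType.
Implicit Types M G H : gmod D.

Definition gexpn M (x : M) (n : nat) : M := iter n (gmul M x) (gone M).

Definition gexpz M (x : M) (k : int) : M :=
  match k with
  | Posz n => gexpn x n
  | Negz n => ginv M (gexpn x n.+1)
  end.

(* x ^ b for b in the integral group ring Z[D], seen as a function D -> int. *)
Definition gpow M (x : M) (b : D -> int) : M :=
  \big[gmul M/gone M]_(d : D) gexpz (gact M d x) (b d).

Definition gsubgroup M (S : set M) : Prop :=
  [/\ S `<=` gset M, S (gone M),
      forall x y, S x -> S y -> S (gmul M x y) &
      forall x, S x -> S (ginv M x)].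

Definition gsubmodule M (S : set M) : Prop :=
  gsubgroup S /\ forall d x, S x -> S (gact M d x).

Definition gsub M (S : set M) : gmod D :=
  GMod S (gmul M) (gone M) (ginv M) (gact M).

Definition gcoset M (N : set M) (x : M) : set M := [set gmul M x y | y in N].

(* The quotient M / N: its elements are the cosets of N, with the setwise
   operations. *)
Definition gquo M (N : set M) : gmod D :=
  @GMod D (set M) [set gcoset N x | x in gset M]
    (fun X Y => [set gmul M x y | x in X & y in Y])
    (gcoset N (gone M))
    (fun X => [set ginv M x | x in X])
    (fun d X => [set gact M d x | x in X]).

Definition ghom G H (phi : G -> H) : Prop :=
  {homo phi : x / gset G x >-> gset H x} /\
  forall x y, gset G x -> gset G y -> phi (gmul G x y) = gmul H (phi x) (phi y).

Definition giso G H (phi : G -> H) : Prop :=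
  ghom phi /\ set_bij (gset G) (gset H) phi.

Definition gkilled M (e : nat) : Prop :=
  forall x, gset M x -> gexpn x e = gone M.

Definition gexponent M (e : nat) : Prop :=
  [/\ (0 < e)%N, gkilled M e &
      forall e', (0 < e')%N -> gkilled M e' -> (e <= e')%N].

(* The number of elements of a finite set (0 if S is infinite). *)
Definition cardinal (T : Type) (S : set T) : nat :=
  xget 0%N [set n | (S #= `I_n)%card].

Definition gsylow (p : nat) M (S : set M) : Prop :=
  gsubgroup S /\ cardinal S = (p ^ logn p (cardinal (gset M)))%N.

Section Components.
Variables (p : nat) (p_pr : prime p).
Implicit Type rho : D -> padic p_pr.

(* Homomorphisms from D to the unit group of the p-adic integers. *)
Definition padic_char rho : Prop :=
  (forall d, rho d \is a GRing.unit) /\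
  (forall d d', rho (d * d')%g = rho d * rho d').

(* The idempotent e_rho of Z_p[D], for #|D| = p - 1. *)
Definition idem rho : D -> padic p_pr :=
  fun d => (p.-1)%:R^-1 * (rho d)^-1.

Definition gring_congr (N : nat) (b : D -> int) (e : D -> padic p_pr) : Prop :=
  forall d, zp_congr N (b d)%:~R (e d).

(* M(rho) = e_rho M for M killed by a power p ^ N of p: the group ring Z_p[D]
   acts on M through its quotient (Z/p^N)[D]. *)
Definition gcomp M rho : gmod D :=
  gsub [set y | exists N b x, [/\ gkilled M (p ^ N), gring_congr N b (idem rho),
                                  gset M x & y = gpow x b]].

End Components.
End GroupModules.

Section Cyclotomic.
Variables (p : nat) (L : splittingFieldType rat) (zeta : L).

(* gal_of {:L} is the full Galois group of L over Q. *)
Notation Delta := (gal_of {:L}).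

(* The automorphism zeta |-> zeta ^ a, for a prime to p (1 by default). *)
Definition sigma (a : int) : Delta :=
  odflt 1%g [pick s : Delta | s zeta == zeta ^ a].

Definition gring_minus (b : Delta -> int) : Prop :=
  forall d, b ((sigma (-1))^-1 * d)%g = - b d.

Definition ring_int : set L :=
  [set x | exists q : {poly int}, x = (map_poly intr q).[zeta]].
Notation O := ring_int.

(* Nonzero finitely generated O-submodules of L. *)
Definition frac_ideal : set (set L) :=
  [set I | (exists2 x, I x & x != 0) /\
           exists s : seq L, I = [set x | exists c : 'I_(size s) -> L,
             (forall i, O (c i)) /\ x = \sum_(i < size s) c i * s`_i]].

Definition ideal_mul (I J : set L) : set L :=
  [set x | exists n (a b : 'I_n -> L),
     [/\ forall i, I (a i), forall i, J (b i) & x = \sum_i a i * b i]].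

Definition ideal_inv (I : set L) : set L :=
  [set x | forall y, I y -> O (x * y)].

Definition ideal_gen (a : L) : set L := [set a * x | x in O].

Definition frac_ideals : gmod Delta :=
  GMod frac_ideal ideal_mul O ideal_inv
    (fun (s : Delta) I => [set s x | x in I]).

Definition principal : set (set L) :=
  [set I | exists2 a : L, a != 0 & I = ideal_gen a].

Definition Cl : gmod Delta := gquo (principal : set frac_ideals).

Definition ideal_class (I : set L) : Cl :=
  gcoset (principal : set frac_ideals) I.

Definition integral_prime_to_p (I : set L) : Prop :=
  [/\ frac_ideal I, I `<=` O &
      exists b c, [/\ I b, O c & b + p%:R * c = 1]].

Definition prime_to_p : set (set L) :=
  [set I | exists B C, [/\ integral_prime_to_p B, integral_prime_to_p C &
                           I = ideal_mul B (ideal_inv C)]].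

Definition ideals_p : gmod Delta := gsub (prime_to_p : set frac_ideals).

Definition principal_p : set (set L) := prime_to_p `&` principal.

(* The subgroup I^q P of the group I of ideals prime to p. *)
Definition powers_principal_p (q : nat) : set (set L) :=
  [set ideal_mul (gexpn (B : ideals_p) q) P
     | B in prime_to_p & P in principal_p].

Definition ideals_mod (q : nat) : gmod Delta :=
  gquo (powers_principal_p q : set ideals_p).

Definition ideal_mod (q : nat) (I : set L) : ideals_mod q :=
  gcoset (powers_principal_p q : set ideals_p) I.

Definition Lstar : gmod Delta :=
  @GMod Delta L [set x | x != 0] *%R 1 GRing.inv (fun (s : Delta) x => s x).

Definition Lpowers (q : nat) : set L := [set x ^+ q | x in gset Lstar].

Definition L_mod (q : nat) : gmod Delta := gquo (Lpowers q : set Lstar).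

Definition elt_mod (q : nat) (x : L) : L_mod q :=
  gcoset (Lpowers q : set Lstar) x.

Section LocalField.
Variables (p_pr : prime p) (K : fieldExtType {fraction (padic p_pr)}).
Variable iota : {rmorphism L -> K}.

Definition local_int : set K :=
  [set z | exists q : {poly padic p_pr},
             z = (map_poly (fun c => (tofrac c)%:A) q).[iota zeta]].

(* U = 1 + pi^2 Z_p[zeta], with pi = zeta - 1. *)
Definition local_units : set K :=
  [set 1 + (iota zeta - 1) ^+ 2 * z | z in local_int].

(* b is the element beta(f) of Z[Delta], which is determined by f. *)
Definition has_beta (f : set L -> L) (b : Delta -> int) : Prop :=
  forall a : L, a != 0 -> local_units (iota a) ->
    f (ideal_gen a) = gpow (a : Lstar) b.

(* The elements of calW are given as functions on all subsets of L, whose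
   values matter only on the ideals prime to p. *)
Definition calW : set (set L -> L) :=
  [set f | [/\ ghom (f : ideals_p -> Lstar),
               forall (s : Delta) (I : ideals_p), prime_to_p I ->
                 f (gact ideals_p s I) = s (f I),
               forall I, prime_to_p I -> local_units (iota (f I)) &
               exists b, has_beta f b]].

Definition calW_minus : set (set L -> L) :=
  [set f | calW f /\
           forall I, prime_to_p I -> sigma (-1) (f I) = (f I)^-1].

Definition W : set L :=
  smallest (gsubmodule (M := Lstar))
    [set x | exists f I, [/\ calW f, prime_to_p I & x = f I]].

Definition W_mod (q : nat) : gmod Delta :=
  @gquo Delta (gsub ([set w * y | w in W & y in Lpowers q] : set Lstar))
    (Lpowers q).

End LocalField.

(* The values of such a w are automatically (p - 1)-th roots of unity. *)
Definition teichmuller (p_pr : prime p) (w : Delta -> padic p_pr) : Prop :=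
  padic_char w /\
  forall a : nat, coprime p a -> zp_congr 1 (w (sigma a%:Z)) a%:R.

End Cyclotomic.

Arguments principal {L} zeta I.
Arguments ideal_class {L} zeta I.
Arguments prime_to_p p {L} zeta I.
Arguments ideals_mod p {L} zeta q.
Arguments ideal_mod p {L} zeta q I.
Arguments has_beta {p L} zeta {p_pr K} iota f b.
Arguments calW_minus {p L} zeta {p_pr K} iota f.
Arguments W_mod {p L} zeta {p_pr K} iota q.

(* Main.v *)
(* Every f in calW satisfies f(I) O = I^beta(f): this holds up to a power because
   some power of I has a generator in U, and the group of fractional ideals is
   torsion free. So beta(f) annihilates the class group.

   Injectivity: if f_psi(I) = gamma^(p^k) then I^(2 n e_m) = gamma O, again by
   torsion-freeness, and on A(psi) the exponent 2 n e_m acts as the unit 2 n.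

   Surjectivity: for g in calW, beta(g) kills A(psi), so p^k divides psi(beta(g)),
   and comparing g(I)^beta(f_psi) with f_psi(I)^beta(g) expresses g(I)^(e_psi) as a
   value of f_psi times a p^k-th power; the p-power roots of unity met on the way
   vanish in the psi-component because psi is not the Teichmueller character.

   That fractional ideals form a group with finitely many classes is obtained
   directly for Z[zeta]: a pigeonhole argument on norms bounds the classes, so two
   powers of an ideal I are proportional, and the determinant trick with the
   integral closedness of Z[zeta] makes I invertible. *)

(* A principal ideal prime to p need not have a generator in U. Its (p - 1)-st power does: by Fermat
   a^(p-1) is 1 modulo pi, and a power of zeta, which leaves the ideal unchanged, corrects it modulo
   pi^2. So [has_beta] is only ever applied after multiplication by p - 1, a factor that is then
   removed by Bezout against a power of p, or by torsion-freeness. The factor 2 n of beta(f_psi),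
   prime to p, is removed by Bezout too.

   The obstacle in the surjectivity is that L^* carries no action of Z_p: e_psi acts on it only
   through integral lifts, and each identity for e_psi holds only up to p^N-th powers. The precision
   N must be large enough to survive a division by p^k. Congruences with explicit error terms
   therefore replace the idempotent calculus, and psi-components are handled as eigenspaces.

   Integral closedness of Z[zeta] is reached in two stages: the trace form shows that p x lies in
   Z[zeta] for integral x, and the powers of 1 - zeta in p are then cancelled one by one. *)
From HB Require Import structures.
Require Import Defs.
From mathcomp Require Import all_boot all_order all_algebra all_fingroup.
From mathcomp Require Import all_field.
From mathcomp Require Import boolp classical_sets functions cardinality ring.

Set Implicit Arguments.
Unset Strict Implicit.
Unset Printing Implicit Defensive.

Import Order.TTheory GRing.Theory Num.Theory.
Local Open Scope classical_set_scope.
Local Open Scope ring_scope.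

(** * Congruences in the p-adic integers *)

Section PadicFacts.
Variables (p : nat) (p_pr : prime p).
Notation Zp := (padic p_pr).

Lemma padic_coord_nat (a n : nat) : (a%:R : Zp) n = (a%:Z %% (p ^ n)%N)%Z.
Proof.
elim: a => [|a IH]; first by rewrite /= mod0z.
by rewrite -natr1 /= IH modzDm -PoszD addn1.
Qed.

Lemma padic_coord_int (a : int) n : (a%:~R : Zp) n = (a %% (p ^ n)%N)%Z.
Proof.
case: a => a; first exact: padic_coord_nat.
rewrite NegzE mulrNz /= -[(a.+1%:Z)%:~R]/(a.+1%:R) padic_coord_nat.
by rewrite modzNm.
Qed.

Lemma zp_congr_int N (a b : int) :
  @zp_congr p p_pr N a%:~R b%:~R <-> (a = b %[mod (p ^ N)%N])%Z.
Proof.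
split=> [[c]|].
  rewrite -rmorphB /= => /(congr1 (fun x : Zp => x N)).
  rewrite padic_coord_int /= -natrX padic_coord_nat modzz mul0r mod0z.
  by move/dvdz_mod0P => h; apply/eqP; rewrite eqz_mod_dvd.
move=> /eqP; rewrite eqz_mod_dvd => /dvdzP[c hc]; exists c%:~R.
by rewrite -rmorphB /= hc rmorphM /= mulrC -natrX.
Qed.

Lemma zp_congr_refl N (x : Zp) : zp_congr N x x.
Proof. by exists 0; rewrite subrr mulr0. Qed.

Lemma zp_congr_sym N (x y : Zp) : zp_congr N x y -> zp_congr N y x.
Proof. by case=> c hc; exists (- c); rewrite mulrN -hc opprB. Qed.

Lemma zp_congr_trans N (y x z : Zp) :
  zp_congr N x y -> zp_congr N y z -> zp_congr N x z.
Proof.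
by case=> c hc [d hd]; exists (c + d); rewrite mulrDr -hc -hd addrA subrK.
Qed.

Lemma zp_congrD N (x y x' y' : Zp) :
  zp_congr N x y -> zp_congr N x' y' -> zp_congr N (x + x') (y + y').
Proof.
case=> c hc [d hd]; exists (c + d).
by rewrite mulrDr -hc -hd opprD addrACA.
Qed.

Lemma zp_congrM N (x y x' y' : Zp) :
  zp_congr N x y -> zp_congr N x' y' -> zp_congr N (x * x') (y * y').
Proof.
case=> c hc [d hd]; exists (c * x' + y * d).
rewrite mulrDr mulrA -hc (mulrCA _ y) -hd mulrBl mulrBr.
by rewrite addrA subrK.
Qed.

Lemma zp_congr_sum N (I : Type) (r : seq I) (F G : I -> Zp) :
  (forall i, zp_congr N (F i) (G i)) ->
  zp_congr N (\sum_(i <- r) F i) (\sum_(i <- r) G i).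
Proof.
move=> h; elim/big_ind2: _ => //; first exact: zp_congr_refl.
by move=> *; apply: zp_congrD.
Qed.

Lemma zp_congr_le N N' (x y : Zp) : (N' <= N)%N ->
  zp_congr N x y -> zp_congr N' x y.
Proof.
move=> le [c hc]; exists (p%:R ^+ (N - N') * c).
by rewrite mulrA -exprD subnKC.
Qed.

(** The quotient is built coordinatewise: every [x (N + n)] is divisible by p^N, and coherence of
    [x] determines the quotient modulo p^n. *)
Lemma padic_coord0 N (x : Zp) : x N = 0 -> exists c, x = p%:R ^+ N * c.
Proof.
move=> xN.
have pp n : (p ^ n)%N%:Z != 0 by rewrite -lt0n expn_gt0 prime_gt0.
have dv n : ((p ^ N)%N %| x (N + n)%N)%Z.
  by apply/dvdz_mod0P; rewrite padic_le xN mod0z.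
pose f n := (x (N + n)%N %/ (p ^ N)%N)%Z.
have fE n : f n * (p ^ N)%N = x (N + n)%N by rewrite divzK.
have hf n : (f n.+1 = f n %[mod (p ^ n)%N])%Z.
  apply/eqP; rewrite eqz_mod_dvd -(@dvdz_mul2r (p ^ N)%N) //.
  rewrite mulrBl !fE -PoszM -expnD -eqz_mod_dvd addnS [(n + N)%N]addnC.
  by apply/eqP; apply: padic_step.
exists (padic_reduce p_pr hf); apply: padic_ext => n /=.
rewrite -natrX padic_coord_nat modzMml modzMmr mulrC fE addnC.
by rewrite padic_le padic_mod.
Qed.

Lemma padic_approx N (x : Zp) : zp_congr N (x N)%:~R x.
Proof.
apply/zp_congr_sym.
have : (x - (x N)%:~R) N = 0.
  by rewrite /= padic_coord_int padic_mod modzDmr subrr mod0z.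
by case/padic_coord0 => c hc; exists c.
Qed.

(** The Bezout inverses [u n] of [a] modulo p^n are chosen independently; they are coherent because
    an inverse modulo p^n is unique. *)
Lemma padic_unit_int (a : int) : coprimez a p%:Z -> (a%:~R : Zp) \is a GRing.unit.
Proof.
move=> co.
have co' n : exists u : int, ((p ^ n)%N %| u * a - 1)%Z.
  have : coprimez a (p ^ n)%N by rewrite coprimezE coprimeXr.
  by case/coprimezP => -[u v] /= e; exists u; rewrite -e opprD addrA subrr sub0r rpredN dvdz_mull.
pose u n := projT1 (cid (co' n)).
have uE n : ((p ^ n)%N %| u n * a - 1)%Z by apply: projT2 (cid (co' n)).
have hu n : (u n.+1 = u n %[mod (p ^ n)%N])%Z.
  apply/eqP; rewrite eqz_mod_dvd.
  have cop : coprimez (p ^ n)%N a.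
    by rewrite coprimez_sym coprimezE coprimeXr.
  rewrite -(@Gauss_dvdzl _ _ a) // mulrBl.
  rewrite -(subrK 1 (u n.+1 * a)) -addrA -[1 - _]opprB; apply: rpredB => //.
  by apply: dvdz_trans (uE n.+1); rewrite expnSr PoszM dvdz_mulr.
apply: (@padic_unitPl _ _ _ (padic_reduce p_pr hu)).
apply: padic_ext => n /=; rewrite padic_coord_int modzMmr modzMml.
by apply/eqP; rewrite eqz_mod_dvd.
Qed.

End PadicFacts.

(** * Modules over an integral group ring *)

(** Additivity is a bare hypothesis because the maps to which this applies, such as the class map
    and the lift of [f], are plain functions and not bundled morphisms. *)
Lemma morph_Mn (V V' : zmodType) (h : V -> V') : {morph h : x y / x + y} ->
  forall x i, h (x *+ i) = h x *+ i.
Proof.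
move=> hD x; elim=> [|i IH]; last by rewrite !mulrS hD IH.
by rewrite !mulr0n; apply: (addrI (h 0)); rewrite -hD !addr0.
Qed.

Lemma morph_opp (V V' : zmodType) (h : V -> V') : {morph h : x y / x + y} ->
  forall x, h (- x) = - h x.
Proof.
move=> hD x; apply: (addrI (h x)); rewrite -hD !subrr.
exact: (morph_Mn hD 0 0).
Qed.

Lemma morph_Mz (V V' : zmodType) (h : V -> V') : {morph h : x y / x + y} ->
  forall x (a : int), h (x *~ a) = h x *~ a.
Proof.
move=> hD x [i|i]; first exact: morph_Mn.
by rewrite NegzE !mulrNz (morph_opp hD) -!pmulrn (morph_Mn hD).
Qed.

(* Modules are written additively here: dpow x b is the power x ^ b of the
   multiplicative notation. *)
Record dmod (D : finGroupType) := DMod {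
  dsort :> zmodType;
  dact : D -> dsort -> dsort;
  dactD : forall d x y, dact d (x + y) = dact d x + dact d y;
  dactM : forall d e x, dact e (dact d x) = dact (d * e)%g x }.

Section DMod.
Variables (D : finGroupType) (D_abel : commutative (@mulg D)).

Section Powers.
Variable M : dmod D.
Implicit Types (x y : M) (b c : D -> int).

Lemma dact0 d : dact d (0 : M) = 0.
Proof. by apply: (addrI (dact d 0)); rewrite -dactD !addr0. Qed.

Lemma dactN d x : dact d (- x) = - dact d x.
Proof. by apply: (addrI (dact d x)); rewrite -dactD !subrr dact0. Qed.

Lemma dactMn d x n : dact d (x *+ n) = dact d x *+ n.
Proof. by elim: n => [|n IH]; rewrite ?mulr0n ?dact0 // !mulrS dactD IH. Qed.

Lemma dactMz d x (a : int) : dact d (x *~ a) = dact d x *~ a.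
Proof. by case: a => n; rewrite ?NegzE ?mulrNz ?dactN -!pmulrn dactMn. Qed.

Lemma dact_sum d (I : Type) (r : seq I) (F : I -> M) :
  dact d (\sum_(i <- r) F i) = \sum_(i <- r) dact d (F i).
Proof. by elim/big_rec2: _ => [|i y z _ <-]; rewrite ?dact0 ?dactD. Qed.

Definition dpow x b : M := \sum_d dact d x *~ b d.

Lemma dpowDl x y b : dpow (x + y) b = dpow x b + dpow y b.
Proof. by rewrite -big_split; apply: eq_bigr => d _; rewrite dactD mulrzDl. Qed.

Lemma dpow0l b : dpow 0 b = 0.
Proof. by apply: big1 => d _; rewrite dact0 mul0rz. Qed.

Lemma dpowNl x b : dpow (- x) b = - dpow x b.
Proof. by apply: (addrI (dpow x b)); rewrite -dpowDl !subrr dpow0l. Qed.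

Lemma dpowMzl x b (a : int) : dpow (x *~ a) b = dpow x b *~ a.
Proof.
by rewrite /dpow mulrz_suml; apply: eq_bigr => d _; rewrite dactMz mulrzAC.
Qed.

Lemma dpowMnl x b n : dpow (x *+ n) b = dpow x b *+ n.
Proof. by rewrite !pmulrn dpowMzl. Qed.

Lemma dpowDr x b c : dpow x (fun d => b d + c d) = dpow x b + dpow x c.
Proof. by rewrite -big_split; apply: eq_bigr => d _; rewrite mulrzDr. Qed.

Lemma dpowZr x b (a : int) : dpow x (fun d => a * b d) = dpow x b *~ a.
Proof.
rewrite /dpow mulrz_suml; apply: eq_bigr => d _.
by rewrite mulrC mulrzA.
Qed.

Lemma dpow_act d x b : dpow (dact d x) b = dact d (dpow x b).
Proof.
rewrite dact_sum; apply: eq_bigr => e _.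
by rewrite dactMz !dactM D_abel.
Qed.

Lemma dpow_dpow x b c : dpow (dpow x b) c = dpow (dpow x c) b.
Proof.
rewrite /dpow; under eq_bigr do rewrite dact_sum mulrz_suml.
rewrite exchange_big; apply: eq_bigr => d _.
rewrite dact_sum mulrz_suml; apply: eq_bigr => e _.
by rewrite !dactMz !dactM D_abel mulrzAC.
Qed.

(** The error comes from the same [x], so it disappears as soon as N kills [x], and otherwise counts
    as an N-th power. *)
Lemma dpow_diff x b c (N : nat) : (forall d, (b d = c d %[mod N])%Z) ->
  exists a, dpow x b = dpow x c + dpow x a *+ N.
Proof.
move=> bc.
have bc' d : exists a : int, b d = c d + a * N%:Z.
  have /eqP := bc d; rewrite eqz_mod_dvd => /dvdzP[a e].
  by exists a; rewrite -e addrC subrK.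
exists (fun d => projT1 (cid (bc' d))).
rewrite pmulrn -dpowZr -dpowDr; apply: eq_bigr => d _.
by rewrite {1}(projT2 (cid (bc' d))) [N%:Z * _]mulrC.
Qed.

End Powers.

Lemma dpow_morph (M N : dmod D) (f : M -> N) :
  {morph f : x y / x + y} -> (forall d x, f (dact d x) = dact d (f x)) ->
  forall x b, f (dpow x b) = dpow (f x) b.
Proof.
move=> fD fa x b.
rewrite /dpow; elim/big_rec2: _ => [|d y z _ <-]; first exact: (morph_Mn fD 0 0).
by rewrite fD (morph_Mz fD) fa.
Qed.

(* The psi-component of a module killed by a power of p consists of the
   elements on which each d acts as multiplication by psi d. *)
Section Eigen.
Variables (p : nat) (p_pr : prime p) (cardD : #|D| = p.-1).
Variables (psi : D -> padic p_pr) (psi_char : padic_char psi).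

(** An element killed by p^N sees [psi d] only modulo p^N, so the eigenvalue is expressed through
    integers approximating it and no action of Z_p has to be constructed. The condition is empty on
    elements that no power of p kills. *)
Definition eigen (M : dmod D) (x : M) :=
  forall N d (r : int), zp_congr N r%:~R (psi d) ->
    x *+ (p ^ N) = 0 -> dact d x = x *~ r.

Lemma charM d e : psi (d * e)%g = psi d * psi e.
Proof. by case: psi_char. Qed.

Lemma char_unit d : psi d \is a GRing.unit.
Proof. by case: psi_char. Qed.

(** This is d e_psi = psi(d) e_psi in Z_p[D], read off coefficient by coefficient. *)
Lemma idem_shift d e : idem psi (d^-1 * e)%g = psi d * idem psi e.
Proof.
rewrite /idem mulrCA; congr (_ * _).
have -> : psi e = psi d * psi (d^-1 * e)%g by rewrite -charM mulKVg.
by rewrite invrM ?char_unit // mulrCA mulrV ?mulr1 ?char_unit.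
Qed.

Lemma pred_unit : (p.-1%:R : padic p_pr) \is a GRing.unit.
Proof.
apply: (padic_unit_int p_pr (a := p.-1%:Z)); rewrite coprimezE /=.
by rewrite -{2}(prednK (prime_gt0 p_pr)) coprimenS.
Qed.

(** The character psi, extended linearly to Z_p[D], is 1 at e_psi: the order p - 1 of D cancels the
    denominator. *)
Lemma idem_sum : \sum_d idem psi d * psi d = 1.
Proof.
rewrite (eq_bigr (fun=> p.-1%:R^-1)) => [|d _].
  by rewrite sumr_const cardD -[RHS](mulVr pred_unit) mulr_natr.
by rewrite /idem -mulrA mulVr ?mulr1 ?char_unit.
Qed.

Lemma gring_congr_le N N' (b : D -> int) (e : D -> padic p_pr) : (N' <= N)%N ->
  gring_congr N b e -> gring_congr N' b e.
Proof. by move=> le h d; apply: zp_congr_le le (h d). Qed.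

Lemma gring_congr_mod N (b c : D -> int) (e : D -> padic p_pr) :
  gring_congr N b e -> gring_congr N c e ->
  forall d, (b d = c d %[mod (p ^ N)%N])%Z.
Proof.
move=> hb hc d; apply/(@zp_congr_int _ p_pr).
exact: zp_congr_trans (hb d) (zp_congr_sym (hc d)).
Qed.

Definition approx N (e : D -> padic p_pr) : D -> int := fun d => e d N.

Lemma approxP N e : gring_congr N (approx N e) e.
Proof. by move=> d; apply: padic_approx. Qed.

Lemma mulz_congr (V : zmodType) (x : V) (N : nat) (a b : int) :
  x *+ N = 0 -> (a = b %[mod N])%Z -> x *~ a = x *~ b.
Proof.
move=> xN /eqP; rewrite eqz_mod_dvd => /dvdzP[c e].
rewrite -[a](subrK b) e mulrzDr mulrC mulrzA -pmulrn xN.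
by rewrite mul0rz add0r.
Qed.

(** An integral lift of e_psi satisfies d e_psi = psi(d) e_psi only modulo p^N. As [x] may have
    infinite order, the error stays in the statement, which makes it usable in L^*. *)
Lemma dpow_shift N (M : dmod D) (x : M) b d (r : int) :
  gring_congr N b (idem psi) -> zp_congr N r%:~R (psi d) ->
  exists a, dact d (dpow x b) = dpow x b *~ r + dpow x a *+ (p ^ N).
Proof.
move=> hb hr.
have [a e] : exists a, dpow x (fun e => b (d^-1 * e)%g) =
    dpow x (fun e => r * b e) + dpow x a *+ (p ^ N).
  apply: dpow_diff => e; apply/(@zp_congr_int _ p_pr).
  apply: zp_congr_trans (hb _) _; rewrite idem_shift rmorphM.
  by apply: zp_congrM; [apply: zp_congr_sym|apply/zp_congr_sym/hb].
exists a; rewrite -dpowZr -e -dpow_act /dpow.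
rewrite [RHS](reindex_inj (mulgI d)); apply: eq_bigr => f _.
by rewrite dactM mulKg.
Qed.

Lemma eigen_dpow N (M : dmod D) (x : M) b :
  x *+ (p ^ N) = 0 -> gring_congr N b (idem psi) -> eigen (dpow x b).
Proof.
move=> xN hb N' d r hr xN'.
have xb : dpow x b *+ (p ^ N) = 0 by rewrite -dpowMnl xN dpow0l.
have [a ->] := dpow_shift x hb (padic_approx N (psi d)).
rewrite -dpowMnl xN dpow0l addr0.
(* Both p^N and p^N' kill the element, so the approximations of [psi d] need only agree to the
   smaller of the two precisions. *)
case: (leqP N N') => le.
  apply: mulz_congr xb _; apply/(@zp_congr_int _ p_pr).
  apply: zp_congr_trans (padic_approx _ _) _.
  exact: zp_congr_le le (zp_congr_sym hr).
apply: mulz_congr xN' _; apply/(@zp_congr_int _ p_pr).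
apply: zp_congr_trans (zp_congr_sym hr).
exact: zp_congr_le (ltnW le) (padic_approx _ _).
Qed.

Lemma dpow_eigen N (M : dmod D) (x : M) b (c : int) :
  x *+ (p ^ N) = 0 -> eigen x ->
  zp_congr N c%:~R (\sum_d (b d)%:~R * psi d) -> dpow x b = x *~ c.
Proof.
move=> xN ex hc; rewrite /dpow.
rewrite (eq_bigr (fun d => x *~ (psi d N * b d))) => [|d _]; last first.
  by rewrite mulrzA; congr (_ *~ _); apply: ex xN; apply: padic_approx.
rewrite -mulrz_sumr; apply: mulz_congr xN _; apply/(@zp_congr_int _ p_pr).
apply: zp_congr_trans (zp_congr_sym hc); rewrite rmorph_sum /=.
apply: zp_congr_sum => d; rewrite rmorphM /= mulrC.
by apply: zp_congrM (padic_approx _ _); apply: zp_congr_refl.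
Qed.

Lemma congr_idem_sum N b : gring_congr N b (idem psi) ->
  zp_congr N 1 (\sum_d (b d)%:~R * psi d).
Proof.
move=> hb; rewrite -{1}idem_sum; apply: zp_congr_sum => d.
by apply: zp_congrM (zp_congr_sym (hb d)) (zp_congr_refl _ _).
Qed.

Lemma dpow_idem N (M : dmod D) (x : M) b :
  x *+ (p ^ N) = 0 -> eigen x -> gring_congr N b (idem psi) -> dpow x b = x.
Proof.
by move=> xN ex /congr_idem_sum hb; rewrite (dpow_eigen (c := 1) xN ex) ?mulr1z.
Qed.

(** In a module with elements of infinite order, [dpow x e] is an eigenvector only up to p^N-th
    multiples; the group ring still acts on it, up to such multiples, through an integer [c]
    approximating psi(b). *)
Lemma dpow_idem_dpow N (M : dmod D) (x : M) b e (c : int) :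
  gring_congr N e (idem psi) ->
  zp_congr N c%:~R (\sum_d (b d)%:~R * psi d) ->
  exists y, dpow (dpow x e) b = dpow x e *~ c + y *+ (p ^ N).
Proof.
move=> he hc.
have sh d : exists y, dact d (dpow x e) = dpow x e *~ psi d N + y *+ (p ^ N).
  by have [a ->] := dpow_shift x he (padic_approx N (psi d)); exists (dpow x a).
pose y d := projT1 (cid (sh d)).
have hy d : dact d (dpow x e) = dpow x e *~ psi d N + y d *+ (p ^ N).
  exact: projT2 (cid (sh d)).
have /eqP : (\sum_d psi d N * b d = c %[mod (p ^ N)%N])%Z.
  apply/(@zp_congr_int _ p_pr).
  apply: zp_congr_trans (zp_congr_sym hc); rewrite rmorph_sum /=.
  apply: zp_congr_sum => d; rewrite rmorphM /= mulrC.
  by apply: zp_congrM (padic_approx _ _); apply: zp_congr_refl.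
rewrite eqz_mod_dvd => /dvdzP[t ht].
exists (dpow x e *~ t + \sum_d y d *~ b d).
rewrite /dpow -/(dpow x e); under eq_bigr do rewrite hy mulrzDl -mulrzA.
rewrite big_split /= -mulrz_sumr -[\sum_d _ * _](subrK c) ht mulrzDr.
rewrite mulrnDl addrA [LHS]addrC mulrzA -pmulrn.
have -> : \sum_d y d *+ (p ^ N) *~ b d = (\sum_d y d *~ b d) *+ (p ^ N).
  by rewrite -sumrMnl; apply: eq_bigr => d _; rewrite !pmulrn mulrzAC.
by rewrite addrC [dpow x e *~ c + _]addrC.
Qed.

(* E, C and X stand for the ideals prime to p, the class group and L^*, f for
   the homomorphism of the theorem and g for any element of calW. *)
Section Core.
Variables (E X C : dmod D) (cl : E -> C) (n s k m : nat).
Hypotheses (clD : {morph cl : x y / x + y})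
  (clA : forall d x, cl (dact d x) = dact d (cl x))
  (cl_surj : forall y, exists x, cl x = y)
  (p_odd : odd p) (co_np : coprime n p)
  (C_exp : forall y : C, y *+ (n * p ^ s) = 0)
  (k_min : forall t, (forall y : C, y *+ (p ^ s) = 0 -> eigen y ->
     y *+ (p ^ t) = 0) -> (k <= t)%N)
  (le_km : (k <= m)%N).
Variables (em : D -> int) (em_congr : gring_congr m em (idem psi)).
Hypothesis X_tors : forall (x : X) t N b, (0 < N)%N ->
  gring_congr N b (idem psi) -> x *+ (p ^ t) = 0 -> dpow x b = 0.
Variables (f g : E -> X) (bg : D -> int).
Let bf d := (2 * n * p ^ k)%N%:Z * em d.
Hypotheses (fD : {morph f : x y / x + y})
  (fA : forall d x, f (dact d x) = dact d (f x))
  (gD : {morph g : x y / x + y})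
  (princ : forall x, cl x = 0 -> exists c, f (x *+ p.-1) = dpow c bf /\ g (x *+ p.-1) = dpow c bg)
  (bg_kill : forall y : C, dpow y bg = 0).

(* beta(g) kills C and acts on its psi-component by the scalar psi(beta(g)),
   which is therefore a multiple of the exponent of that component. *)
Lemma char_ideal_dvd N (c : int) : (s <= N)%N ->
  zp_congr N c%:~R (\sum_d (bg d)%:~R * psi d) -> ((p ^ k)%N %| c)%Z.
Proof.
move=> le hc.
have [t tN e] : exists2 t, (t <= s)%N & gcdn (p ^ s) `|c|%N = (p ^ t)%N.
  by apply/dvdn_pfactor; rewrite ?dvdn_gcdl.
rewrite dvdzE /=; apply: (@dvdn_trans (p ^ t)); last by rewrite -e dvdn_gcdr.
apply: dvdn_exp2l; apply: k_min => y ys ey.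
have yc : y *~ c = 0.
  by rewrite -(dpow_eigen ys ey (zp_congr_le le hc)) bg_kill.
have [u [v /= euv]] := Bezoutz (p ^ s)%N c.
have -> : y *+ (p ^ t) = y *~ gcdz (p ^ s)%N c by rewrite /gcdz /= e.
by rewrite -euv mulrzDr [u * _]mulrC [v * _]mulrC !mulrzA yc -pmulrn ys !mul0rz addr0.
Qed.

(** The preimage in X of the image of [f] in X / p^k X. Surjectivity amounts to placing the
    e_psi-part of every value of [g] in it. *)
Definition f_image (x : X) := exists z y, x = f z + y *+ (p ^ k).

Lemma f_imageD x y : f_image x -> f_image y -> f_image (x + y).
Proof.
move=> [z [u ->]] [z' [u' ->]]; exists (z + z'), (u + u').
by rewrite fD mulrnDl addrACA.
Qed.

Lemma f_imageMz x (a : int) : f_image x -> f_image (x *~ a).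
Proof.
move=> [z [u ->]].
have fMn i : f_image ((f z + u *+ (p ^ k)) *+ i).
  by exists (z *+ i), (u *+ i); rewrite (morph_Mn fD) mulrnDl mulrnAC.
case: a => i; first exact: fMn.
rewrite NegzE mulrNz -pmulrn; have [z' [u' ->]] := fMn i.+1.
by exists (- z'), (- u'); rewrite (morph_opp fD) mulNrn opprD.
Qed.

Lemma f_image_mul y : f_image (y *+ (p ^ k)).
Proof. by exists 0, y; rewrite (morph_Mn fD 0 0) mulr0n add0r. Qed.

Lemma f_image_dpow x b : f_image x -> f_image (dpow x b).
Proof.
move=> [z [u ->]]; exists (dpow z b), (dpow u b).
by rewrite (dpow_morph fD fA) dpowDl dpowMnl.
Qed.

(** The quotient of X by this subgroup is killed by p^k, so multiplication by [j] is invertible on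
    it. *)
Lemma f_image_coprime x j : coprime j p -> f_image (x *+ j) -> f_image x.
Proof.
move=> co hx.
have /coprimezP[[u v] /= e] : coprimez j (p ^ k)%N.
  by rewrite coprimezE coprimeXr.
rewrite -[x]mulr1z -e mulrzDr [u * _]mulrC [v * _]mulrC !mulrzA -!pmulrn.
by apply: f_imageD; apply: f_imageMz => //; apply: f_image_mul.
Qed.

(* Since x^(n p^s (p - 1)) has a generator in U, f(x)^beta(g) and g(x)^beta(f)
   agree, after raising to the power n (p - 1), up to p-power torsion, which e_psi
   kills. As beta(f) and psi(beta(g)) are multiples of p^k, one can then extract
   p^k-th roots. *)
Lemma f_image_idem x N b : (k <= N)%N -> gring_congr N b (idem psi) ->
  f_image (dpow (g x) b).
Proof.
move=> leN hb.
(* The summand s lets [char_ideal_dvd] apply and 1 lets [X_tors] apply. Of the two k, one is lost in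
   the division by p^k below and the other keeps the remaining error a p^k-th multiple. *)
pose N' := (s + N + 1 + k + k)%N.
pose e := approx N' (idem psi); have he : gring_congr N' e (idem psi) := approxP _ _.
have [N'_gt0 N's N'k] : [/\ (0 < N')%N, (s <= N')%N & (k <= N')%N].
  by split; rewrite ?leq_addl ?addn_gt0 /= ?orbT // /N' -!addnA leq_addr.
have kill (y : X) t : y *+ (p ^ t) = 0 -> dpow y e = 0 by apply: X_tors N'_gt0 he.
suff: f_image (dpow (g x) e).
  move=> fe; have [a ->] : exists a, dpow (g x) b = dpow (g x) e + dpow (g x) a *+ (p ^ k).
    by apply: dpow_diff; apply: gring_congr_mod (gring_congr_le leN hb) (gring_congr_le N'k he).
  exact: f_imageD fe (f_image_mul _).
pose T := (n * p.-1)%N.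
have [c [fc gc]] : exists c, f (x *+ (n * p ^ s) *+ p.-1) = dpow c bf /\ g (x *+ (n * p ^ s) *+ p.-1) = dpow c bg.
  by apply: princ; rewrite (morph_Mn clD).
rewrite !mulrnA in fc gc; pose G := g x *+ T; pose F := f x *+ T.
have TE : (n * p ^ s * p.-1 = T * p ^ s)%N by rewrite /T mulnAC.
(* Multiplied by p^s, [dpow G bf] and [dpow F bg] both become [c] raised to beta(f) beta(g); their
   difference is p-power torsion, which e_psi kills. *)
have GF : dpow (dpow G bf) e = dpow (dpow F bg) e.
  apply/eqP; rewrite -subr_eq0 -dpowNl -dpowDl; apply/eqP.
  apply: (kill _ s); rewrite mulrnDl mulNrn -!dpowMnl /G /F -!mulrnA -TE !mulrnA.
  by rewrite -!(morph_Mn fD) -!(morph_Mn gD) fc gc dpow_dpow subrr.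
pose c0 := (\sum_d (bg d)%:~R * psi d) N'.
have hc0 : zp_congr N' c0%:~R (\sum_d (bg d)%:~R * psi d) by apply: padic_approx.
have /dvdzP[c' c'E] := char_ideal_dvd N's hc0.
have [y hy] := dpow_idem_dpow F he hc0.
have hG : dpow (dpow G bf) e = dpow (dpow G em) e *+ (2 * n) *+ (p ^ k).
  by rewrite /bf dpowZr dpowMzl -pmulrn mulrnA.
(* All three terms of the comparison contain the factor p^k; taking it out leaves an element of
   p^k-torsion, again killed by e_psi. *)
have /kill : (dpow (dpow G em) e *+ (2 * n) - dpow F e *~ c' - y *+ (p ^ (N' - k))) *+ (p ^ k) = 0.
  rewrite !mulrnBl -hG GF dpow_dpow hy c'E mulrzA -pmulrn -mulrnA -expnD subnK //.
  by rewrite addrAC addrK subrr.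
rewrite !dpowDl !dpowNl dpowMnl dpowMzl => /eqP; rewrite -addrA -opprD subr_eq0 => /eqP h.
have [y1 h1] : exists y1, dpow G em = dpow G e + dpow G y1 *+ (p ^ k).
  apply: dpow_diff.
  exact: gring_congr_mod (gring_congr_le le_km em_congr) (gring_congr_le N'k he).
have [y2 h2] := dpow_idem_dpow (b := e) (c := 1) G he (congr_idem_sum he).
(* Modulo p^k, [em] and [e] lift the same idempotent, so applying them in succession amounts to
   applying [e] once, up to p^k-th multiples. *)
have [z hz] : exists z, dpow (dpow (dpow G em) e) e = dpow G e + z *+ (p ^ k).
  exists ((y2 + dpow y2 e) *+ (p ^ (N' - k)) + dpow (dpow (dpow G y1) e) e).
  clear hG h GF; clearbody G; rewrite h1 !dpowDl !dpowMnl h2 !dpowDl mulr1z !dpowMnl h2 mulr1z.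
  by rewrite !mulrnDl -!mulrnA -!expnD subnK // -!addrA.
(* The factor 2 n stems from beta(f), and T = n (p - 1) from the passage to [G] and [F]. *)
apply: (@f_image_coprime _ (2 * n * T)).
  rewrite /T !coprimeMl co_np coprime2n p_odd /=.
  by rewrite -{2}(prednK (prime_gt0 p_pr)) coprimenS.
have -> : dpow (g x) e *+ (2 * n * T) = dpow G e *+ (2 * n).
  by rewrite /G dpowMnl -mulrnA mulnC.
have : f_image (dpow (dpow F e) e *~ c' + dpow (y *+ p ^ (N' - k)) e).
  apply: f_imageD; last first.
    rewrite dpowMnl.
    by rewrite addnK expnD mulrnA; apply: f_image_mul.
  apply: f_imageMz; do 2!apply: f_image_dpow.
  by exists (x *+ T), 0; rewrite mul0rn addr0 (morph_Mn fD).
rewrite -h hz mulrnDl -[z *+ _ *+ _]mulrnAC => hh.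
rewrite -[dpow G e *+ _](addrK (z *+ (2 * n) *+ (p ^ k))) -mulNrn.
by apply: f_imageD hh _; apply: f_image_mul.
Qed.

End Core.
End Eigen.
End DMod.

(** * Modules given by a set and raw operations *)

(** The laws left out of [gmod], imposed on the carrier set only. In [glaw_actM] the factor [d] acts
    first, because products of Galois automorphisms are composed from left to right. *)
Record glaws (D : finGroupType) (M : gmod D) : Prop := GLaws {
  glaw_mul : forall x y, gset M x -> gset M y -> gset M (gmul M x y);
  glaw_one : gset M (gone M);
  glaw_inv : forall x, gset M x -> gset M (ginv M x);
  glaw_act : forall d x, gset M x -> gset M (Defs.gact M d x);
  glaw_mulA : forall x y z, gset M x -> gset M y -> gset M z ->
    gmul M x (gmul M y z) = gmul M (gmul M x y) z;
  glaw_mulC : forall x y, gset M x -> gset M y -> gmul M x y = gmul M y x;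
  glaw_mul1 : forall x, gset M x -> gmul M (gone M) x = x;
  glaw_mulV : forall x, gset M x -> gmul M (ginv M x) x = gone M;
  glaw_actD : forall d x y, gset M x -> gset M y ->
    Defs.gact M d (gmul M x y) = gmul M (Defs.gact M d x) (Defs.gact M d y);
  glaw_actM : forall d e x, gset M x ->
    Defs.gact M e (Defs.gact M d x) = Defs.gact M (d * e)%g x;
  glaw_act1 : forall x, gset M x -> Defs.gact M 1%g x = x }.

Record lgmod (D : finGroupType) := LGMod { lgm :> gmod D; lgP : glaws lgm }.

(** Restricting to the carrier set turns the raw operations into a [zmodType], so that ideals,
    classes and elements of L^* all fall under the additive theory above; [gelt_val] leads back to
    the raw data. *)
Definition gelt (D : finGroupType) (M : lgmod D) := {x : M | `[< gset M x >]}.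
HB.instance Definition _ D (M : lgmod D) := gen_eqMixin (gelt M).
HB.instance Definition _ D (M : lgmod D) := gen_choiceMixin (gelt M).

Section Gelt.
Variables (D : finGroupType) (M : lgmod D).
Implicit Types x y : gelt M.

Definition Gelt (a : M) (h : gset M a) : gelt M := exist _ a (asboolT h).
Definition gelt_val (x : gelt M) : M := sval x.

Lemma gelt_valP x : gset M (gelt_val x).
Proof. exact: asboolW (valP x). Qed.

Lemma gelt_val_inj : injective gelt_val.
Proof. exact: val_inj. Qed.

Definition gelt_add x y := Gelt (glaw_mul (lgP M) (gelt_valP x) (gelt_valP y)).
Definition gelt_zero := Gelt (glaw_one (lgP M)).
Definition gelt_opp x := Gelt (glaw_inv (lgP M) (gelt_valP x)).

Fact gelt_addA : associative gelt_add.
Proof. by move=> x y z; apply: gelt_val_inj; apply: (glaw_mulA (lgP M)); apply: gelt_valP. Qed.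
Fact gelt_addC : commutative gelt_add.
Proof. by move=> x y; apply: gelt_val_inj; apply: (glaw_mulC (lgP M)); apply: gelt_valP. Qed.
Fact gelt_add0 : left_id gelt_zero gelt_add.
Proof. by move=> x; apply: gelt_val_inj; apply: (glaw_mul1 (lgP M)); apply: gelt_valP. Qed.
Fact gelt_addN : left_inverse gelt_zero gelt_opp gelt_add.
Proof. by move=> x; apply: gelt_val_inj; apply: (glaw_mulV (lgP M)); apply: gelt_valP. Qed.

HB.instance Definition _ :=
  GRing.isZmodule.Build (gelt M) gelt_addA gelt_addC gelt_add0 gelt_addN.

Definition gelt_act d x := Gelt (glaw_act (lgP M) d (gelt_valP x)).

Fact gelt_actD d x y : gelt_act d (x + y) = gelt_act d x + gelt_act d y.
Proof. by apply: gelt_val_inj; apply: (glaw_actD (lgP M)); apply: gelt_valP. Qed.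
Fact gelt_actM d e x : gelt_act e (gelt_act d x) = gelt_act (d * e)%g x.
Proof. by apply: gelt_val_inj; apply: (glaw_actM (lgP M)); apply: gelt_valP. Qed.

Lemma gelt_act1 x : gelt_act 1%g x = x.
Proof. by apply: gelt_val_inj; apply: (glaw_act1 (lgP M)); apply: gelt_valP. Qed.

Definition gdmod : dmod D := DMod gelt_actD gelt_actM.

Lemma gelt_val_expn (x : gdmod) n : gexpn (gelt_val x) n = gelt_val (x *+ n).
Proof. by elim: n => [|n IH] //; rewrite mulrS /gexpn iterS -/(gexpn _ _) IH. Qed.

Lemma gelt_val_expz (x : gdmod) a : gexpz (gelt_val x) a = gelt_val (x *~ a).
Proof. by case: a => n; rewrite /gexpz gelt_val_expn. Qed.

Lemma gelt_val_pow (x : gdmod) b : gpow (gelt_val x) b = gelt_val (dpow x b).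
Proof.
rewrite /gpow /dpow; elim/big_rec2: _ => // d y z _ ->.
by rewrite -[Defs.gact M d (gelt_val x)]/(gelt_val (dact d x)) gelt_val_expz.
Qed.

End Gelt.

Section SubQuo.
Variables (D : finGroupType).

Section Sub.
Variables (M : lgmod D) (S : set M) (hS : gsubmodule S).

Lemma gsub_laws : glaws (gsub S).
Proof.
have [[sS S1 SM SV] SA] := hS; split => //=.
- by move=> x y z /sS ? /sS ? /sS ?; apply: (glaw_mulA (lgP M)).
- by move=> x y /sS ? /sS ?; apply: (glaw_mulC (lgP M)).
- by move=> x /sS ?; apply: (glaw_mul1 (lgP M)).
- by move=> x /sS ?; apply: (glaw_mulV (lgP M)).
- by move=> d x y /sS ? /sS ?; apply: (glaw_actD (lgP M)).
- by move=> d e x /sS ?; apply: (glaw_actM (lgP M)).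
- by move=> x /sS ?; apply: (glaw_act1 (lgP M)).
Qed.

Definition lsub := LGMod gsub_laws.

Lemma sub_valP (x : gdmod lsub) : gset M (gelt_val x : M).
Proof. by have [[sub _ _ _] _] := hS; apply: sub; apply: (gelt_valP x). Qed.

Definition gincl (x : gdmod lsub) : gdmod M := Gelt (sub_valP x).

Lemma ginclD : {morph gincl : x y / x + y}.
Proof. by move=> x y; apply: gelt_val_inj. Qed.

Lemma ginclA d x : gincl (dact d x) = dact d (gincl x).
Proof. exact: gelt_val_inj. Qed.

End Sub.

Section Quo.
Variables (M : lgmod D) (N : set M) (hN : gsubmodule N).
Implicit Types x y : gdmod M.

Definition inN x := N (gelt_val x).

Lemma inN0 : inN 0. Proof. by case: hN => -[]. Qed.
Lemma inND x y : inN x -> inN y -> inN (x + y).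
Proof. by case: hN => -[_ _ h _] _; apply: h. Qed.
Lemma inNN x : inN x -> inN (- x).
Proof. by case: hN => -[_ _ _ h] _; apply: h. Qed.
Lemma inNA d x : inN x -> inN (dact d x).
Proof. by case: hN => _; apply. Qed.
Lemma inN_gset a : N a -> exists2 x, inN x & a = gelt_val x.
Proof.
move=> Na; have h : gset M a by case: hN => -[h] _ _ _ _; apply: h.
by exists (Gelt h : gdmod M).
Qed.

Lemma gcosetP x a : gcoset N (gelt_val x) a <-> exists2 y, inN y & a = gelt_val (x + y).
Proof.
split=> [[b /inN_gset[y Ny ->] <-]|[y Ny ->]]; first by exists y.
by exists (gelt_val y).
Qed.

Lemma gcoset_eq x y : gcoset N (gelt_val x) = gcoset N (gelt_val y) <-> inN (x - y).
Proof.
split=> [e|h].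
  have : gcoset N (gelt_val x) (gelt_val x).
    by apply/gcosetP; exists 0; [apply: inN0|rewrite addr0].
  rewrite e => /gcosetP[z Nz /gelt_val_inj ->].
  by rewrite addrC addKr.
apply/seteqP; split=> a /gcosetP[z Nz ->]; apply/gcosetP.
  by exists (x - y + z); [apply: inND|rewrite addrA [y + _]addrC subrK].
by exists (- (x - y) + z); [apply: inND Nz; apply: inNN|rewrite addrA opprB [x + _]addrC subrK].
Qed.

Lemma gcosetM x y :
  gmul (gquo N) (gcoset N (gelt_val x)) (gcoset N (gelt_val y)) = gcoset N (gelt_val (x + y)).
Proof.
apply/seteqP; split=> a.
  move=> [_ /gcosetP[u Nu ->] [_ /gcosetP[v Nv ->] <-]]; apply/gcosetP.
  by exists (u + v); [apply: inND|rewrite addrACA].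
move=> /gcosetP[u Nu ->]; exists (gelt_val x).
  by apply/gcosetP; exists 0; [apply: inN0|rewrite addr0].
by exists (gelt_val (y + u)); [apply/gcosetP; exists u|rewrite -addrA].
Qed.

Lemma gcosetV x : ginv (gquo N) (gcoset N (gelt_val x)) = gcoset N (gelt_val (- x)).
Proof.
apply/seteqP; split=> a.
  move=> [_ /gcosetP[u Nu ->] <-]; apply/gcosetP.
  by exists (- u); [apply: inNN|rewrite -opprD].
move=> /gcosetP[u Nu ->]; exists (gelt_val (x - u)).
  by apply/gcosetP; exists (- u); [apply: inNN|].
by rewrite -[ginv M _]/(gelt_val (- (x - u))) opprB addrC.
Qed.

Lemma gcosetA d x : Defs.gact (gquo N) d (gcoset N (gelt_val x)) = gcoset N (gelt_val (dact d x)).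
Proof.
apply/seteqP; split=> a.
  move=> [_ /gcosetP[u Nu ->] <-]; apply/gcosetP.
  by exists (dact d u); [apply: inNA|rewrite -dactD].
move=> /gcosetP[u Nu ->]; exists (gelt_val (x + dact d^-1%g u)).
  by apply/gcosetP; exists (dact d^-1%g u); [apply: inNA|].
rewrite -[Defs.gact M _ _]/(gelt_val (dact d (x + dact d^-1%g u))) dactD dactM mulVg.
by congr (gelt_val (_ + _)); apply: gelt_act1.
Qed.

Lemma gset_quoP (X : set M) : gset (gquo N) X <-> exists x, X = gcoset N (gelt_val x).
Proof.
split=> [[a Ma <-]|[x ->]]; first by exists (Gelt Ma : gdmod M).
by exists (gelt_val x) => //; apply: gelt_valP.
Qed.

Lemma gquo_laws : glaws (gquo N).
Proof.
split.
- move=> X Y /gset_quoP[x ->] /gset_quoP[y ->].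
  by apply/gset_quoP; exists (x + y); rewrite gcosetM.
- by apply/gset_quoP; exists 0.
- move=> X /gset_quoP[x ->]; apply/gset_quoP; exists (- x); exact: gcosetV.
- move=> d X /gset_quoP[x ->]; apply/gset_quoP; exists (dact d x); exact: gcosetA.
- move=> X Y Z /gset_quoP[x ->] /gset_quoP[y ->] /gset_quoP[z ->].
  by rewrite !gcosetM addrA.
- by move=> X Y /gset_quoP[x ->] /gset_quoP[y ->]; rewrite !gcosetM addrC.
- move=> X /gset_quoP[x ->].
  by rewrite -[gone (gquo N)]/(gcoset N (gelt_val (0 : gdmod M))) gcosetM add0r.
- by move=> X /gset_quoP[x ->]; rewrite gcosetV gcosetM addNr.
- by move=> d X Y /gset_quoP[x ->] /gset_quoP[y ->]; rewrite !(gcosetM, gcosetA) dactD.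
- by move=> d e X /gset_quoP[x ->]; rewrite !gcosetA dactM.
- by move=> X /gset_quoP[x ->]; rewrite gcosetA; congr (gcoset N (gelt_val _)); apply: gelt_act1.
Qed.

Definition lquo := LGMod gquo_laws.

Lemma gset_coset x : gset lquo (gcoset N (gelt_val x)).
Proof. by apply/gset_quoP; exists x. Qed.

Definition qcl x : gdmod lquo := Gelt (gset_coset x).

Lemma qclD : {morph qcl : x y / x + y}.
Proof. by move=> x y; apply: gelt_val_inj; symmetry; apply: gcosetM. Qed.

Lemma qclA d x : qcl (dact d x) = dact d (qcl x).
Proof. by apply: gelt_val_inj; symmetry; apply: gcosetA. Qed.

Lemma qcl_surj (y : gdmod lquo) : exists x, qcl x = y.
Proof. by have /gset_quoP[x e] := gelt_valP y; exists x; apply: gelt_val_inj. Qed.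

Lemma qcl_eq x y : qcl x = qcl y <-> inN (x - y).
Proof. by split=> [/(congr1 (@gelt_val _ _)) /gcoset_eq //|/gcoset_eq h]; apply: gelt_val_inj. Qed.

Lemma qcl_eq0 x : qcl x = 0 <-> inN x.
Proof.
have -> : 0 = qcl 0 by apply: (addrI (qcl 0)); rewrite -qclD !addr0.
by rewrite qcl_eq subr0.
Qed.

End Quo.

(** This replaces the components of the theorem by eigenspaces. A lift of e_psi maps into the
    eigenspace; conversely an eigenvector killed by p^N is fixed by any lift of precision N, hence
    is its own preimage. *)
Lemma gcomp_subP (p : nat) (p_pr : prime p) (psi : D -> padic p_pr) (N : nat)
    (M : lgmod D) (S : set M) (Y : M) : gsubmodule S ->
  commutative (@mulg D) -> #|D| = p.-1 -> padic_char psi ->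
  (forall x : gdmod M, S (gelt_val x) -> x *+ (p ^ N) = 0) ->
  gset (gcomp (gsub S) psi) Y <->
  exists x : gdmod M, [/\ S (gelt_val x), eigen psi x & Y = gelt_val x].
Proof.
move=> hS abD cD chi kill; split=> [[N' [b [a [kN' hb Sa ->]]]]|[x [Sx ex ->]]].
  have [x Sx xE] := inN_gset hS (Sa : S a); subst a.
  have xN' : x *+ (p ^ N') = 0 by apply: gelt_val_inj; rewrite -gelt_val_expn; apply: kN'.
  exists (dpow x b); split; last by rewrite -gelt_val_pow.
  - rewrite -[gelt_val _]/(gelt_val (dpow x b)) /dpow.
    elim/big_ind: _ => [||d _]; [exact: (inN0 hS)|exact: (inND hS)|].
    have SMn z i : S (gelt_val z) -> S (gelt_val (z *+ i)).
      move=> Sz; elim: i => [|i IH]; first exact: (inN0 hS).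
      by rewrite mulrS; apply: (inND hS).
    case: (b d) => i; first exact: SMn (inNA hS d Sx).
    by rewrite NegzE mulrNz; apply: (inNN hS); apply: SMn (inNA hS d Sx).
  - exact: eigen_dpow hb.
exists N, (approx N (idem psi)), (gelt_val x); split => //.
- move=> a Sa; have [z Sz ->] := inN_gset hS (Sa : S a).
  by rewrite [LHS](gelt_val_expn z) kill.
- exact: approxP.
by rewrite [RHS](gelt_val_pow x) (dpow_idem cD chi (kill x Sx) ex (approxP _ _)).
Qed.

End SubQuo.

(** * Finite abelian groups *)

Section AbelianCounting.
Variable (C : zmodType).

Lemma translate_perm (s : seq C) (h : C -> C) : uniq s ->
  {in s &, injective h} -> {in s, forall x, h x \in s} -> perm_eq (map h s) s.
Proof.
move=> us hi hs; have um : uniq (map h s) by rewrite map_inj_in_uniq.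
have sub : {subset map h s <= s} by move=> _ /mapP[x xs ->]; apply: hs.
apply: uniq_perm => //.
by have [] := uniq_min_size um sub (eq_leq (esym (size_map h s))).
Qed.

(** Translation by [a] permutes [s], so adding [a] to every term leaves the sum over [s]
    unchanged. *)
Lemma mulrn_size (s : seq C) a : uniq s -> {in s, forall x, a + x \in s} ->
  a *+ size s = 0.
Proof.
move=> us sa.
have e : \sum_(x <- s) (a + x) = \sum_(x <- s) x.
  rewrite -(big_map (fun x => a + x) xpredT id).
  by apply: perm_big; apply: translate_perm => // x y _ _; apply: addrI.
move: e => /eqP; rewrite big_split /= -subr_eq0 addrK.
by rewrite big_const_seq count_predT iter_addr addr0 => /eqP.
Qed.

(** The same summation in the quotient by [t]: translation by [x] permutes the n cosets, and
    comparing the sums of representatives gives n x modulo [t]. *)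
Lemma mulrn_index (s t : seq C) (n : nat) x : uniq s -> uniq t ->
  (forall y, y \in s) -> 0 \in t -> {in t &, forall a b, a - b \in t} ->
  size s = (n * size t)%N -> x *+ n \in t.
Proof.
move=> us ut sT t0 tB sz.
have tN a : a \in t -> - a \in t by move=> ta; rewrite -sub0r; apply: tB.
have tD a b : a \in t -> b \in t -> a + b \in t.
  by move=> ta tb; rewrite -[b]opprK; apply: tB => //; apply: tN.
(* A canonical representative of the coset: [choose] returns the same element for extensionally
   equal predicates, whichever admissible starting point is given. *)
pose r y := choose (fun z => z - y \in t) y.
have rP y : r y - y \in t by apply: (@chooseP _ (fun z => z - y \in t)); rewrite subrr.
have r_eq y z : y - z \in t -> r y = r z.
  move=> yz; rewrite /r.
  have e : (fun w => w - y \in t) =1 (fun w => w - z \in t).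
    move=> w; apply/idP/idP => h.
      by have := tD _ _ h yz; rewrite addrA subrK.
    by have := tB _ _ h yz; rewrite opprB addrA subrK.
  rewrite (eq_choose e); apply: choose_id => //; first by rewrite subrr.
pose R := undup (map r s).
have Rr y : r y \in R by rewrite mem_undup map_f.
have RE y : y \in R -> r y = y.
  by rewrite mem_undup => /mapP[z _ ->]; apply: r_eq.
have szR : size s = (size R * size t)%N.
  rewrite -(size_allpairs +%R); apply: perm_size; apply: uniq_perm => //.
    apply: allpairs_uniq => //; first exact: undup_uniq.
    move=> _ _ /allpairsP[[y a] /= [Ry ta ->]] /allpairsP[[z b] /= [Rz tb ->]] /= e.
    have yz : y = z.
      rewrite -(RE y Ry) -(RE z Rz); apply: r_eq.
      have -> : y - z = b - a.
        by apply/eqP; rewrite subr_eq addrAC eq_sym subr_eq eq_sym addrC -e addrC.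
      exact: tB.
    by move: e; rewrite yz => /addrI ->.
  move=> y; rewrite sT; apply/esym/allpairsP; exists (r y, y - r y); split => //=.
    by rewrite -opprB; apply: tN.
  by rewrite addrC subrK.
have t_gt0 : (0 < size t)%N by case: (t) t0.
have nR : n = size R by apply/eqP; rewrite -(eqn_pmul2r t_gt0) -sz szR.
have perm : perm_eq (map (fun y => r (x + y)) R) R.
  apply: translate_perm (undup_uniq _) _ _ => // y z Ry Rz e.
  rewrite -(RE y Ry) -(RE z Rz); apply: r_eq.
  have h1 := rP (x + y); have h2 := rP (x + z); rewrite e in h1.
  have := tB _ _ h2 h1.
  by rewrite opprB addrC addrA subrK opprD addrACA subrr add0r.
have : \sum_(y <- R) (r (x + y) - (x + y)) \in t.
  by elim/big_ind: _ => // y _; apply: rP.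
rewrite sumrB -(big_map _ xpredT id) (perm_big _ perm) /= big_split /=.
rewrite big_const_seq count_predT iter_addr addr0 -nR.
by rewrite opprD addrCA subrr addr0 => /tN; rewrite opprK.
Qed.

End AbelianCounting.

Lemma cardinalE (T : Type) (S : set T) n : (S #= `I_n)%card -> cardinal S = n.
Proof.
move=> Sn; rewrite /cardinal.
have : (S #= `I_(xget 0%N [set k | (S #= `I_k)%card]))%card.
  by apply: (@xgetPex _ 0%N [set k | (S #= `I_k)%card]); exists n.
by move/card_esym => /card_eq_trans /(_ Sn) /card_eq_II.
Qed.

Lemma cardinal_image (T : choiceType) (U : Type) (s : seq T) (h : T -> U) :
  uniq s -> injective h -> cardinal [set h x | x in [set` s]] = size s.
Proof.
move=> us hi; apply: cardinalE.
apply: (@card_eq_trans _ _ _ _ [set` s]).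
  by apply: inj_card_eq => x y _ _; apply: hi.
apply/card_set_bijP; exists (index^~ s); split.
- by move=> x /=; rewrite index_mem.
- move=> x y /set_mem /= xs /set_mem /= ys e.
  by rewrite -(nth_index x xs) e nth_index.
case: s us => [_ i //|x0 s us i /= ilt].
have e := index_uniq x0 (ilt : (i < size (x0 :: s))%N) us.
by exists (nth x0 (x0 :: s) i); [exact: mem_nth|exact: e].
Qed.

(** * Arithmetic of the cyclotomic integers *)

(** Irreducibility of Phi_n is taken from [algC] and transferred without embedding L: the minimal
    polynomial of [x] over Q divides Phi_n, so any complex root of it is a primitive n-th root of
    unity, whose degree is known. *)
Lemma totient_adjoin_degree (L : fieldExtType rat) (n : nat) (x : L) :
  n.-primitive_root x -> (totient n <= adjoin_degree 1%AS x)%N.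
Proof.
move=> prim_x; have n_gt0 := prim_order_gt0 prim_x.
pose PhiL d : {poly L} := map_poly intr 'Phi_d.
have prodPhi d : (d > 0)%N -> \prod_(e <- divisors d) PhiL e = 'X^d - 1.
  by move=> d0; rewrite -rmorph_prod prod_Cyclotomic // rmorphB rmorph1 /= map_polyXn.
have rootPhi d : (d > 0)%N -> root (PhiL d) x -> x ^+ d = 1.
  move=> d0 /rootP rd; apply/eqP; rewrite -subr_eq0.
  have := congr1 (horner^~ x) (prodPhi d d0).
  rewrite !hornerE => <-; rewrite horner_prod (big_rem d) ?dvdn_divisors -?dvdn_divisors //=.
  by rewrite rd mul0r.
have Phix : root (PhiL n) x.
  have : \prod_(d <- divisors n) (PhiL d).[x] == 0.
    by rewrite -horner_prod prodPhi // !hornerE (prim_expr_order prim_x) subrr.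
  rewrite prodf_seq_eq0 => /hasP[d]; rewrite -dvdn_divisors // => dn /= rd.
  have d0 : (d > 0)%N := dvdn_gt0 n_gt0 dn.
  suff -> : n = d by [].
  apply/eqP; rewrite eqn_dvd dn andbT (prim_order_dvd prim_x).
  by apply/eqP; apply: rootPhi.
pose Phi : {poly rat} := map_poly intr 'Phi_n.
have LPhi : map_poly (in_alg L) Phi = PhiL n.
  by rewrite -map_poly_comp; apply: eq_map_poly => a /=; rewrite scaler_int.
have [q qE] := polyOver1P (minPolyOver 1%AS x).
have q_dvd : q %| Phi.
  rewrite -(dvdp_map (in_alg L)) -qE LPhi; apply: minPoly_dvdp Phix.
  by rewrite -LPhi; apply/polyOver1P; exists Phi.
have sz_q : size q = (adjoin_degree 1%AS x).+1.
  by rewrite -size_minPoly qE size_map_poly.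
have /closed_rootP[z rz] : size (map_poly (ratr : rat -> algC) q) != 1.
  by rewrite size_map_poly sz_q.
have [z0 prim_z0] := C_prim_root_exists n_gt0.
have CPhi : map_poly (ratr : rat -> algC) Phi = cyclotomic z0 n.
  rewrite -(Cintr_Cyclotomic prim_z0) -map_poly_comp.
  by apply: eq_map_poly => a /=; rewrite ratr_int.
have prim_z : n.-primitive_root z.
  rewrite -(root_cyclotomic prim_z0) -CPhi.
  by apply: root_dvdp rz; rewrite dvdp_map.
have [pf [Dpf mon_pf] dv_pf] := minCpolyP z.
have : pf %| q by rewrite -dv_pf.
move/dvdp_leq; rewrite -size_poly_eq0 sz_q => /(_ isT).
rewrite -(size_map_poly (ratr : {rmorphism rat -> algC})) -Dpf.
by rewrite (minCpoly_cyclotomic prim_z) size_cyclotomic.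
Qed.

Section Cyclotomic.
Variables (p : nat) (p_pr : prime p) (L : splittingFieldType rat) (zeta : L).
Hypothesis zeta_prim : p.-primitive_root zeta.
Hypothesis zeta_gen : <<1%AS; zeta>>%VS = fullv :> {vspace L}.
Notation O := (ring_int zeta).
Notation Delta := (gal_of {:L}).

Lemma O_poly (q : {poly int}) : O (map_poly intr q).[zeta].
Proof. by exists q. Qed.

Lemma O_int (a : int) : O a%:~R.
Proof. by exists a%:P; rewrite map_polyC hornerC. Qed.

Lemma O0 : O 0. Proof. exact: (O_int 0). Qed.
Lemma O1 : O 1. Proof. exact: (O_int 1). Qed.

Lemma O_nat (a : nat) : O a%:R. Proof. exact: (O_int a). Qed.

Lemma O_zeta : O zeta.
Proof. by exists 'X; rewrite map_polyX hornerX. Qed.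

Lemma OD x y : O x -> O y -> O (x + y).
Proof. by move=> [q ->] [r ->]; exists (q + r); rewrite rmorphD hornerD. Qed.

Lemma ON x : O x -> O (- x).
Proof. by move=> [q ->]; exists (- q); rewrite rmorphN hornerN. Qed.

Lemma OB x y : O x -> O y -> O (x - y).
Proof. by move=> hx hy; apply: OD (ON hy). Qed.

Lemma OM x y : O x -> O y -> O (x * y).
Proof. by move=> [q ->] [r ->]; exists (q * r); rewrite rmorphM hornerM. Qed.

Lemma OX x n : O x -> O (x ^+ n).
Proof. by move=> hx; elim: n => [|n IH]; [apply: O1|rewrite exprS; apply: OM]. Qed.

Lemma O_sum (I : Type) (r : seq I) (P : pred I) (F : I -> L) :
  (forall i, P i -> O (F i)) -> O (\sum_(i <- r | P i) F i).
Proof. by move=> h; elim/big_ind: _ => //; [apply: O0|apply: OD]. Qed.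

Lemma O_prod (I : Type) (r : seq I) (P : pred I) (F : I -> L) :
  (forall i, P i -> O (F i)) -> O (\prod_(i <- r | P i) F i).
Proof. by move=> h; elim/big_ind: _ => //; [apply: O1|apply: OM]. Qed.

Let p_gt1 := prime_gt1 p_pr.
Let zetap : zeta ^+ p = 1 := prim_expr_order zeta_prim.

Lemma zeta_neq1 : zeta != 1.
Proof.
by rewrite -[zeta]expr1 -(prim_order_dvd zeta_prim) gtnNdvd // p_gt1.
Qed.

Lemma sum_zeta : \sum_(i < p) zeta ^+ i = 0.
Proof.
have : (zeta - 1) * \sum_(i < p) zeta ^+ i = 0 by rewrite -subrX1 zetap subrr.
by move/eqP; rewrite mulf_eq0 subr_eq0 (negPf zeta_neq1) => /eqP.
Qed.

Lemma zeta_pred : zeta ^+ p.-1 = - \sum_(i < p.-1) zeta ^+ i.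
Proof.
apply/eqP; rewrite -addr_eq0 addrC; apply/eqP.
have := sum_zeta; rewrite -(big_mkord predT) /= -{1}(prednK (prime_gt0 p_pr)).
by rewrite big_nat_recr //= big_mkord.
Qed.

Lemma gal_zeta (s : Delta) : exists2 a : nat, coprime a p & s zeta = zeta ^+ a.
Proof.
have sp : (s zeta) ^+ p = 1 by rewrite -rmorphXn /= zetap rmorph1.
have [a e] := prim_rootP zeta_prim sp; exists a => //.
rewrite coprime_sym prime_coprime //; apply/negP => pa.
have : s zeta = s 1 by rewrite e rmorph1; apply/eqP; rewrite -(prim_order_dvd zeta_prim).
by move/fmorph_inj => h; move: zeta_neq1; rewrite h eqxx.
Qed.

Lemma gal_inj (s t : Delta) : s zeta = t zeta -> s = t.
Proof.
move=> e; apply/eqP/gal_eqP => v _.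
have : v \in <<1; zeta>>%VS by rewrite zeta_gen memvf.
case/Fadjoin_polyP => q /polyOver1P[r ->] ->.
rewrite -!horner_map /= e; congr (_.[_]).
by rewrite -!map_poly_comp; apply: eq_map_poly => a /=; rewrite !rmorph_alg.
Qed.

Lemma gal_abel : commutative (@mulg Delta).
Proof.
move=> s t; apply: gal_inj; rewrite !galM ?memvf //.
have [a _ ea] := gal_zeta s; have [b _ eb] := gal_zeta t.
by rewrite ea eb !rmorphXn /= ea eb -!exprM mulnC.
Qed.

Lemma gal_in (s : Delta) : s \in 'Gal({:L} / 1)%g.
Proof.
rewrite gal_kHom ?sub1v //; apply/kHomP_tmp; split.
  by move=> u /vlineP[c ->]; rewrite rmorph_alg.
by move=> u v _ _; rewrite rmorphM.
Qed.

Lemma galois1 : galois 1%AS {:L}%AS.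
Proof.
apply/and3P; split; [exact: sub1v| |exact: normalFieldf].
apply/separableP => y _; apply: pcharf0_separable => q.
by rewrite pchar_lalg pchar_num.
Qed.

Lemma gal_fix (x : L) : (forall s : Delta, s x = x) -> exists a : rat, x = a%:A.
Proof.
move=> h; suff /vlineP[a ->] : x \in 1%VS by exists a.
have /galois_fixedField <- := galois1.
by apply/fixedFieldP; rewrite ?memvf // => s _; apply: h.
Qed.

Lemma adjoin_degree_zeta : adjoin_degree 1%AS zeta = p.-1.
Proof.
apply/eqP; rewrite eqn_leq -{2}(totient_prime p_pr) totient_adjoin_degree // andbT.
pose q : {poly rat} := \sum_(i < p) 'X^i.
have qE : q = \poly_(i < p) 1 by rewrite poly_def; apply: eq_bigr => i _; rewrite scale1r.
have rq : root (map_poly (in_alg L) q) zeta.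
  rewrite rmorph_sum /=; apply/rootP; rewrite horner_sum -[RHS]sum_zeta.
  by apply: eq_bigr => i _; rewrite map_polyXn hornerXn.
have sq : size q = p.
  by rewrite qE size_poly_eq ?oner_neq0.
have /dvdp_leq : minPoly 1%AS zeta %| map_poly (in_alg L) q.
  by apply: minPoly_dvdp rq; apply/polyOver1P; exists q.
rewrite size_minPoly -size_poly_eq0 size_map_poly sq -lt0n prime_gt0 // => /(_ isT).
by rewrite -{1}(prednK (prime_gt0 p_pr)) ltnS.
Qed.

Lemma dimL : \dim {:L} = p.-1.
Proof. by rewrite -zeta_gen dim_Fadjoin dimv1 muln1 adjoin_degree_zeta. Qed.

Lemma card_gal : #|{: Delta}| = p.-1.
Proof.
have := galois_dim galois1; rewrite dimv1 divn1 dimL => ->.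
by apply: eq_card => s; rewrite gal_in.
Qed.

(** Existence is by counting: the p - 1 automorphisms have distinct exponents modulo p, none of them
    0, so if [a] were missed as well only p - 2 values would remain. Hence [sigma] does not fall
    back on its default here. *)
Lemma sigmaE (a : nat) : coprime a p -> sigma zeta a%:Z zeta = zeta ^+ a.
Proof.
move=> co; rewrite /sigma; case: pickP => [s /eqP //|none].
have ex (s : Delta) : exists i : 'I_p, s zeta == zeta ^+ i.
  have [b _ ->] := gal_zeta s; exists (Ordinal (ltn_pmod b (prime_gt0 p_pr))).
  by rewrite /= prim_expr_mod.
pose h (s : Delta) := xchoose (ex s).
have hE (s : Delta) : s zeta = zeta ^+ h s by apply/eqP; apply: (xchooseP (ex s)).
have h_inj : injective h by move=> s t e; apply: gal_inj; rewrite !hE e.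
have p0 := prime_gt0 p_pr.
pose i0 := Ordinal p0; pose ia := Ordinal (ltn_pmod a p0).
have ia0 : i0 != ia.
  by rewrite -val_eqE /= eq_sym -/(p %| a)%N -prime_coprime // coprime_sym.
have : (#|codom h| <= #|predC (pred2 i0 ia)|)%N.
  apply: subset_leq_card; apply/fintype.subsetP => _ /codomP[s ->].
  rewrite !inE negb_or; apply/andP; split; apply/eqP => e.
    have [b cb eb] := gal_zeta s.
    move: eb; rewrite hE e /= expr0 => /esym/eqP.
    rewrite -(prim_order_dvd zeta_prim) => pb.
    by move: cb; rewrite coprime_sym prime_coprime // pb.
  by have := none s; rewrite /= hE e /= prim_expr_mod // eqxx.
rewrite card_codom // card_gal.
have := cardC (pred2 i0 ia); rewrite card2 ia0 card_ord => e.
have -> : p.-1 = #|predC (pred2 i0 ia)|.+1 by rewrite -[X in X.-1]e.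
by rewrite ltnn.
Qed.

Lemma p1_gt0 : (0 < p.-1)%N. Proof. by rewrite -ltnS prednK // prime_gt0. Qed.

(** A root of unity of order p^2 would generate a subfield of degree at least p (p - 1), more than
    the degree of L. *)
Lemma gal_roots_tors (e : L) t : e ^+ (p ^ t) = 1 -> exists i, e = zeta ^+ i.
Proof.
elim: t e => [|t IH] e; first by rewrite expr1 => ->; exists 0%N; rewrite expr0.
rewrite expnS exprM => /IH[i ei].
case pi : (p %| i)%N.
  suff /(prim_rootP zeta_prim)[j ->] : e ^+ p = 1 by exists j.
  by rewrite ei; apply/eqP; rewrite -(prim_order_dvd zeta_prim).
have ep1 : e ^+ p != 1 by rewrite ei -(prim_order_dvd zeta_prim) pi.
have ep2 : e ^+ (p ^ 2) = 1.
  by rewrite expnS expn1 exprM ei -!exprM mulnC exprM zetap expr1n.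
have p2 : (0 < p ^ 2)%N by rewrite expn_gt0 prime_gt0.
have [d prim_d] := prim_order_exists p2 ep2.
case/(dvdn_pfactor _ _ p_pr) => -[|[|[|]]] // _ dE; move: prim_d; rewrite dE.
- by move/prim_expr_order; rewrite expr1 => e1; rewrite e1 expr1n eqxx in ep1.
- by move/prim_expr_order; rewrite expn1 => e1; rewrite e1 eqxx in ep1.
move/totient_adjoin_degree; rewrite totient_pfactor // expn1 => le.
have : (\dim <<1%AS; e>> <= \dim {:L})%N by apply: dimvS; apply: subvf.
rewrite dimL dim_Fadjoin dimv1 muln1 => /(leq_trans le).
by rewrite leqNgt ltn_Pmulr // p1_gt0.
Qed.

Definition zbasis : (p.-1).-tuple L := [tuple zeta ^+ i | i < p.-1].

Lemma zbasis_nth (i : 'I_p.-1) : zbasis`_i = zeta ^+ i.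
Proof. by rewrite nth_mktuple. Qed.

Lemma zbasisP : basis_of {:L} zbasis.
Proof.
rewrite basisEdim dimL size_tuple leqnn andbT; apply/subvP => v _.
have vz : v \in <<1; zeta>>%VS by rewrite zeta_gen memvf.
rewrite -(Fadjoin_poly_eq vz).
have /polyOver1P[q qE] := Fadjoin_polyOver 1%AS zeta v.
have sz := size_Fadjoin_poly 1%AS zeta v.
rewrite (horner_coef_wide _ sz) adjoin_degree_zeta; apply: memv_suml => i _.
rewrite qE coef_map /= -scalerAl mul1r memvZ // -zbasis_nth memv_span //.
by rewrite mem_nth // size_tuple.
Qed.

Definition zcoord (i : 'I_p.-1) (v : L) : rat := coord zbasis i v.

Lemma zcoordE v : v = \sum_i zcoord i v *: zeta ^+ i.
Proof.
rewrite {1}(coord_basis zbasisP (memvf v)); apply: eq_bigr => i _.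
by rewrite zbasis_nth.
Qed.

Lemma zcoordD i u v : zcoord i (u + v) = zcoord i u + zcoord i v.
Proof. exact: linearD. Qed.

Lemma zcoordB i u v : zcoord i (u - v) = zcoord i u - zcoord i v.
Proof. exact: linearB. Qed.

Lemma zcoordZ i a v : zcoord i (a *: v) = a * zcoord i v.
Proof. exact: linearZ. Qed.

Lemma zcoord_sum i (I : Type) (r : seq I) (F : I -> L) :
  zcoord i (\sum_(k <- r) F k) = \sum_(k <- r) zcoord i (F k).
Proof. exact: linear_sum. Qed.

Lemma zcoord_zeta (i j : 'I_p.-1) : zcoord i (zeta ^+ j) = (i == j)%:R.
Proof.
by rewrite -zbasis_nth /zcoord coord_free ?(basis_free zbasisP) // eq_sym.
Qed.

Definition ord0p : 'I_p.-1 := Ordinal p1_gt0.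

Lemma zcoord_rat a : zcoord ord0p a%:A = a.
Proof.
by rewrite zcoordZ -[1](expr0 zeta) -[0%N]/(val ord0p) zcoord_zeta eqxx mulr1.
Qed.

(** The integral combinations of 1, ..., zeta^(p-2) are stable under multiplication by zeta, because
    [zeta_pred] expresses zeta^(p-1) with coefficients -1. *)
Lemma O_coord x : O x <-> forall i, zcoord i x \is a Num.int.
Proof.
split; last first.
  move=> h; rewrite (zcoordE x); apply: O_sum => i _.
  by have /intrP[a ->] := h i; rewrite scaler_int -mulrzr; apply: OM (OX _ O_zeta) (O_int a).
pose Q v := forall i, zcoord i v \is a Num.int.
have QD u v : Q u -> Q v -> Q (u + v) by move=> hu hv i; rewrite zcoordD rpredD.
have QZ (a : rat) v : a \is a Num.int -> Q v -> Q (a *: v).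
  by move=> ha hv i; rewrite zcoordZ rpredM.
have Qs (r : seq 'I_p.-1) F : (forall k, Q (F k)) -> Q (\sum_(k <- r) F k).
  by move=> h; elim/big_ind: _ => // i; rewrite /zcoord linear0 rpred0.
have Qz (k : 'I_p.-1) : Q (zeta ^+ k) by move=> i; rewrite zcoord_zeta rpred_nat.
have QzS (k : 'I_p.-1) : Q (zeta ^+ k.+1).
  have := ltn_ord k; rewrite leq_eqVlt => /predU1P[->|lt]; last exact: (Qz (Ordinal lt)).
  by rewrite zeta_pred -scaleN1r; apply: QZ; [rewrite rpredN rpred1|apply: Qs].
have Qmz v : Q v -> Q (v * zeta).
  move=> hv; rewrite (zcoordE v) mulr_suml; apply: Qs => k.
  by rewrite -scalerAl -exprSr; apply: QZ.
move=> [q ->]; elim/poly_ind: q => [|q c IH].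
  by rewrite rmorph0 horner0 => i; rewrite /zcoord linear0 rpred0.
have Qc : Q c%:~R.
  rewrite -(scaler_int c (1 : L)) -(expr0 zeta).
  by apply: QZ (Qz ord0p); apply: intr_int.
rewrite rmorphD rmorphM /= map_polyX map_polyC !hornerE.
exact: QD (Qmz _ IH) Qc.
Qed.

Lemma O_rat (a : rat) : O a%:A -> a \is a Num.int.
Proof. by move/O_coord/(_ ord0p); rewrite zcoord_rat. Qed.

Lemma O_gal (s : Delta) x : O x -> O (s x).
Proof.
move=> [q ->]; have [a _ e] := gal_zeta s.
rewrite -horner_map /= e -map_poly_comp.
rewrite (eq_map_poly (g := intr)); last by move=> c /=; rewrite rmorph_int.
elim/poly_ind: q => [|q c IH]; first by rewrite rmorph0 horner0; apply: O0.
rewrite rmorphD rmorphM /= map_polyX map_polyC !hornerE.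
by apply: OD (O_int c); apply: OM IH (OX _ O_zeta).
Qed.

(** A generator of the prime above p, with sign opposite to pi = zeta - 1; the group U involves only
    its square. *)
Definition lam : L := 1 - zeta.

Lemma lam_neq0 : lam != 0.
Proof. by rewrite subr_eq0 eq_sym zeta_neq1. Qed.

Lemma O_lam : O lam. Proof. exact: OB O1 O_zeta. Qed.

Lemma p_neq0 : p%:R != 0 :> L.
Proof.
have -> : (p%:R : L) = (p%:R : rat)%:A by rewrite scaler_nat.
by rewrite scaler_eq0 oner_eq0 orbF pnatr_eq0 -lt0n prime_gt0.
Qed.

(** The quotient is the cyclotomic unit 1 + ... + zeta^(i-1). If b inverts i modulo p, then zeta =
    (zeta^i)^b, and the geometric sum in zeta^i is the inverse. *)
Lemma lam_unit i : (0 < i < p)%N ->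
  exists2 w, O w /\ O w^-1 & 1 - zeta ^+ i = lam * w.
Proof.
move=> /andP[i0 ip].
have geo (y : L) b : 1 - y ^+ b = (1 - y) * \sum_(j < b) y ^+ j.
  by rewrite -opprB subrX1 -mulNr opprB.
pose w := \sum_(j < i) zeta ^+ j; exists w; last exact: geo.
have co : coprime i p.
  by rewrite coprime_sym prime_coprime // gtnNdvd.
split; first by apply: O_sum => j _; apply: OX O_zeta.
have [b hb] : exists b, (i * b = 1 %[mod p])%N.
  case: (egcdnP p i0) => u k; rewrite (eqP co) mulnC => e _.
  by exists u; rewrite e modnMDl.
pose v := \sum_(j < b) (zeta ^+ i) ^+ j.
suff -> : w^-1 = v by apply: O_sum => j _; do 2!apply: OX; apply: O_zeta.
have e : lam = lam * (w * v).
  rewrite mulrA -geo -geo -exprM; congr (1 - _).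
  by rewrite -(prim_expr_mod zeta_prim) hb prim_expr_mod // expr1.
have wv : w * v = 1.
  by apply: (mulfI lam_neq0); rewrite -e mulr1.
by apply: (mulfI (x := w)); rewrite ?wv ?mulfV //; apply: contraPneq wv => ->; rewrite mul0r => /esym/eqP; rewrite oner_eq0.
Qed.

(** Both sides are the value at 1 of (X^p - 1) / (X - 1). *)
Lemma prod_one_sub_zeta : \prod_(1 <= i < p) (1 - zeta ^+ i) = p%:R.
Proof.
have := factor_Xn_sub_1 zeta_prim.
rewrite big_ltn ?prime_gt0 // expr0 -['X^p]/('X ^+ p) subrX1.
have X1 : 'X - 1 != 0 :> {poly L} by rewrite -polyC1 polyXsubC_eq0.
rewrite polyC1 => /(mulfI X1)/(congr1 (horner^~ 1)).
rewrite horner_prod horner_sum; under eq_bigr do rewrite !hornerE.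
by move=> ->; under eq_bigr do rewrite hornerXn expr1n; rewrite sumr_const card_ord.
Qed.

Lemma p_lam : exists2 u, O u /\ O u^-1 & p%:R = lam ^+ p.-1 * u.
Proof.
have ex (i : nat) : exists w, (0 < i < p)%N -> [/\ O w, O w^-1 & 1 - zeta ^+ i = lam * w].
  case ip : (0 < i < p)%N; last by exists 0.
  by have [w [h1 h2] h3] := lam_unit ip; exists w.
pose w i := projT1 (cid (ex i)).
have wP i : (0 < i < p)%N -> [/\ O (w i), O (w i)^-1 & 1 - zeta ^+ i = lam * w i].
  exact: (projT2 (cid (ex i))).
exists (\prod_(1 <= i < p) w i).
  rewrite -prodfV !big_nat; split; apply: O_prod => i /wP[] //.
have -> : p%:R = \prod_(1 <= i < p) (lam * w i).
  by rewrite -prod_one_sub_zeta; apply: eq_big_nat => i /wP[].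
by rewrite big_split /= prodr_const_nat subn1.
Qed.

(** Modulo [lam], zeta becomes 1, so the residue of a polynomial in zeta is its value at 1. *)
Lemma O_res y : O y -> exists c : int, exists2 z, O z & y = c%:~R + lam * z.
Proof.
move=> [q ->]; exists q.[1].
have /factor_theorem[r e] : root (q - q.[1]%:P) 1.
  by apply/rootP; rewrite !hornerE subrr.
exists (- (map_poly intr r).[zeta]); first exact: ON (O_poly r).
have := congr1 (fun t => (map_poly intr t).[zeta]) e.
rewrite !rmorphB !rmorphM /= !map_polyC /= !rmorphB /= map_polyX !map_polyC !hornerE /= => h.
by rewrite -[LHS](subrK (q.[1])%:~R) h addrC /lam mulrN -mulNr opprB mulrC.
Qed.

(** * Integral closedness of Z[zeta] *)

Notation integral := (integralOver (intr : int -> L)).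

Lemma O_integral x : O x -> integral x.
Proof.
move=> [q ->]; elim/poly_ind: q => [|q c IH].
  by rewrite rmorph0 horner0; apply: integral0.
rewrite rmorphD rmorphM /= map_polyX map_polyC !hornerE.
apply: integral_add (integral_id _ c); apply: integral_mul IH _.
exists ('X^p - 1); first exact: monicXnsubC (prime_gt0 p_pr).
by apply/rootP; rewrite rmorphB rmorph1 /= map_polyXn !hornerE zetap subrr.
Qed.

Lemma integral_rat (a : rat) : integral a%:A -> a \is a Num.int.
Proof.
move=> [q mq rq].
have ra : root (map_poly (intr : int -> rat) q) a.
  rewrite -(fmorph_root (in_alg L)) -map_poly_comp.
  rewrite (eq_map_poly (g := intr)) //; first by move=> c /=; rewrite scaler_int.
rewrite -Cint_rat; apply: Cint_rat_Aint; first exact: Crat_rat.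
apply: (@root_monic_Aint (map_poly intr q)); last 1 first.
- by apply/polyOverP => i; rewrite coef_map /= intr_int.
- rewrite -(fmorph_root (ratr : {rmorphism rat -> algC})) -map_poly_comp in ra.
  by rewrite (eq_map_poly (g := intr)) in ra => // c /=; rewrite ratr_int.
- exact: monic_map.
Qed.

Lemma integral_gal (s : Delta) x : integral x -> integral (s x).
Proof.
move=> [q mq rq]; exists q => //.
rewrite -(fmorph_root s) -map_poly_comp in rq.
by rewrite (eq_map_poly (g := intr)) in rq => // c /=; rewrite rmorph_int.
Qed.

(* lam * x is congruent modulo lam to an integer c divisible by lam among the
   algebraic integers; then c^(p-1) / p is integral, so p divides c. *)
Lemma integral_lam x : integral x -> O (lam * x) -> O x.
Proof.
move=> ix /O_res[c [z Oz e]].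
have [u [Ou Ou'] pu] := p_lam.
have u0 : u != 0 by apply: contraNneq p_neq0 => u0; rewrite pu u0 mulr0.
pose t := x - z.
have te : lam * t = c%:~R by rewrite mulrBr e addrK.
have it : integral t by apply: integral_sub ix (O_integral Oz).
pose a : rat := c%:~R ^+ p.-1 / p%:R.
have aE : a%:A = t ^+ p.-1 * u^-1.
  rewrite -in_algE rmorphM fmorphV rmorphXn rmorph_int rmorph_nat.
  rewrite pu -te exprMn invfM mulrACA mulfV ?mul1r //.
  by rewrite expf_neq0 ?lam_neq0.
have : a \is a Num.int.
  apply: integral_rat; rewrite aE; apply: integral_mul (O_integral Ou').
  by elim: p.-1 => [|i IH]; [exact: integral1|rewrite exprS; apply: integral_mul].
case/intrP => b ab.
have pc : (p %| `|c|)%N.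
  have e1 : c ^+ p.-1 = b * p%:Z.
    apply: (@intr_inj rat); rewrite rmorphXn rmorphM /= -ab /a mulfVK //.
    by rewrite pnatr_eq0 -lt0n prime_gt0.
  have : (p %| `|c ^+ p.-1|)%N by rewrite e1 abszM dvdn_mull.
  by rewrite abszX Euclid_dvdX // => /andP[].
have [c' cE] : exists c' : int, c = p%:Z * c'.
  by have /dvdzP[c' ->] : (p%:Z %| c)%Z by []; exists c'; rewrite mulrC.
have xE : x = z + lam ^+ p.-2 * u * c'%:~R.
  apply: (mulfI lam_neq0); rewrite e addrC mulrDr; congr (_ + _).
  rewrite cE rmorphM /= -[(p%:Z)%:~R]/(p%:R) pu !mulrA -exprS prednK //.
  exact: p1_gt0.
by rewrite xE; apply: OD Oz _; apply: OM (O_int _); apply: OM Ou; apply: OX O_lam.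
Qed.

Definition trc (x : L) : L := \sum_(s : Delta) s x.

Lemma trc_int x : integral x -> exists a : int, trc x = a%:~R.
Proof.
move=> ix.
have [a e] : exists a : rat, trc x = a%:A.
  apply: gal_fix => s; rewrite /trc rmorph_sum /=.
  rewrite [RHS](reindex_inj (mulIg s)); apply: eq_bigr => t _.
  by rewrite galM ?memvf.
have : a \is a Num.int.
  apply: integral_rat; rewrite -e /trc.
  elim/big_ind: _ => [||s _]; [exact: integral0|exact: integral_add|exact: integral_gal].
by case/intrP => b ab; exists b; rewrite e ab scaler_int.
Qed.

Lemma trcD x y : trc (x + y) = trc x + trc y.
Proof. by rewrite /trc -big_split; apply: eq_bigr => s _; rewrite rmorphD. Qed.

Lemma trcZ (a : rat) x : trc (a *: x) = a *: trc x.
Proof.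
rewrite /trc scaler_sumr; apply: eq_bigr => s _.
exact: linearZ.
Qed.

Lemma trc0 : trc 0 = 0.
Proof. by apply: big1 => s _; apply: rmorph0. Qed.

Lemma trc_sum (I : Type) (r : seq I) (F : I -> L) :
  trc (\sum_(i <- r) F i) = \sum_(i <- r) trc (F i).
Proof.
elim/big_rec2: _ => [|i y z _ <-]; last exact: trcD.
exact: trc0.
Qed.

Lemma trc_zeta_coprime a : coprime a p -> trc (zeta ^+ a) = trc zeta.
Proof.
move=> co; rewrite -(sigmaE co) /trc.
rewrite [RHS](reindex_inj (mulgI (sigma zeta a%:Z))); apply: eq_bigr => s _.
by rewrite galM ?memvf.
Qed.

Lemma trc_zeta : trc zeta = -1.
Proof.
have p10 : (p.-1)%:R != 0 :> L.
  have -> : (p.-1%:R : L) = (p.-1%:R : rat)%:A by rewrite scaler_nat.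
  by rewrite scaler_eq0 oner_eq0 orbF pnatr_eq0 -lt0n p1_gt0.
apply: (mulfI p10); rewrite mulrN1.
have -> : p.-1%:R * trc zeta = \sum_(1 <= a < p) trc (zeta ^+ a).
  rewrite (eq_big_nat _ _ (F2 := fun=> trc zeta)) ?sumr_const_nat => [|a /andP[a0 ap]].
    by rewrite subn1 mulr_natl.
  by apply: trc_zeta_coprime; rewrite coprime_sym prime_coprime // gtnNdvd.
have trc1 : trc 1 = p.-1%:R.
  rewrite /trc (eq_bigr (fun=> 1)) => [|s _]; last exact: rmorph1.
  by rewrite sumr_const card_gal.
apply/eqP; rewrite -addr_eq0 -trc1 -(expr0 zeta) addrC -trc_sum -trcD.
rewrite -(big_ltn (F := fun i => zeta ^+ i)) ?prime_gt0 // big_mkord sum_zeta.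
by rewrite trc0.
Qed.

Lemma trc_zetaX a : trc (zeta ^+ a) = (if (p %| a)%N then p%:R else 0) - 1.
Proof.
case: ifP => [pa|pa].
  move: pa; rewrite (prim_order_dvd zeta_prim) => /eqP ->.
  rewrite /trc (eq_bigr (fun=> 1)) => [|s _]; last exact: rmorph1.
  by rewrite sumr_const card_gal -subn1 natrB // prime_gt0.
by rewrite sub0r trc_zeta_coprime ?trc_zeta // coprime_sym prime_coprime // pa.
Qed.

(** Up to the factor p, the elements zeta^(-i) - zeta form the dual basis of 1, ..., zeta^(p-2) for
    the trace form. So p times a coordinate of [x] is the trace of an integral element. *)
Lemma integral_p x : integral x -> O (p%:R * x).
Proof.
move=> ix; apply/O_coord => i.
have p_gt0 := prime_gt0 p_pr.
pose y := zeta ^+ (p - i) - zeta.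
have iy : integral (x * y).
  apply: integral_mul ix (O_integral _).
  by apply: OB O_zeta; apply: OX O_zeta.
have [a ea] := trc_int iy.
have ltS (k : 'I_p.-1) : (k.+1 < p)%N by rewrite -[X in (_ < X)%N](prednK p_gt0) ltnS.
have ltp (k : 'I_p.-1) : (k < p)%N := ltnW (ltS k).
have dvd_sub (j : 'I_p.-1) : (p %| j + (p - i))%N = (j == i).
  rewrite /dvdn -(modnn p) -[X in _ == (X %% _)%N](subnKC (ltnW (ltp i))).
  by rewrite eqn_modDr !modn_small.
have tE (j : 'I_p.-1) : trc (zcoord j x *: zeta ^+ j * y) =
    zcoord j x *: (if j == i then p%:R else 0).
  rewrite -scalerAl trcZ mulrBr -exprD -exprSr -[X in _ - X]scale1r -scaleNr.
  rewrite trcD trcZ !trc_zetaX dvd_sub gtnNdvd //.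
  by rewrite sub0r scaleN1r opprK subrK.
have : trc (x * y) = (p%:R * zcoord i x)%:A.
  rewrite {1}(zcoordE x) mulr_suml trc_sum (bigD1 i) //= big1 => [|j ji].
    by rewrite addr0 tE eqxx mulrC -scalerA scaler_nat.
  by rewrite tE (negPf ji) scaler0.
rewrite ea -(scaler_int a (1 : L)) => /eqP; rewrite -subr_eq0 -scalerBl scaler_eq0.
rewrite oner_eq0 orbF subr_eq0 => /eqP e.
have -> : p%:R * x = (p%:R : rat) *: x by rewrite scaler_nat mulr_natl.
by rewrite zcoordZ -e intr_int.
Qed.

(** By [integral_p] the denominator is at most p, a unit times lam^(p-1); [integral_lam] removes one
    factor [lam] at a time. *)
Lemma integral_O x : integral x -> O x.
Proof.
move=> ix; have [u [Ou Ou'] pu] := p_lam.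
have u0 : u != 0 by apply: contraNneq p_neq0 => u0; rewrite pu u0 mulr0.
have iux : integral (u * x) by apply: integral_mul (O_integral Ou) ix.
have : O (lam ^+ p.-1 * (u * x)) by rewrite mulrA -pu; apply: integral_p.
elim: p.-1 => [|i IH].
  by rewrite expr0 mul1r => h; rewrite -(mulKf u0 x); apply: OM Ou' h.
rewrite exprS -mulrA => h; apply: IH; apply: integral_lam h.
by apply: integral_mul iux; apply: O_integral; apply: OX O_lam.
Qed.

(* An element stabilizing a nonzero finitely generated module is a root of the
   characteristic polynomial of a matrix over Z[zeta]. *)
Lemma stable_O n (v : 'rV[L]_n) (M : 'M[L]_n) x : v != 0 ->
  (forall i j, O (M i j)) -> v *m M = x *: v -> O x.
Proof.
move=> v0 OM' vM; apply: integral_O.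
have ex i j : exists q : {poly int}, M i j = (map_poly intr q).[zeta] := OM' i j.
pose phi : {rmorphism {poly int} -> L} := horner_eval zeta \o map_poly intr.
pose N : 'M[{poly int}]_n := \matrix_(i, j) projT1 (cid (ex i j)).
have MN : M = map_mx phi N.
  by apply/matrixP => i j; rewrite !mxE; apply: (projT2 (cid (ex i j))).
have : root (char_poly M) x.
  by rewrite -eigenvalue_root_char; apply/eigenvalueP; exists v.
rewrite MN -map_char_poly => rx.
apply: (integral_root_monic _ rx); first exact: monic_map (char_poly_monic N).
apply/integral_poly => i; rewrite coef_map.
by apply: O_integral; exists (char_poly N)`_i.
Qed.

(** As [M] fixes [v], the determinant of 1 - M is zero; as the entries of [M] lie in [B], it is
    congruent to 1 modulo [B]. *)
Lemma nakayama_mx n (v : 'rV[L]_n) (B : set L) (M : 'M[L]_n) : v != 0 ->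
  B `<=` O -> B 0 -> (forall x y, B x -> B y -> B (x + y)) ->
  (forall x y, O x -> B y -> B (x * y)) ->
  (forall i j, B (M i j)) -> v *m M = v -> B 1.
Proof.
move=> v0 BO B0 BD BM MB vM.
have BN x : B x -> B (- x) by move=> hx; rewrite -mulN1r; apply: BM hx; apply: ON O1.
pose R x y := [/\ O x, O y & B (x - y)].
have RD x x' y y' : R x x' -> R y y' -> R (x + y) (x' + y').
  move=> [h1 h2 h3] [h4 h5 h6]; split; [exact: OD|exact: OD|].
  by rewrite opprD addrACA; apply: BD.
have RM x x' y y' : R x x' -> R y y' -> R (x * y) (x' * y').
  move=> [h1 h2 h3] [h4 h5 h6]; split; [exact: OM|exact: OM|].
  have -> : x * y - x' * y' = y * (x - x') + x' * (y - y').
    by rewrite !mulrBr addrA [y * x]mulrC [y * x']mulrC subrK.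
  by apply: BD; apply: BM.
have RR x : O x -> R x x by move=> h; split=> //; rewrite subrr.
have Rd : R (\det (1%:M - M)) (\det (1%:M : 'M[L]_n)).
  rewrite /determinant; elim/big_ind2: _; [exact: RR O0|by move=> *; apply: RD|].
  move=> s _; apply: (RM); first by apply: RR; case: (odd_perm s); [apply: ON O1|apply: O1].
  elim/big_ind2: _; [exact: RR O1|by move=> *; apply: RM|].
  move=> i _; rewrite !mxE; split; last by rewrite addrAC subrr sub0r; apply: BN.
    by apply: OB; [apply: O_nat|apply: BO].
  exact: O_nat.
have d0 : \det (1%:M - M) = 0.
  apply/eqP/det0P; exists v => //.
  by rewrite mulmxBr mulmx1 vM subrr.
by case: Rd => _ _; rewrite d0 det1 sub0r => /BN; rewrite opprK.
Qed.

(** * Norms of cyclotomic numbers *)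

Definition nrm (x : L) : L := \prod_(s : Delta) s x.

Lemma nrmM x y : nrm (x * y) = nrm x * nrm y.
Proof. by rewrite /nrm -big_split; apply: eq_bigr => s _; rewrite rmorphM. Qed.

Lemma nrm_neq0 x : x != 0 -> nrm x != 0.
Proof. by move=> x0; apply/prodf_neq0 => s _; rewrite fmorph_eq0. Qed.

Lemma nrm_rat x : nrm x = (zcoord ord0p (nrm x))%:A.
Proof.
have [a e] : exists a : rat, nrm x = a%:A.
  apply: gal_fix => s; rewrite /nrm rmorph_prod /=.
  rewrite [RHS](reindex_inj (mulIg s)); apply: eq_bigr => t _.
  by rewrite galM ?memvf.
by rewrite e zcoord_rat.
Qed.

Definition qnorm (x : L) : rat := zcoord ord0p (nrm x).

Lemma qnormM x y : qnorm (x * y) = qnorm x * qnorm y.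
Proof.
rewrite /qnorm nrmM [in LHS](nrm_rat x) [in LHS](nrm_rat y).
by rewrite -scalerAl mul1r scalerA zcoord_rat.
Qed.

Lemma qnorm_neq0 x : x != 0 -> qnorm x != 0.
Proof.
by move/nrm_neq0; apply: contraNneq => h; rewrite nrm_rat -/(qnorm x) h scale0r.
Qed.

Lemma qnorm_int x : O x -> qnorm x \is a Num.int.
Proof.
move=> Ox; apply: O_rat; rewrite -nrm_rat.
by apply: O_prod => s _; apply: O_gal.
Qed.

(** In coordinates the norm is a form of degree p - 1; the constant adds up the absolute values of
    the coefficients in its expansion. *)
Lemma qnorm_bound : exists2 C : rat, 0 <= C & forall (e : rat) x, 0 <= e ->
  (forall i, `|zcoord i x| <= e) -> `|qnorm x| <= e ^+ p.-1 * C.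
Proof.
pose Z (f : {ffun Delta -> 'I_p.-1}) := zcoord ord0p (\prod_(s : Delta) s (zeta ^+ f s)).
exists (\sum_f `|Z f|); first exact: sumr_ge0.
move=> e x e0 xe; rewrite /qnorm /nrm.
have -> : \prod_(s : Delta) s x =
    \sum_(f : {ffun Delta -> 'I_p.-1}) (\prod_s zcoord (f s) x) *: \prod_(s : Delta) s (zeta ^+ f s).
  under eq_bigr => s _ do rewrite {1}(zcoordE x) rmorph_sum /=.
  rewrite bigA_distr_bigA /=; apply: eq_bigr => f _.
  rewrite -scaler_prod; apply: eq_bigr => s _; exact: linearZ.
rewrite zcoord_sum mulr_sumr; apply: le_trans (ler_norm_sum _ _ _) _.
apply: ler_sum => f _; rewrite zcoordZ normrM; apply: ler_wpM2r => //.
have -> : e ^+ p.-1 = \prod_(s : Delta) e by rewrite prodr_const card_gal.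
by rewrite normr_prod; apply: ler_prod => s _; rewrite normr_ge0 xe.
Qed.

Lemma zcoord_comb (c : 'I_p.-1 -> rat) i : zcoord i (\sum_k c k *: zeta ^+ k) = c i.
Proof.
rewrite zcoord_sum (bigD1 i) //= zcoordZ zcoord_zeta eqxx mulr1 big1 ?addr0 // => k ki.
by rewrite zcoordZ zcoord_zeta eq_sym (negPf ki) mulr0.
Qed.

Lemma O_comb (c : 'I_p.-1 -> int) : O (\sum_k (c k)%:~R *: zeta ^+ k).
Proof. by apply/O_coord => i; rewrite zcoord_comb intr_int. Qed.

(* Pigeonhole on the fractional parts of the coordinates of 0, x, 2x, ... *)
Lemma euclid_multiple : exists2 M : nat, (0 < M)%N & forall x : L,
  exists t : nat, [/\ (0 < t)%N, (t <= M)%N &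
    exists2 w, O w & `|qnorm (t%:R * x - w)| < 1].
Proof.
have [C C0 hC] := qnorm_bound.
(* Boxes of side 1/m bound the norm by C / m^(p-1), which is below 1 once m exceeds C; m^(p-1) + 1
   multiples of [x] force two into one box. *)
pose m := (Num.bound C).+1.
have Cm : C < m%:R.
  by apply: lt_le_trans (archi_boundP C0) _; rewrite ler_nat.
have m0 : 0 < m%:R :> rat by rewrite ltr0n.
exists (m ^ p.-1)%N; first by rewrite expn_gt0.
move=> x; pose fl (t : nat) i := Num.floor (t%:R * zcoord i x).
pose fr (t : nat) i : rat := t%:R * zcoord i x - (fl t i)%:~R.
have fr0 t i : 0 <= fr t i by rewrite subr_ge0 ge_floor.
have fr1 t i : fr t i < 1.
  by rewrite ltrBlDl; have := floorD1_gt (t%:R * zcoord i x); rewrite intrD.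
pose bx (t : nat) i := Num.truncn (m%:R * fr t i).
have bxm t i : (bx t i < m)%N.
  rewrite -(@ltr_nat rat); apply: le_lt_trans (_ : m%:R * fr t i < _).
    by have /andP[] : (bx t i)%:R <= m%:R * fr t i < (bx t i).+1%:R
      by apply: truncn_itv; rewrite mulr_ge0 // ltW.
  by rewrite gtr_pMr.
pose box (t : 'I_(m ^ p.-1).+1) := [ffun i => Ordinal (bxm t i)].
have /injectivePn[t1 [t2 t12 e12]] : ~~ injectiveb box.
  apply/negP => /injectiveP /leq_card.
  by rewrite card_ffun !card_ord ltnn.
have main (u v : 'I_(m ^ p.-1).+1) : (u < v)%N -> box u = box v ->
    exists t : nat, [/\ (0 < t)%N, (t <= m ^ p.-1)%N &
      exists2 w, O w & `|qnorm (t%:R * x - w)| < 1].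
  move=> uv e; exists (v - u)%N; split.
  - by rewrite subn_gt0.
  - by rewrite leq_subLR; apply: leq_trans (leq_addl _ _); rewrite -ltnS.
  exists (\sum_k (fl v k - fl u k)%:~R *: zeta ^+ k); first exact: O_comb.
  apply: le_lt_trans (hC m%:R^-1 _ _ _) _; first by rewrite invr_ge0 ltW.
    move=> i; rewrite zcoordB zcoord_comb.
    have -> : (v - u)%:R * x = (v - u)%:R *: x by rewrite scaler_nat mulr_natl.
    have -> : zcoord i ((v - u)%:R *: x) = (v - u)%:R * zcoord i x.
      by rewrite !scaler_nat -[x *+ _]scaler_nat zcoordZ.
    have -> : (v - u)%:R * zcoord i x - (fl v i - fl u i)%:~R = fr v i - fr u i.
      rewrite natrB ?(ltnW uv) // mulrBl intrB /fr.
      by rewrite !opprB addrACA [in RHS]addrACA [- _ + _ in RHS]addrC.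
    have /(congr1 (fun h : {ffun _ -> 'I_m} => val (h i))) := e.
    rewrite !ffunE /= => eb.
    rewrite -(ler_pM2l m0) mulfV ?gt_eqF // -[X in X * _]gtr0_norm // -normrM mulrBr.
    have tr t : (bx t i)%:R <= m%:R * fr t i < (bx t i).+1%:R.
      by apply: truncn_itv; rewrite mulr_ge0 // ltW.
    have /andP[a1 a2] := tr u; have /andP[b1 b2] := tr v.
    rewrite eb in a1 a2; rewrite ler_norml; apply/andP; split.
      rewrite lerBrDl -lerBrDr opprK; apply: le_trans (ltW a2) _.
      by rewrite -natr1 lerD2r.
    rewrite lerBlDl; apply: le_trans (ltW b2) _.
    by rewrite -natr1 lerD2r.
  rewrite -(prednK p1_gt0) exprS.
  apply: le_lt_trans (_ : m%:R^-1 * C < 1); last first.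
    by rewrite mulrC ltr_pdivrMr // mul1r.
  rewrite -mulrA; apply: ler_wpM2l; first by rewrite invr_ge0 ltW.
  rewrite ler_piMl // exprn_ile1 ?invr_ge0 ?(ltW m0) // invf_le1 // ler1n //.
case: (ltngtP t1 t2) => [lt|lt|/val_inj e]; first exact: main lt e12.
  by apply: main lt _.
by rewrite e eqxx in t12.
Qed.

(** * Fractional ideals *)

Definition Omod (I : set L) := [/\ I 0, forall x y, I x -> I y -> I (x + y) &
  forall x y, O x -> I y -> I (x * y)].

Definition span (s : seq L) : set L := [set x | exists c : 'I_(size s) -> L,
  (forall i, O (c i)) /\ x = \sum_(i < size s) c i * s`_i].

Lemma OmodO : Omod O. Proof. by split; [apply: O0|apply: OD|apply: OM]. Qed.

Lemma Omod_span s : Omod (span s).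
Proof.
split.
- by exists (fun=> 0); split; [move=> _; apply: O0|rewrite big1 // => i _; rewrite mul0r].
- move=> _ _ [c [Oc ->]] [d [Od ->]]; exists (fun i => c i + d i); split.
    by move=> i; apply: OD.
  by rewrite -big_split; apply: eq_bigr => i _; rewrite mulrDl.
move=> x _ Ox [c [Oc ->]]; exists (fun i => x * c i); split.
  by move=> i; apply: OM.
by rewrite mulr_sumr; apply: eq_bigr => i _; rewrite mulrA.
Qed.

Lemma span_mem s x : x \in s -> span s x.
Proof.
move=> xs; have xi : (index x s < size s)%N by rewrite index_mem.
exists (fun i => (i == Ordinal xi)%:R); split; first by move=> i; apply: O_nat.
rewrite (bigD1 (Ordinal xi)) //= eqxx mul1r nth_index // big1 ?addr0 // => i /negPf ->.
by rewrite mul0r.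
Qed.

Lemma span_min s I : Omod I -> {in s, forall x, I x} -> span s `<=` I.
Proof.
move=> [I0 ID IM] sI _ [c [Oc ->]]; elim/big_ind: _ => // i _.
by apply: IM => //; apply: sI; rewrite mem_nth.
Qed.

Lemma Omod_frac I : frac_ideal zeta I -> Omod I.
Proof. by move=> [_ [s ->]]; apply: Omod_span. Qed.

Lemma ideal_mul_mem (I J : set L) x y : I x -> J y -> ideal_mul I J (x * y).
Proof.
by exists 1%N, (fun=> x), (fun=> y); split => //; rewrite big_ord_recl big_ord0 addr0.
Qed.

Lemma ideal_mul_min (I J K : set L) : K 0 -> (forall x y, K x -> K y -> K (x + y)) ->
  (forall x y, I x -> J y -> K (x * y)) -> ideal_mul I J `<=` K.
Proof.
move=> K0 KD h _ [n [a [b [Ia Jb ->]]]]; elim/big_ind: _ => // i _; exact: h.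
Qed.

Lemma ideal_mul0 (I J : set L) : ideal_mul I J 0.
Proof.
by exists 0%N, (fun=> 0), (fun=> 0); split; [case|case|rewrite big_ord0].
Qed.

Lemma ideal_mulD (I J : set L) x y :
  ideal_mul I J x -> ideal_mul I J y -> ideal_mul I J (x + y).
Proof.
move=> [n [a [b [Ia Jb ->]]]] [m [c [d [Ic Jd ->]]]].
exists (n + m)%N,
  (fun i : 'I_(n + m) => match fintype.split i with inl j => a j | inr j => c j end),
  (fun i : 'I_(n + m) => match fintype.split i with inl j => b j | inr j => d j end); split.
- by move=> i; case: (fintype.split i).
- by move=> i; case: (fintype.split i).
rewrite big_split_ord /=; congr (_ + _); apply: eq_bigr => i _.
  by rewrite (unsplitK (inl i)).
by rewrite (unsplitK (inr i)).
Qed.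

Lemma ideal_mulC (I J : set L) : ideal_mul I J = ideal_mul J I.
Proof.
have sub (I' J' : set L) : ideal_mul I' J' `<=` ideal_mul J' I'.
  apply: ideal_mul_min; [exact: ideal_mul0|exact: ideal_mulD|].
  by move=> x y hx hy; rewrite mulrC; apply: ideal_mul_mem.
by apply/seteqP; split.
Qed.

Lemma Omod_mul I J : Omod I -> Omod (ideal_mul I J).
Proof.
move=> [_ _ IM]; split; [exact: ideal_mul0|exact: ideal_mulD|].
move=> x y Ox; move: y; apply: (@ideal_mul_min I J [set y | ideal_mul I J (x * y)]).
- by rewrite /= mulr0; apply: ideal_mul0.
- by move=> y z; rewrite /= mulrDr; apply: ideal_mulD.
by move=> a b Ia Jb; rewrite /= mulrA; apply: ideal_mul_mem Jb; apply: IM.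
Qed.

Lemma ideal_mulS (I I' J J' : set L) :
  I `<=` I' -> J `<=` J' -> ideal_mul I J `<=` ideal_mul I' J'.
Proof.
move=> sI sJ; apply: ideal_mul_min; [exact: ideal_mul0|exact: ideal_mulD|].
by move=> x y /sI hx /sJ hy; apply: ideal_mul_mem.
Qed.

Lemma ideal_mulA (I J K : set L) :
  ideal_mul I (ideal_mul J K) = ideal_mul (ideal_mul I J) K.
Proof.
have sub (I' J' K' : set L) :
    ideal_mul I' (ideal_mul J' K') `<=` ideal_mul (ideal_mul I' J') K'.
  apply: ideal_mul_min; [exact: ideal_mul0|exact: ideal_mulD|].
  move=> x y Ix; move: y.
  apply: (@ideal_mul_min J' K' [set y | ideal_mul (ideal_mul I' J') K' (x * y)]).
  - by rewrite /= mulr0; apply: ideal_mul0.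
  - by move=> y z; rewrite /= mulrDr; apply: ideal_mulD.
  by move=> a b Ja Kb; rewrite /= mulrA; apply: ideal_mul_mem Kb; apply: ideal_mul_mem.
apply/seteqP; split; first exact: sub.
rewrite [ideal_mul _ K]ideal_mulC [ideal_mul I J]ideal_mulC.
rewrite [ideal_mul I (ideal_mul J K)]ideal_mulC [ideal_mul J K]ideal_mulC.
exact: sub.
Qed.

Lemma ideal_mul1 I : Omod I -> ideal_mul O I = I.
Proof.
move=> [I0 ID IM]; apply/seteqP; split; first exact: ideal_mul_min.
by move=> x Ix; rewrite -[x]mul1r; apply: ideal_mul_mem Ix; apply: O1.
Qed.

Lemma frac_mul I J : frac_ideal zeta I -> frac_ideal zeta J ->
  frac_ideal zeta (ideal_mul I J).
Proof.
move=> [[x Ix x0] [s Is]] [[y Jy y0] [t Jt]]; split.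
  by exists (x * y); [apply: ideal_mul_mem|rewrite mulf_neq0].
exists [seq a * b | a <- s, b <- t]; set P := [seq _ | _ <- _, _ <- _].
have [P0 PD PM] := Omod_span P.
apply/seteqP; split.
  apply: ideal_mul_min => // a b; rewrite Is Jt => sa tb; move: a sa.
  apply: span_min.
    split; first by rewrite mul0r.
      by move=> u v; rewrite mulrDl; apply: PD.
    by move=> u v; rewrite -mulrA; apply: PM.
  move=> a sa; move: b tb; apply: span_min.
    split; first by rewrite mulr0.
      by move=> u v; rewrite mulrDr; apply: PD.
    by move=> u v; rewrite mulrCA; apply: PM.
  move=> b tb; apply: span_mem; apply/allpairsP; exists (a, b); split => //.
apply: span_min; first by apply: Omod_mul; rewrite Is; apply: Omod_span.
move=> _ /allpairsP[[a b] /= [sa tb ->]].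
by apply: ideal_mul_mem; rewrite ?Is ?Jt; apply: span_mem.
Qed.

Lemma frac_gen a : a != 0 -> frac_ideal zeta (ideal_gen zeta a).
Proof.
move=> a0; split; first by exists a => //; exists 1; [apply: O1|rewrite mulr1].
exists [:: a]; apply/seteqP; split.
  move=> _ [x Ox <-]; exists (fun=> x); split => //=.
  by rewrite big_ord_recl big_ord0 addr0 mulrC.
apply: span_min; last by move=> _ /[!inE] /eqP ->; exists 1; [apply: O1|rewrite mulr1].
split; first by exists 0; [apply: O0|rewrite mulr0].
  by move=> _ _ [x Ox <-] [y Oy <-]; exists (x + y); [apply: OD|rewrite mulrDr].
by move=> x _ Ox [y Oy <-]; exists (x * y); [apply: OM|rewrite mulrCA].
Qed.

Lemma gen1 : ideal_gen zeta 1 = O.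
Proof.
by apply/seteqP; split => [_ [x Ox <-]|x Ox]; rewrite ?mul1r //; exists x; rewrite ?mul1r.
Qed.

Lemma frac_O : frac_ideal zeta O.
Proof. by rewrite -gen1; apply: frac_gen (oner_neq0 _). Qed.

Lemma gen_mul I a : Omod I -> ideal_mul (ideal_gen zeta a) I = [set a * x | x in I].
Proof.
move=> [I0 ID IM]; apply/seteqP; split.
  apply: ideal_mul_min.
  - by exists 0; rewrite ?mulr0.
  - by move=> _ _ [x Ix <-] [y Iy <-]; exists (x + y); rewrite ?mulrDr; auto.
  by move=> _ y [x Ox <-] Iy; exists (x * y); rewrite ?mulrA; auto.
move=> _ [x Ix <-]; apply: ideal_mul_mem Ix.
by exists 1; [apply: O1|rewrite mulr1].
Qed.

Lemma gen_gen a b : ideal_mul (ideal_gen zeta a) (ideal_gen zeta b) = ideal_gen zeta (a * b).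
Proof.
case: (eqVneq b 0) => [->|b0]; last first.
  rewrite gen_mul; last exact: Omod_frac (frac_gen b0).
  apply/seteqP; split => [_ [_ [x Ox <-] <-]|_ [x Ox <-]].
    by exists x; rewrite // mulrA.
  by exists (b * x); rewrite ?mulrA //; exists x.
have z : ideal_gen zeta 0 = [set 0].
  apply/seteqP; split => [_ [x Ox <-]|_ ->]; first by rewrite mul0r.
  by exists 0; [apply: O0|rewrite mul0r].
rewrite mulr0 z; apply/seteqP; split.
  by apply: ideal_mul_min => [//|_ _ -> ->|x _ _ ->]; rewrite ?addr0 ?mulr0.
by move=> _ ->; apply: ideal_mul0.
Qed.

(** * Finitely many ideal classes, and invertibility of ideals *)

Lemma span_denom s : exists2 d : nat, (0 < d)%N & forall x, span s x -> O (d%:R * x).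
Proof.
have den x : exists2 d : nat, (0 < d)%N & O (d%:R * x).
  pose D := (\prod_i `|denq (zcoord i x)|)%N; exists D.
    by apply: prodn_gt0 => i; rewrite absz_gt0 denq_neq0.
  apply/O_coord => i; have -> : D%:R * x = (D%:R : rat) *: x by rewrite scaler_nat mulr_natl.
  rewrite zcoordZ /D (bigD1 i) //= natrM mulrAC rpredM //.
    by rewrite mulrC pmulrn absz_denq -numqE intr_int.
  exact: rpred_nat.
have [d d0 hd] : exists2 d : nat, (0 < d)%N & {in s, forall x, O (d%:R * x)}.
  elim: s => [|x s [d d0 hd]]; first by exists 1%N.
  have [e e0 he] := den x; exists (e * d)%N; first by rewrite muln_gt0 e0.
  move=> y /[!inE] /predU1P[->|ys]; rewrite natrM.
    by rewrite mulrAC; apply: OM he (O_nat _).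
  by rewrite -mulrA; apply: OM (O_nat _) (hd y ys).
exists d => // x; apply: (@span_min s [set x | O (d%:R * x)]) => //.
split => /=; first by rewrite mulr0; apply: O0.
  by move=> u v hu hv; rewrite mulrDr; apply: OD.
by move=> u v hu hv; rewrite mulrCA; apply: OM.
Qed.

(** Take b in I nonzero of least norm. For a in I, [euclid_multiple] gives t <= M and w with the
    norm of t a / b - w below 1; minimality forces t a = w b. So M! clears all quotients a / b at
    once, and c = M! / b works. *)
Lemma ideal_multiple : exists2 Q : nat, (0 < Q)%N & forall I, frac_ideal zeta I ->
  exists c, [/\ c != 0, ideal_mul (ideal_gen zeta c) I `<=` O &
                ideal_mul (ideal_gen zeta c) I Q%:R].
Proof.
have [M M0 hM] := euclid_multiple; exists M`!; first exact: fact_gt0.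
move=> I fI; have [I0 ID IM] := Omod_frac fI.
have [[x0 Ix0 nx0] [s /= Is0]] := fI; have Is : I = span s := Is0.
have [d d0 hd] := span_denom s; rewrite -Is in hd.
have dn0 : (d%:R : L) != 0.
  have -> : (d%:R : L) = (d%:R : rat)%:A by rewrite scaler_nat.
  by rewrite scaler_eq0 oner_eq0 orbF pnatr_eq0 -lt0n.
pose nn x := `|Num.floor `|qnorm (d%:R * x)| |%N.
have nnE x : I x -> `|qnorm (d%:R * x)| = (nn x)%:R.
  move=> Ix; have /intrP[a e] := qnorm_int (hd x Ix).
  by rewrite /nn e -intr_norm intrKfloor [RHS]pmulrn abszE normr_id.
have ex : exists k, `[< exists x, [/\ I x, x != 0 & nn x = k] >].
  by exists (nn x0); apply/asboolP; exists x0.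
have [k /asboolP[b [Ib b0 bk]] kmin] := ex_minnP ex.
have key a : I a -> exists2 t : nat, (0 < t <= M)%N & O (t%:R * (a / b)).
  move=> Ia; have [t [t0 tM [w Ow hw]]] := hM (a / b).
  exists t; first by rewrite t0.
  pose c := t%:R * a - w * b.
  have Ic : I c.
    apply: ID; first by apply: IM Ia; apply: O_nat.
    by rewrite -mulNr; apply: IM Ib; apply: ON.
  have cE : c = (t%:R * (a / b) - w) * b by rewrite mulrBl -mulrA mulfVK.
  case: (eqVneq c 0) => [c0|c0].
    suff -> : t%:R * (a / b) = w by [].
    by apply/eqP; rewrite -subr_eq0 -(mulIr_eq0 _ (mulIf b0)) -cE c0.
  have : (k <= nn c)%N by apply: kmin; apply/asboolP; exists c.
  rewrite leqNgt -bk -(@ltr_nat rat) -!nnE // cE mulrCA [X in `|X| < _]qnormM normrM => /negP[].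
  by rewrite gtr_pMl // normr_gt0 qnorm_neq0 // mulf_neq0.
have fact_dvd t : (0 < t <= M)%N -> exists e : nat, M`! = (e * t)%N.
  by move/dvdn_fact => /dvdnP[e ->]; exists e.
exists (M`!%:R / b); rewrite gen_mul; last exact: Omod_frac; split.
- rewrite mulf_neq0 ?invr_eq0 //.
  have -> : (M`!%:R : L) = (M`!%:R : rat)%:A by rewrite scaler_nat.
  by rewrite scaler_eq0 oner_eq0 orbF pnatr_eq0 -lt0n fact_gt0.
- move=> _ [a Ia <-]; have [t /fact_dvd[e ->] Ot] := key a Ia.
  by rewrite natrM mulrAC -!mulrA; apply: OM Ot; apply: O_nat.
by exists b => //; rewrite mulfVK.
Qed.

(** Scaled as in [ideal_multiple], an ideal lies between Q Z[zeta] and Z[zeta], so it is determined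
    by the residues modulo Q that it contains; this set of residues is the code. *)
Lemma class_code : exists T : finType, exists g : set L -> T, forall I J,
  frac_ideal zeta I -> frac_ideal zeta J -> g I = g J ->
  exists2 a, a != 0 & J = ideal_mul (ideal_gen zeta a) I.
Proof.
have [Q Q0 hQ] := ideal_multiple.
have [q qE] : exists q, Q = q.+1 by exists Q.-1; rewrite prednK.
have ex I : exists c, frac_ideal zeta I -> [/\ c != 0, ideal_mul (ideal_gen zeta c) I `<=` O &
                ideal_mul (ideal_gen zeta c) I Q%:R].
  case: (pselect (frac_ideal zeta I)) => [/hQ[c hc]|]; first by exists c.
  by exists 0.
pose c I := projT1 (cid (ex I)); have cP I := projT2 (cid (ex I)) : _ -> [/\ c I != 0, _ & _].
pose nI I := ideal_mul (ideal_gen zeta (c I)) I.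
pose el (v : {ffun 'I_p.-1 -> 'I_Q}) : L := \sum_i (v i)%:R *: zeta ^+ i.
exists {ffun {ffun 'I_p.-1 -> 'I_Q} -> bool}, (fun I => [ffun v => `[< nI I (el v) >]]).
move=> I J fI fJ /ffunP e.
have [cI0 nIO IQ] := cP I fI; have [cJ0 nJO JQ] := cP J fJ.
have mI : Omod (nI I) by apply: Omod_frac; apply: frac_mul fI; apply: frac_gen.
have mJ : Omod (nI J) by apply: Omod_frac; apply: frac_mul fJ; apply: frac_gen.
have red x : O x -> exists2 v, exists2 y, O y & x = el v + Q%:R * y & True.
  move=> Ox; have ci i : exists a : int, zcoord i x = a%:~R.
    by have /O_coord/(_ i)/intrP[a ->] := Ox; exists a.
  pose a i := projT1 (cid (ci i)); have aP i : zcoord i x = (a i)%:~R := projT2 (cid (ci i)).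
  have vlt i : (`|(a i %% Q)%Z| < Q)%N.
    by rewrite -ltz_nat gez0_abs ?modz_ge0 ?ltz_pmod // -lt0n.
  exists [ffun i => Ordinal (vlt i)] => //.
  exists (\sum_i ((a i %/ Q)%Z)%:~R *: zeta ^+ i); first exact: O_comb.
  rewrite {1}(zcoordE x) mulr_sumr -big_split; apply: eq_bigr => i _ /=.
  rewrite ffunE /= -scalerAr -[Q%:R * _]/(Q%:R * zeta ^+ i) mulr_natl -scaler_nat scalerA -scalerDl.
  congr (_ *: _); rewrite aP {1}(divz_eq (a i) Q) addrC rmorphD rmorphM /=.
  by congr (_ + _); rewrite -[in LHS](gez0_abs (modz_ge0 _ _)) // -lt0n.
have sub K K' : Omod (nI K) -> Omod (nI K') -> nI K `<=` O -> nI K Q%:R -> nI K' Q%:R ->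
    (forall v, nI K (el v) -> nI K' (el v)) -> nI K `<=` nI K'.
  move=> [_ KD KM] [_ KD' KM'] KO KQ KQ' h x Kx.
  have [v [y Oy xE] _] := red x (KO x Kx).
  have KN z : nI K z -> nI K (- z).
    by move=> hz; rewrite -mulN1r; apply: KM hz; apply: ON O1.
  rewrite xE; apply: KD'; last by rewrite mulrC; apply: KM'.
  apply: h; have -> : el v = x - Q%:R * y by rewrite xE addrK.
  by apply: KD Kx _; apply: KN; rewrite mulrC; apply: KM.
have IJ v : nI I (el v) <-> nI J (el v).
  have := e v; rewrite !ffunE => h.
  by split=> hv; apply/asboolP; [rewrite -h|rewrite h]; apply/asboolP.
have eIJ : nI I = nI J.
  by apply/seteqP; split; apply: sub => // v /IJ.
exists (c I / c J); first by rewrite mulf_neq0 // invr_eq0.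
rewrite mulrC -gen_gen -ideal_mulA -/(nI I) eIJ /nI ideal_mulA gen_gen mulVf // gen1.
by rewrite ideal_mul1 //; apply: Omod_frac.
Qed.

(* Two powers of I are proportional since there are finitely many classes; then
   nakayama_mx shows that the ideal B formed from their ratio is trivial. *)
Lemma frac_invertible I : frac_ideal zeta I ->
  exists2 J, frac_ideal zeta J & ideal_mul I J = O.
Proof.
move=> fI; have [T [g hg]] := class_code.
pose pw n := iter n (ideal_mul I) O.
have fpw n : frac_ideal zeta (pw n).
  by elim: n => [|n IH] /=; [apply: frac_O|apply: frac_mul].
have pwD n m : pw (n + m)%N = ideal_mul (pw n) (pw m).
  elim: n => [|n IH] /=; first by rewrite ideal_mul1 //; apply: Omod_frac.
  by rewrite IH ideal_mulA.
have [n [d [n0 d0 e]]] : exists n d, [/\ True, (0 < d)%N & g (pw n) = g (pw (n + d)%N)].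
  pose h (i : 'I_#|T|.+1) := g (pw i).
  have /injectivePn[i [j ij e]] : ~~ injectiveb h.
    by apply/negP => /injectiveP /leq_card; rewrite card_ord ltnn.
  case: (ltngtP i j) => [lt|lt|/val_inj eij].
  - by exists i, (j - i)%N; rewrite subn_gt0 subnKC // ltnW.
  - by exists j, (i - j)%N; rewrite subn_gt0 subnKC // ltnW.
  by rewrite eij eqxx in ij.
have [a a0 aE] := hg _ _ (fpw n) (fpw _) e.
(* The ratio satisfies I^n B = I^n. Stability of I^n under [B] puts [B] inside Z[zeta] by
   [stable_O]; writing the generators of I^n with coefficients in [B] puts 1 in [B]. Then a^-1
   I^(d-1) inverts I. *)
pose B := ideal_mul (ideal_gen zeta a^-1) (pw d).
have fB : frac_ideal zeta B by apply: frac_mul (fpw d); apply: frac_gen; rewrite invr_eq0.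
have JB : ideal_mul (pw n) B = pw n.
  rewrite /B ideal_mulA [ideal_mul (pw n) _]ideal_mulC -ideal_mulA -pwD aE.
  by rewrite ideal_mulA gen_gen mulVf // gen1 ideal_mul1 //; apply: Omod_frac.
have [[x0 Jx0 nx0] [s /= Js0]] := fpw n; have Js : pw n = span s := Js0.
pose v : 'rV[L]_(size s) := \row_i s`_i.
have v0 : v != 0.
  apply: contraNneq nx0 => v0; move: Jx0; rewrite Js => -[c [_ ->]].
  rewrite big1 // => i _; have := congr1 (fun w : 'rV_ _ => w 0 i) v0.
  by rewrite !mxE => ->; rewrite mulr0.
have Jmem (i : 'I_(size s)) : pw n s`_i by rewrite Js; apply: span_mem; rewrite mem_nth.
have [B0 BD BM] := Omod_frac fB.
have BO : B `<=` O.
  move=> x Bx.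
  have ex (i : 'I_(size s)) : exists c : 'I_(size s) -> L,
      (forall j, O (c j)) /\ x * s`_i = \sum_j c j * s`_j.
    have : pw n (x * s`_i) by rewrite -JB mulrC; apply: ideal_mul_mem.
    by rewrite Js.
  pose M : 'M[L]_(size s) := \matrix_(j, i) projT1 (cid (ex i)) j.
  apply: (@stable_O _ v M x v0).
    by move=> j i; rewrite mxE; case: (projT2 (cid (ex i))).
  apply/rowP => i; rewrite !mxE; case: (projT2 (cid (ex i))) => _ ->.
  by apply: eq_bigr => j _; rewrite !mxE mulrC.
have B1 : B 1.
  have ex (i : 'I_(size s)) : exists c : 'I_(size s) -> L,
      (forall j, B (c j)) /\ s`_i = \sum_j c j * s`_j.
    have : ideal_mul (pw n) B s`_i by rewrite JB.
    apply: (@ideal_mul_min (pw n) B [set y | exists c : 'I_(size s) -> L,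
      (forall j, B (c j)) /\ y = \sum_j c j * s`_j]).
    - by exists (fun=> 0); split => //; rewrite big1 // => j _; rewrite mul0r.
    - move=> _ _ [c [Bc ->]] [c' [Bc' ->]]; exists (fun j => c j + c' j); split.
        by move=> j; apply: BD.
      by rewrite -big_split; apply: eq_bigr => j _; rewrite mulrDl.
    move=> x b; rewrite Js => -[c [Oc ->]] Bb; exists (fun j => c j * b); split.
      by move=> j; apply: BM.
    by rewrite mulr_suml; apply: eq_bigr => j _; rewrite mulrAC.
  pose M : 'M[L]_(size s) := \matrix_(j, i) projT1 (cid (ex i)) j.
  apply: (@nakayama_mx _ v B M v0 BO B0 BD BM).
    by move=> j i; rewrite mxE; case: (projT2 (cid (ex i))).
  apply/rowP => i; rewrite !mxE; case: (projT2 (cid (ex i))) => _ ->.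
  by apply: eq_bigr => j _; rewrite !mxE mulrC.
have BE : B = O.
  by apply/seteqP; split => // x Ox; rewrite -[x]mulr1; apply: BM.
exists (ideal_mul (ideal_gen zeta a^-1) (pw d.-1)).
  by apply: frac_mul (fpw _); apply: frac_gen; rewrite invr_eq0.
rewrite -BE /B ideal_mulA [ideal_mul I _]ideal_mulC -ideal_mulA.
by rewrite -[ideal_mul I _]/(pw d.-1.+1) prednK.
Qed.

Lemma frac_invE I J : frac_ideal zeta J -> ideal_mul I J = O -> ideal_inv zeta I = J.
Proof.
move=> fJ IJ; apply/seteqP; split => [x hx|x Jx y Iy]; last first.
  by rewrite -IJ mulrC; apply: ideal_mul_mem.
have : ideal_mul I J 1 by rewrite IJ; apply: O1.
have [J0 JD JM] := Omod_frac fJ.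
rewrite -[x]mulr1; apply: (@ideal_mul_min I J [set y | J (x * y)]) 1.
- by rewrite /= mulr0.
- by move=> u w; rewrite /= mulrDr; apply: JD.
by move=> u w Iu Jw; rewrite /= mulrA; apply: JM Jw; apply: hx.
Qed.

Notation Fr := (frac_ideals zeta).

Lemma gal_inv_img (s : Delta) x : s ((s^-1)%g x) = x.
Proof. by rewrite -galM ?memvf // mulVg gal_id. Qed.

Lemma img_mul (s : Delta) (I J : set L) :
  [set s x | x in ideal_mul I J] = ideal_mul [set s x | x in I] [set s x | x in J].
Proof.
apply/seteqP; split.
  move=> _ [x [n [a [b [Ia Jb ->]]]] <-].
  exists n, (fun i => s (a i)), (fun i => s (b i)); split.
  - by move=> i; exists (a i).
  - by move=> i; exists (b i).
  by rewrite rmorph_sum; apply: eq_bigr => i _; rewrite rmorphM.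
apply: ideal_mul_min.
- by exists 0; [apply: ideal_mul0|apply: rmorph0].
- move=> _ _ [x hx <-] [y hy <-]; exists (x + y); last exact: rmorphD.
  exact: ideal_mulD.
move=> _ _ [x hx <-] [y hy <-]; exists (x * y); last exact: rmorphM.
exact: ideal_mul_mem.
Qed.

Lemma frac_img (s : Delta) I : frac_ideal zeta I -> frac_ideal zeta [set s x | x in I].
Proof.
move=> [[x Ix x0] [t It]]; split; first by exists (s x); [exists x|rewrite fmorph_eq0].
exists [seq s y | y <- t]; apply/seteqP; split.
  move=> _ [y + <-]; rewrite It; move: y.
  have [S0 SD SM] := Omod_span [seq s y | y <- t].
  apply: (@span_min t [set y | span [seq s y | y <- t] (s y)]).
    split=> /=; first by rewrite rmorph0.
      by move=> u v hu hv; rewrite rmorphD; apply: SD.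
    by move=> u v hu hv; rewrite rmorphM; apply: SM hv; apply: O_gal.
  by move=> y ty; apply: span_mem; apply: map_f.
have [I0 ID IM] : Omod I by rewrite It; apply: Omod_span.
apply: span_min.
  split; first by exists 0; [|apply: rmorph0].
    by move=> _ _ [u hu <-] [v hv <-]; exists (u + v); [apply: ID|apply: rmorphD].
  move=> u _ hu [v hv <-]; exists ((s^-1)%g u * v); first by apply: IM hv; apply: O_gal.
  by rewrite rmorphM /= gal_inv_img.
by move=> _ /mapP[y ty ->]; exists y => //; rewrite It; apply: span_mem.
Qed.

Lemma frac_laws : glaws Fr.
Proof.
split => /=.
- exact: frac_mul.
- exact: frac_O.
- by move=> I fI; have [J fJ IJ] := frac_invertible fI; rewrite (frac_invE fJ IJ).
- exact: frac_img.
- by move=> I J K _ _ _; apply: ideal_mulA.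
- by move=> I J _ _; apply: ideal_mulC.
- by move=> I /Omod_frac; apply: ideal_mul1.
- move=> I fI; have [J fJ IJ] := frac_invertible fI.
  by rewrite (frac_invE fJ IJ) ideal_mulC.
- by move=> s I J _ _; apply: img_mul.
- move=> s t I _; apply/seteqP; split => [_ [_ [x Ix <-] <-]|_ [x Ix <-]].
    by exists x => //; rewrite galM ?memvf.
  by exists (s x); [exists x|rewrite galM ?memvf].
move=> I _; apply/seteqP; split => [_ [x Ix <-]|x Ix]; first by rewrite gal_id.
by exists x; rewrite ?gal_id.
Qed.

Lemma Lstar_laws : glaws (Lstar L).
Proof.
split => /=.
- by move=> x y x0 y0; rewrite mulf_neq0.
- exact: oner_neq0.
- by move=> x x0; rewrite invr_eq0.
- by move=> s x x0; rewrite fmorph_eq0.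
- by move=> x y z _ _ _; apply: mulrA.
- by move=> x y _ _; apply: mulrC.
- by move=> x _; apply: mul1r.
- by move=> x x0; apply: mulVf.
- by move=> s x y _ _; apply: rmorphM.
- by move=> s t x _; rewrite galM ?memvf.
by move=> x _; apply: gal_id.
Qed.

Definition FrM := LGMod frac_laws.
Definition LstM := LGMod Lstar_laws.
Notation FI := (gdmod FrM).
Notation Lx := (gdmod LstM).

Definition fgen (a : Lx) : FI := Gelt (frac_gen (gelt_valP a) : gset FrM (ideal_gen zeta (gelt_val a))).

Lemma fgenD : {morph fgen : a b / a + b}.
Proof. by move=> a b; apply: gelt_val_inj; symmetry; apply: gen_gen. Qed.

Lemma fgenA (s : Delta) a : fgen (dact s a) = dact s (fgen a).
Proof.
apply: gelt_val_inj; apply/seteqP; split.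
  move=> _ [x Ox <-]; exists (gelt_val a * (s^-1)%g x).
    by exists ((s^-1)%g x) => //; apply: O_gal.
  by rewrite rmorphM /= gal_inv_img.
move=> _ [_ [x Ox <-] <-]; exists (s x); first exact: O_gal.
by rewrite rmorphM.
Qed.

(** If I^n is trivial, each a in I has a^n in Z[zeta], so a is integral and I is contained in
    Z[zeta]; the same applies to the inverse of I. *)
Lemma frac_tors (x : FI) n : (0 < n)%N -> x *+ n = 0 -> x = 0.
Proof.
move=> n0 xn.
have sub (y : FI) : y *+ n = 0 -> gelt_val y `<=` O.
  move=> yn a ya; apply: integral_O.
  have pw i : gelt_val (y *+ i) (a ^+ i).
    elim: i => [|i IH]; first exact: O1.
    by rewrite mulrS exprS; apply: (@ideal_mul_mem (gelt_val y) (gelt_val (y *+ i))).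
  have : O (a ^+ n) by have := pw n; rewrite yn.
  case/O_integral => q mq rq; exists (q \Po 'X^n).
    by rewrite monicE lead_coef_comp ?size_polyXn // (monicP mq) lead_coefXn expr1n mulr1.
  apply/rootP; rewrite map_comp_poly horner_comp map_polyXn hornerXn.
  exact/rootP.
apply: gelt_val_inj; apply/seteqP; split; first exact: sub.
move=> a Oa; have sx : gelt_val (- x) `<=` O by apply: sub; rewrite mulNrn xn oppr0.
have : gelt_val (x - x) a by rewrite subrr.
have [x0 xD xM] := Omod_frac (gelt_valP x).
apply: (@ideal_mul_min (gelt_val x) (gelt_val (- x)) (gelt_val x)) => //.
by move=> u v hu /sx hv; rewrite mulrC; apply: xM.
Qed.

(** * Ideals prime to p *)

Definition prime_p (x : FI) := prime_to_p p zeta (gelt_val x).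

Lemma ip_frac I : integral_prime_to_p p zeta I -> exists2 x : FI, True & I = gelt_val x.
Proof. by case=> fI _ _; exists (Gelt (fI : gset FrM I)). Qed.

Lemma prime_pP (x : FI) : prime_p x <-> exists b c : FI,
  [/\ integral_prime_to_p p zeta (gelt_val b), integral_prime_to_p p zeta (gelt_val c) & x = b - c].
Proof.
split=> [[B [C [hB hC e]]]|[b [c [hb hc ->]]]]; last first.
  by exists (gelt_val b), (gelt_val c); split.
have [b _ bE] := ip_frac hB; have [c _ cE] := ip_frac hC.
exists b, c; split; rewrite -?bE -?cE //.
by apply: gelt_val_inj; rewrite e bE cE.
Qed.

Lemma ipM (b c : FI) : integral_prime_to_p p zeta (gelt_val b) ->
  integral_prime_to_p p zeta (gelt_val c) -> integral_prime_to_p p zeta (gelt_val (b + c)).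
Proof.
move=> [fb bO [u [v [bu Ov e]]]] [fc cO [u' [v' [bu' Ov' e']]]]; split.
- exact: (gelt_valP (b + c)).
- rewrite -[X in _ `<=` X](ideal_mul1 OmodO); exact: ideal_mulS.
exists (u * u'), (u * v' + v); split.
- exact: (@ideal_mul_mem (gelt_val b) (gelt_val c)).
- by apply: OD Ov; apply: OM Ov'; apply: bO.
by rewrite mulrDr addrA mulrCA -mulrDr e' mulr1.
Qed.

Lemma ip0 : integral_prime_to_p p zeta (gelt_val (0 : FI)).
Proof.
split; [exact: frac_O|by []|exists 1, 0]; split; [exact: O1|exact: O0|].
by rewrite mulr0 addr0.
Qed.

Lemma prime_p_submod : gsubmodule (M := FrM) (prime_to_p p zeta).
Proof.
have key (I : set L) : prime_to_p p zeta I -> exists2 x : FI, prime_p x & I = gelt_val x.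
  move=> [B [C [hB hC e]]].
  have [b _ bE] := ip_frac hB; have [c _ cE] := ip_frac hC.
  have xI : I = gelt_val (b - c) by rewrite e bE cE.
  exists (b - c) => //; apply/prime_pP; exists b, c; split; by rewrite -?bE -?cE.
split; first split.
- by move=> I /key[x _ ->]; apply: gelt_valP.
- by apply/(@prime_pP 0); exists 0, 0; split; rewrite ?subrr //; apply: ip0.
- move=> I J /key[x hx ->] /key[y hy ->].
  have /prime_pP[b [c [hb hc ->]]] := hx; have /prime_pP[b' [c' [hb' hc' ->]]] := hy.
  apply/(@prime_pP (b - c + (b' - c'))); exists (b + b'), (c + c').
  by split; [exact: ipM|exact: ipM|rewrite opprD addrACA].
- move=> I /key[x hx ->]; have /prime_pP[b [c [hb hc ->]]] := hx.
  by apply/(@prime_pP (- (b - c))); exists c, b; rewrite opprB.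
move=> s I /key[x hx ->]; have /prime_pP[b [c [hb hc ->]]] := hx.
have ips (d : FI) : integral_prime_to_p p zeta (gelt_val d) ->
    integral_prime_to_p p zeta (gelt_val (dact s d)).
  move=> [fd dO [u [v [du Ov e]]]]; split; first exact: (gelt_valP (dact s d)).
    by move=> _ [y dy <-]; apply: O_gal; apply: dO.
  exists (s u), (s v); split; [by exists u|exact: O_gal|].
  by rewrite -(rmorph_nat s p) -rmorphM -rmorphD e rmorph1.
apply/(@prime_pP (dact s (b - c))); exists (dact s b), (dact s c).
by rewrite dactD dactN; split=> //; apply: ips.
Qed.

Lemma principal_submod : gsubmodule (M := FrM) (principal zeta).
Proof.
have key (I : set L) : principal zeta I -> exists a : Lx, I = gelt_val (fgen a).
  by move=> [a a0 ->]; exists (Gelt (a0 : gset LstM a)).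
have mem (a : Lx) : principal zeta (gelt_val (fgen a)).
  by exists (gelt_val a) => //; apply: (gelt_valP a).
have fgen0 : fgen 0 = 0 by apply: (addrI (fgen 0)); rewrite -fgenD !addr0.
split; first split.
- by move=> I /key[a ->]; apply: gelt_valP.
- by have := mem 0; rewrite fgen0.
- move=> I J /key[a ->] /key[b ->]; have := mem (a + b); rewrite fgenD; exact.
- move=> I /key[a ->]; have := mem (- a).
  by have -> : fgen (- a) = - fgen a by apply: (addrI (fgen a)); rewrite -fgenD !subrr.
by move=> s I /key[a ->]; have := mem (dact s a); rewrite fgenA.
Qed.

Lemma inv_p_nO : ~ O (p%:R^-1).
Proof.
have -> : (p%:R^-1 : L) = (p%:R^-1 : rat)%:A.
  by rewrite -in_algE fmorphV rmorph_nat.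
move/O_rat/intrP => [a e].
have p0 : (p%:R : rat) != 0 by rewrite pnatr_eq0 -lt0n prime_gt0.
have : p%:Z * a = 1.
  by apply: (@intr_inj rat); rewrite rmorphM /= -e mulfV.
move/(congr1 absz); rewrite abszM /= => /eqP; rewrite muln_eq1 => /andP[/eqP p1 _].
by move: p_gt1; rewrite p1.
Qed.

Lemma lam_ndvd1 z : O z -> lam * z <> 1.
Proof.
move=> Oz e; apply: inv_p_nO; have [u [Ou Ou'] ->] := p_lam.
have -> : (lam ^+ p.-1 * u)^-1 = z ^+ p.-1 * u^-1.
  rewrite invfM; congr (_ * _); rewrite -exprVn; congr (_ ^+ _).
  by apply: (mulfI lam_neq0); rewrite mulfV ?lam_neq0.
by apply: OM Ou'; apply: OX.
Qed.

Lemma p_lam_dvd : exists2 t, O t & p%:R = lam * t.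
Proof.
have [u [Ou _] ->] := p_lam; exists (lam ^+ p.-2 * u).
  by apply: OM Ou; apply: OX O_lam.
by rewrite mulrA -exprS prednK ?p1_gt0.
Qed.

Lemma O_res_nat x : O x -> (forall z, O z -> x <> lam * z) ->
  exists c : nat, coprime c p /\ exists2 z, O z & x = c%:R + lam * z.
Proof.
move=> /O_res[c [z Oz ->]] nd; have [t Ot pt] := p_lam_dvd.
have p0 : p%:Z != 0 by rewrite -lt0n prime_gt0.
exists `|(c %% p)%Z|%N.
have cE : (`|(c %% p)%Z|%N)%:R = ((c %% p)%Z)%:~R :> L.
  by rewrite pmulrn gez0_abs // modz_ge0.
split; last first.
  exists (z + t * ((c %/ p)%Z)%:~R); first by apply: OD Oz _; apply: OM Ot (O_int _).
  rewrite cE {1}(divz_eq c p) rmorphD rmorphM /= -[(p%:Z)%:~R]/(p%:R) pt.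
  by ring.
rewrite coprime_sym prime_coprime //; apply/negP => pc.
have : (p%:Z %| c)%Z.
  by rewrite (divz_eq c p); apply: rpredD => //; apply: dvdz_mull.
case/dvdzP => d dE; apply: (nd (t * d%:~R + z)).
  by apply: OD Oz; apply: OM Ot (O_int _).
by rewrite dE intrM -[(p%:Z)%:~R]/(p%:R) pt; ring.
Qed.

(** Fermat's little theorem for the residue [c], as p is divisible by [lam]. *)
Lemma O_res_pow x : O x -> (forall z, O z -> x <> lam * z) ->
  exists2 w, O w & x ^+ p.-1 = 1 + lam * w.
Proof.
move=> Ox nd; have [c [co [z Oz xE]]] := O_res_nat Ox nd.
have [t Ot pt] := p_lam_dvd.
have pw i : exists2 w, O w & x ^+ i = c%:R ^+ i + lam * w.
  elim: i => [|i [w Ow e]].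
    by exists 0; [apply: O0|rewrite !expr0 mulr0 addr0].
  exists (z * x ^+ i + c%:R * w).
    by apply: OD; apply: OM => //; [apply: OX|apply: O_nat].
  have -> : x ^+ i.+1 = (c%:R + lam * z) * x ^+ i by rewrite -xE exprS.
  by rewrite mulrDl {1}e exprS; ring.
have [w Ow ->] := pw p.-1.
have c0 : (0 < c)%N.
  by rewrite lt0n; apply: contraTneq co => ->; rewrite /coprime gcd0n gtn_eqF.
have /dvdnP[d dE] : (p %| c ^ p.-1 - 1)%N.
  rewrite -(@Gauss_dvdr _ c) 1?coprime_sym // mulnBr muln1 -expnS prednK ?prime_gt0 //.
  rewrite -eqn_mod_dvd; first by apply/eqP/fermat_little.
  by have := @leq_pexp2l c 1 p c0 (prime_gt0 p_pr); rewrite expn1.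
have cE : c%:R ^+ p.-1 = 1 + p%:R * d%:R :> L.
  by rewrite -natrX -natrM mulnC -dE natrB ?expn_gt0 ?c0 // addrC subrK.
exists (t * d%:R + w); first by apply: OD Ow; apply: OM Ot (O_nat _).
by rewrite cE pt mulrDr -!mulrA addrA.
Qed.

(** An element a of I^-1 outside lam I^-1 makes a I integral but not contained in lam Z[zeta], and
    this suffices for a I to be prime to p. Such an a exists because I I^-1 contains 1. *)
Lemma class_prime (x : FI) : exists a : Lx, prime_p (x + fgen a).
Proof.
pose y : FI := - x.
have xy : ideal_mul (gelt_val x) (gelt_val y) = O.
  by rewrite -[LHS]/(gelt_val (x + y)) subrr.
have [y0 yD yM] := Omod_frac (gelt_valP y : frac_ideal zeta (gelt_val y)).
have [x0 xD xM] := Omod_frac (gelt_valP x : frac_ideal zeta (gelt_val x)).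
have [a ya nla] : exists2 a, gelt_val y a & forall z, gelt_val y z -> a <> lam * z.
  apply: contrapT => h.
  have ly a : gelt_val y a -> exists2 z, gelt_val y z & a = lam * z.
    move=> ya; apply: contrapT => h'; apply: h; exists a => // z yz e.
    by apply: h'; exists z.
  have : ideal_mul (gelt_val x) (gelt_val y) 1 by rewrite xy; apply: O1.
  case/(@ideal_mul_min _ _ [set b | exists2 z, O z & b = lam * z]).
  - by exists 0; [apply: O0|rewrite mulr0].
  - by move=> _ _ [u Ou ->] [v Ov ->]; exists (u + v); [apply: OD|rewrite mulrDr].
  - move=> u v hu /ly[z yz ->]; exists (u * z); last by rewrite mulrCA.
    by rewrite -xy; apply: ideal_mul_mem.
  by move=> z Oz /esym; apply: lam_ndvd1.
have a0 : a != 0.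
  by apply/eqP => a0; apply: (nla 0 y0); rewrite mulr0.
pose A : Lx := Gelt (a0 : gset LstM a); exists A.
have JE : gelt_val (x + fgen A) = [set a * z | z in gelt_val x].
  rewrite -gen_mul; last by split.
  by rewrite addrC.
have JO : gelt_val (x + fgen A) `<=` O.
  rewrite JE => _ [z xz <-]; rewrite -xy mulrC; exact: ideal_mul_mem.
have [j Jj nlj] : exists2 j, gelt_val (x + fgen A) j & forall z, O z -> j <> lam * z.
  apply: contrapT => h.
  have : ideal_mul (gelt_val x) (gelt_val y) 1 by rewrite xy; apply: O1.
  have lz z : gelt_val x z -> exists2 t, O t & a * z = lam * t.
    move=> xz; apply: contrapT => h'; apply: h; exists (a * z); first by rewrite JE; exists z.
    by move=> t Ot e; apply: h'; exists t.
  case/(@ideal_mul_min _ _ [set b | exists2 t, gelt_val y t & a * b = lam * t]).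
  - by exists 0; rewrite ?mulr0.
  - by move=> u v [t yt et] [t' yt' et']; exists (t + t'); [apply: yD|rewrite !mulrDr et et'].
  - move=> u v /lz[t Ot et] yv; exists (t * v); first exact: yM.
    by rewrite !mulrA et.
  by move=> t yt; rewrite mulr1; apply: nla.
have [J0 JD JM] := Omod_frac (gelt_valP (x + fgen A) : frac_ideal zeta (gelt_val (x + fgen A))).
have [w Ow jE] := O_res_pow (JO j Jj) nlj.
pose b0 := j ^+ p.-1.
have Jb0 : gelt_val (x + fgen A) b0.
  by rewrite /b0 -(prednK p1_gt0) exprSr; exact: JM (OX _ (JO _ Jj)) Jj.
have [u [Ou Ou'] pu] := p_lam.
have u0 : u != 0 by apply: contraNneq p_neq0 => u0; rewrite pu u0 mulr0.
have Ob0 : O b0 := JO _ Jb0.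
apply/prime_pP; exists (x + fgen A), 0; split; [|exact: ip0|by rewrite subr0].
split; [exact: (gelt_valP (x + fgen A))|exact: JO|].
(* As 1 - b0 is divisible by [lam], its (p - 1)-st power is divisible by p; the geometric sum writes
   1 - (1 - b0)^(p-1) as a multiple of b0, hence as an element of the ideal. *)
exists (b0 * \sum_(i < p.-1) (1 - b0) ^+ i), (u^-1 * (- w) ^+ p.-1); split.
- rewrite mulrC; apply: JM Jb0; apply: O_sum => i _; apply: OX; exact: OB O1 Ob0.
- by apply: OM Ou' _; apply: OX; apply: ON.
have e1 : 1 - b0 = lam * - w by rewrite /b0 jE opprD addNKr mulrN.
have e2 : b0 * \sum_(i < p.-1) (1 - b0) ^+ i = 1 - (1 - b0) ^+ p.-1.
  have := subrX1 (1 - b0) p.-1; rewrite [1 - b0 - 1]addrAC subrr sub0r mulNr => h.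
  by rewrite -[RHS]opprB h opprK.
by rewrite e2 e1 exprMn pu mulrA mulfK // subrK.
Qed.

(** * Localization at p *)

Section Local.
Hypothesis p_gt2 : (2 < p)%N.
Variables (K : fieldExtType {fraction (padic p_pr)}) (iota : {rmorphism L -> K}).

(** The integer N is invertible in Z_p, so w / N becomes a polynomial in zeta with p-adic integral
    coefficients. *)
Lemma local_unitsP (w : L) (N : int) : O w -> coprimez N p ->
  local_units zeta iota (iota (1 + lam ^+ 2 * w / N%:~R)).
Proof.
move=> [q ->] co.
exists (iota ((map_poly intr q).[zeta] / N%:~R)); last first.
  rewrite -mulrA rmorphD rmorph1 rmorphM; congr (_ + _ * _).
  by rewrite rmorphXn rmorphB rmorph1 -sqrrN opprB.
pose h : {rmorphism padic p_pr -> K} := in_alg K \o @tofrac (padic p_pr).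
have uN : (N%:~R : padic p_pr) \is a GRing.unit by apply: padic_unit_int.
exists ((N%:~R)^-1 *: map_poly intr q).
have -> : map_poly (fun c => (tofrac c)%:A) ((N%:~R)^-1 *: map_poly intr q) =
    map_poly h ((N%:~R)^-1 *: map_poly intr q :> {poly padic p_pr}) by [].
rewrite linearZ /= hornerZ mulrC rmorphM; congr (_ * _).
  have hN : h (N%:~R) * h (N%:~R)^-1 = 1 by rewrite -rmorphM mulrV // rmorph1.
  rewrite fmorphV rmorph_int -[RHS]/(h (N%:~R)^-1).
  rewrite rmorph_int in hN.
  by rewrite -[RHS]mul1r -[1 in RHS](mulVf (x := N%:~R)) ?hN -?mulrA ?hN ?mulr1 //; apply: contraPneq hN => ->; rewrite mul0r => /esym/eqP; rewrite oner_eq0.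
rewrite -horner_map -!map_poly_comp; congr (_.[_]); apply: eq_map_poly => c /=.
by rewrite rmorph_int -[LHS](rmorph_int h).
Qed.

Definition congr2 (x y : L) := exists2 w, O w & x = y + lam ^+ 2 * w.

Lemma congr2_refl x : congr2 x x.
Proof. by exists 0; [apply: O0|rewrite mulr0 addr0]. Qed.

Lemma congr2_trans y x z : congr2 x y -> congr2 y z -> congr2 x z.
Proof.
by move=> [w Ow ->] [v Ov ->]; exists (v + w); [apply: OD|rewrite mulrDr addrA].
Qed.

Lemma congr2M x y x' y' : O x -> O y' -> congr2 x y -> congr2 x' y' ->
  congr2 (x * x') (y * y').
Proof.
move=> Ox Oy' [w Ow xE] [v Ov ->]; exists (w * y' + x * v).
  by apply: OD; apply: OM.
by rewrite [in LHS]mulrDr {1}xE; ring.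
Qed.

Lemma congr2_p x : O x -> congr2 (p%:R * x) 0.
Proof.
move=> Ox; have [u [Ou _] pu] := p_lam.
exists (lam ^+ (p.-1 - 2) * u * x); first by apply: OM Ox; apply: OM Ou; apply: OX O_lam.
(* This is where p > 2 enters: lam^(p-1) contains the factor lam^2. *)
have p2 : (2 <= p.-1)%N by rewrite -ltnS prednK // prime_gt0.
by rewrite add0r !mulrA -exprD subnKC // -pu.
Qed.

(** Powers of zeta = 1 - lam reach every class 1 + c lam modulo lam^2; they are the units that
    correct a generator in [principal_local]. *)
Lemma zeta_congr2 j : congr2 (zeta ^+ j) (1 - j%:R * lam).
Proof.
elim: j => [|j IH]; first by rewrite mul0r subr0; apply: congr2_refl.
rewrite exprSr; apply: (congr2_trans (y := (1 - j%:R * lam) * (1 - lam))).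
  apply: congr2M IH _; [exact: OX O_zeta|exact: OB O1 O_lam|].
  by rewrite /lam opprB addrC subrK; apply: congr2_refl.
by exists j%:R; [apply: O_nat|rewrite -natr1; ring].
Qed.

Lemma one_sub_pX c i : O c -> exists2 t, O t & (1 - p%:R * c) ^+ i = 1 + p%:R * t.
Proof.
move=> Oc; elim: i => [|i [t Ot e]].
  by exists 0; [apply: O0|rewrite mulr0 addr0].
exists (t - c - p%:R * c * t); last by rewrite exprS e; ring.
by apply: OB; [apply: OB|do 2!apply: OM => //; apply: O_nat].
Qed.

(** All conjugates of the element are 1 modulo p, so its norm N is too; the product of the other
    conjugates is N times the inverse. *)
Lemma O_inv_mod_p t : O t -> 1 + p%:R * t != 0 ->
  exists (N : int) v, [/\ O v, coprimez N p & (1 + p%:R * t)^-1 = v / N%:~R].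
Proof.
move=> Ot s0; set s := 1 + _ in s0 *.
have Os : O s by apply: OD O1 _; apply: OM (O_nat _) Ot.
have /intrP[N NE] := qnorm_int Os.
have nE : nrm s = N%:~R by rewrite nrm_rat -/(qnorm s) NE scaler_int.
have [t2 Ot2 e2] : exists2 t2, O t2 & nrm s = 1 + p%:R * t2.
  rewrite /nrm; elim/big_ind: _ => [|x y [u Ou ->] [v Ov ->]|d _].
  - by exists 0; [apply: O0|rewrite mulr0 addr0].
  - exists (u + v + p%:R * u * v); last by ring.
    by apply: OD; [apply: OD|do 2!apply: OM => //; apply: O_nat].
  exists (d t); first exact: O_gal.
  by rewrite /s rmorphD rmorph1 rmorphM rmorph_nat.
have /dvdzP[k kE] : (p%:Z %| N - 1)%Z.
  have p0 : (p%:R : rat) != 0 by rewrite pnatr_eq0 -lt0n prime_gt0.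
  have /O_rat/intrP[k kE] : O ((N - 1)%:~R / p%:R : rat)%:A.
    have -> : ((N - 1)%:~R / p%:R : rat)%:A = t2.
      rewrite -in_algE rmorphM fmorphV rmorph_int rmorph_nat rmorphB rmorph1 /= -nE e2.
      by rewrite addrAC subrr add0r mulrAC mulfV ?mul1r // p_neq0.
    exact: Ot2.
  apply/dvdzP; exists k; apply: (@intr_inj rat).
  by rewrite rmorphM /= -kE mulfVK.
exists N, (\prod_(d : Delta | d != 1%g) d s); split.
- by apply: O_prod => d _; apply: O_gal.
- rewrite -[N](subrK 1) kE coprimez_sym /coprimez gcdzMDl.
  by rewrite gcdz1.
have sv : N%:~R = s * \prod_(d : Delta | d != 1%g) d s.
  by rewrite -nE /nrm (bigD1 1%g) //= gal_id.
have N0 : N%:~R != 0 :> L by rewrite -nE nrm_neq0.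
by apply: (mulIf N0); rewrite mulfVK // sv mulKf.
Qed.

(** The new generator is zeta^j a^(p-1), with j chosen to reach precision lam^2. Since [a] may be
    fractional, it is first multiplied by an element d0 of the denominator ideal that is 1 modulo
    p. *)
Lemma principal_local (a : Lx) : prime_p (fgen a) -> exists2 c : Lx,
  fgen c = fgen a *+ p.-1 & local_units zeta iota (iota (gelt_val c)).
Proof.
move=> /prime_pP[b [d [[fb bO [b0 [b1 [Bb0 Ob1 eb]]]] [fd dO [d0 [d1 [Dd0 Od1 ed]]]] e]]].
have bE : gelt_val b = [set gelt_val a * x | x in gelt_val d].
  rewrite -gen_mul; last exact: Omod_frac fd.
  by rewrite -[RHS]/(gelt_val (fgen a + d)) e subrK.
pose av : L := gelt_val a; have a0 : av != 0 := gelt_valP a.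
have Ox : O (av * d0) by apply: bO; rewrite bE; exists d0.
have [c1 Dc1 c1E] : exists2 c1, gelt_val d c1 & av * c1 = b0.
  by move: Bb0; rewrite bE => -[c1 h <-]; exists c1.
have d0E : d0 = 1 - p%:R * d1 by apply: (addIr (p%:R * d1)); rewrite ed subrK.
have b0E : b0 = 1 - p%:R * b1 by apply: (addIr (p%:R * b1)); rewrite eb subrK.
(* Otherwise, multiplying by c1 would make b0 d0, which is 1 modulo p, divisible by [lam]. *)
have nd z : O z -> av * d0 <> lam * z.
  move=> Oz xz; have [t Ot pt] := p_lam_dvd.
  apply: (@lam_ndvd1 (z * c1 + t * (b1 + d1 - p%:R * b1 * d1))).
    apply: OD; first by apply: OM Oz (dO _ Dc1).
    apply: OM Ot _; apply: OB; first exact: OD.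
    by do 2!apply: OM => //; apply: O_nat.
  have h : lam * z * c1 = b0 * d0 by rewrite -xz -c1E mulrAC.
  rewrite mulrDr [lam * (z * c1)]mulrA h [lam * (t * _)]mulrA -pt b0E d0E.
  by ring.
have [w Ow wE] := O_res_pow Ox nd.
have [e0 [w2 Ow2 w2E]] := O_res Ow.
(* The residue of [w] modulo [lam]: then zeta^j cancels the linear term, since (1 - j lam)(1 + j
   lam) is 1 modulo lam^2. *)
pose j := `|(e0 %% p)%Z|%N.
have p0 : p%:Z != 0 by rewrite -lt0n prime_gt0.
have e0E : e0%:~R = p%:R * ((e0 %/ p)%Z)%:~R + j%:R :> L.
  rewrite {1}(divz_eq e0 p) rmorphD rmorphM /= mulrC; congr (_ + _).
  by rewrite /j pmulrn gez0_abs // modz_ge0.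
have c2x : congr2 ((av * d0) ^+ p.-1) (1 + j%:R * lam).
  have [t Ot pt] := p_lam_dvd.
  exists (w2 + t * ((e0 %/ p)%Z)%:~R); first by apply: OD Ow2 _; apply: OM Ot (O_int _).
  by rewrite wE w2E e0E pt; ring.
have c2y : congr2 (zeta ^+ j * (av * d0) ^+ p.-1) 1.
  apply: (congr2_trans (y := (1 - j%:R * lam) * (1 + j%:R * lam))).
    apply: congr2M c2x; [exact: OX O_zeta| |exact: zeta_congr2].
    by apply: OD O1 _; apply: OM O_lam; apply: O_nat.
  exists (- (j%:R ^+ 2)); last by ring.
  by apply: ON; apply: OX; apply: O_nat.
have [t Ot tE] := one_sub_pX p.-1 Od1; rewrite -d0E in tE.
have [r Or rE] := congr2_p Ot.
have d0n : d0 != 0.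
  apply/eqP => d00; apply: inv_p_nO.
  have -> : p%:R^-1 = d1; last exact: Od1.
  by apply: (mulfI p_neq0); rewrite mulfV ?p_neq0 //; move: ed; rewrite d00 add0r.
have s0 : 1 + p%:R * t != 0 by rewrite -tE expf_neq0.
have [N [v [Ov co iE]]] := O_inv_mod_p Ot s0.
have [y Oy yE] := c2y.
have z0 : zeta != 0.
  by apply: contra_eq_neq zetap => ->; rewrite expr0n gtn_eqF ?prime_gt0 // eq_sym oner_eq0.
have c0 : zeta ^+ j * av ^+ p.-1 != 0 by rewrite mulf_neq0 ?expf_neq0.
exists (Gelt (c0 : gset LstM _) : Lx).
  pose Z : Lx := Gelt (expf_neq0 j z0 : gset LstM _).
  have -> : (Gelt (c0 : gset LstM _) : Lx) = Z + a *+ p.-1.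
    apply: gelt_val_inj; rewrite -[RHS]/(zeta ^+ j * gelt_val (a *+ p.-1)).
    rewrite /=; congr (_ * _); elim: p.-1 => [|i IH] //.
    by rewrite exprS mulrS IH.
  rewrite fgenD (_ : fgen Z = 0) ?add0r; last first.
    apply: gelt_val_inj; apply/seteqP; split.
      by move=> _ [u Ou <-]; apply: OM Ou; apply: OX O_zeta.
    move=> u Ou; exists (zeta ^+ (p.-1 * j) * u); first by apply: OM Ou; apply: OX O_zeta.
    rewrite /= mulrA -exprD -mulSn prednK ?prime_gt0 // exprM zetap expr1n.
    by rewrite mul1r.
  elim: p.-1 => [|i IH]; last by rewrite !mulrS fgenD IH.
  by apply: (addrI (fgen 0)); rewrite -fgenD !addr0.
(* It remains to divide by d0^(p-1) = 1 + p t; as p t = lam^2 r, the quotient is still 1 modulo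
   lam^2, with a denominator prime to p. *)
have -> : gelt_val (Gelt (c0 : gset LstM _)) = 1 + lam ^+ 2 * ((y - r) * v) / N%:~R.
  rewrite /= !mulrA -[_ * v / _]mulrA -iE; apply: (mulIf s0).
  rewrite mulrDl mulfVK // mul1r -{1}tE -mulrA -exprMn yE.
  by rewrite rE; ring.
apply: local_unitsP co; apply: OM Ov; exact: OB.
Qed.

(** * The homomorphisms of calW *)

Section Modules.

Notation E := (gdmod (lsub prime_p_submod)).
Notation C := (gdmod (lquo principal_submod)).

Definition cl (x : E) : C := qcl principal_submod (gincl x).

Lemma clD : {morph cl : x y / x + y}.
Proof.
by move=> x y; apply: etrans (congr1 _ (ginclD _ _)) (qclD _ _ _).
Qed.

Lemma clA d x : cl (dact d x) = dact d (cl x).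
Proof. exact: etrans (congr1 _ (ginclA _ _)) (qclA _ _ _). Qed.

Lemma inN_principal (x : FI) : inN (M := FrM) (principal zeta) x <-> exists a, x = fgen a.
Proof.
split=> [[a a0 e]|[a ->]].
  by exists (Gelt (a0 : gset LstM a)); apply: gelt_val_inj.
by exists (gelt_val a) => //; apply: (gelt_valP a).
Qed.

Lemma cl0P (x : E) : cl x = 0 <-> exists a, gincl x = fgen a.
Proof. by rewrite -inN_principal; apply: qcl_eq0. Qed.

Lemma cl_surj (y : C) : exists x, cl x = y.
Proof.
have [x <-] := qcl_surj y; have [a ha] := class_prime x.
exists (Gelt (ha : gset (lsub prime_p_submod) (gelt_val (x + fgen a)))).
rewrite /cl; apply/qcl_eq/inN_principal; exists a.
have -> : gincl (Gelt (ha : gset (lsub prime_p_submod) (gelt_val (x + fgen a)))) = x + fgen a.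
  exact: gelt_val_inj.
by rewrite addrC addrA addNr add0r.
Qed.

Lemma class_seq : exists2 s : seq C, uniq s & forall y, y \in s.
Proof.
have [T [g hg]] := class_code.
have ex (t : T) : exists y : C, forall x : FI, g (gelt_val x) = t -> y = qcl principal_submod x.
  case: (pselect (exists x : FI, g (gelt_val x) = t)) => [[x xt]|h]; last first.
    by exists 0 => x xt; case: h; exists x.
  exists (qcl principal_submod x) => y yt; apply/qcl_eq/inN_principal.
  have [a a0 e] := hg _ _ (gelt_valP y) (gelt_valP x) (etrans yt (esym xt)).
  exists (Gelt (a0 : gset LstM a)).
  have -> : x = fgen (Gelt (a0 : gset LstM a)) + y by apply: gelt_val_inj.
  by rewrite addrK.
pose h t := projT1 (cid (ex t)).
have hP (t : T) (x : FI) : g (gelt_val x) = t -> h t = qcl principal_submod x := projT2 (cid (ex t)) x.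
exists (undup [seq h t | t <- enum T]); first exact: undup_uniq.
move=> y; rewrite mem_undup; apply/mapP; have [x <-] := qcl_surj y.
by exists (g (gelt_val x)); rewrite ?mem_enum // (hP _ x erefl).
Qed.

Definition clval (y : C) : Cl zeta := gelt_val y.

Lemma clval_inj : injective clval. Proof. exact: gelt_val_inj. Qed.

Lemma cardinal_class (S : set (Cl zeta)) (s : seq C) : uniq s ->
  (forall y, y \in s <-> S (clval y)) -> S `<=` gset (Cl zeta) ->
  cardinal S = size s.
Proof.
move=> us sS SC; rewrite -(@cardinal_image _ _ s _ us clval_inj).
congr cardinal; apply/seteqP; split => [X SX|_ [y /= /sS ? <-] //].
by exists (Gelt (SC _ SX : gset (lquo principal_submod) X)) => //=; apply/sS.
Qed.

(** Lagrange for A and for the quotient by A: p^s kills A, and the index n, prime to p, maps every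
    class into A. By Bezout A is then exactly the p^s-torsion. *)
Lemma sylow_class (A : set (Cl zeta)) : gsylow p A -> exists s n : nat,
  [/\ cardinal A = (p ^ s)%N, (cardinal (gset (Cl zeta)) %/ cardinal A)%N = n,
      coprime n p, forall y : C, y *+ (n * p ^ s) = 0 &
      forall y : C, A (clval y) <-> y *+ (p ^ s) = 0].
Proof.
move=> [[AC A1 AM AV] cA]; have [t ut tT] := class_seq.
have ct : cardinal (gset (Cl zeta)) = size t.
  by apply: cardinal_class => // y; split => // _; apply: (gelt_valP y).
pose tA := [seq y <- t | `[< A (clval y) >]].
have utA : uniq tA by apply: filter_uniq.
have tAE y : y \in tA <-> A (clval y).
  by rewrite mem_filter tT andbT; split=> [/asboolP|h]; [|apply/asboolP].
have ctA : cardinal A = size tA by apply: cardinal_class.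
have t_gt0 : (0 < size t)%N by case: (t) (tT 0).
have [n co nE] := pfactor_coprime p_pr t_gt0.
set s := logn p (size t) in nE; rewrite ct -/s in cA.
have sz : size t = (n * size tA)%N by rewrite -ctA cA.
have t0 : 0 \in tA by apply/tAE.
have tB : {in tA &, forall a b, a - b \in tA}.
  move=> a b /tAE ha /tAE hb; apply/tAE.
  by apply: (AM (clval a) (clval (- b)) ha); apply: (AV (clval b)).
have killA (y : C) : A (clval y) -> y *+ (p ^ s) = 0.
  move=> hy; rewrite -cA ctA; apply: mulrn_size => // x /tAE hx; apply/tAE.
  exact: (AM (clval y) (clval x)).
have nA (y : C) : A (clval (y *+ n)).
  by apply/tAE; apply: mulrn_index ut utA tT t0 tB sz.
exists s, n; split => //.
- by rewrite ct cA nE mulnK // expn_gt0 prime_gt0.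
- by rewrite coprime_sym.
- by move=> y; rewrite mulrnA; apply: killA.
move=> y; split=> [|ys]; first exact: killA.
have [u [v /= euv]] := Bezoutz n (p ^ s)%N.
have yE : y = y *+ n *~ u.
  have g1 : gcdz n (p ^ s)%N = 1 by apply/eqP; rewrite eqz_nat; apply: coprimeXr; rewrite coprime_sym.
  rewrite -[LHS]mulr1z -g1 -euv mulrzDr [u * _]mulrC [v * _]mulrC !mulrzA -!pmulrn ys.
  by rewrite mul0rz addr0.
have tAD a b : a \in tA -> b \in tA -> a + b \in tA.
  by move=> ha hb; rewrite -[b]opprK; apply: (tB) => //; rewrite -sub0r; apply: (tB).
have tAMn a i : a \in tA -> a *+ i \in tA.
  by move=> ha; elim: i => [|i IH] //; rewrite mulrS; apply: tAD.
rewrite yE; apply/tAE; have /tAE h := nA y.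
case: (u) => i; first exact: tAMn.
by rewrite NegzE mulrNz -sub0r; apply: tB => //; apply: tAMn.
Qed.

Lemma calW_lift g : calW zeta iota g -> exists2 gE : E -> Lx,
  {morph gE : x y / x + y} /\ (forall d x, gE (dact d x) = dact d (gE x)) &
  forall x, gelt_val (gE x) = g (gelt_val x).
Proof.
move=> [[gnz gM] gA _ _].
have nz (x : E) : gset LstM (g (gelt_val x)) := gnz _ (gelt_valP x).
exists (fun x => Gelt (nz x)) => //; split=> [x y|d x]; apply: gelt_val_inj.
  exact: (gM _ _ (gelt_valP x) (gelt_valP y)).
exact: (gA d _ (gelt_valP x)).
Qed.

Lemma fgenMn a i : fgen (a *+ i) = fgen a *+ i.
Proof. exact: (morph_Mn fgenD). Qed.

Lemma ginclMn (x : E) i : gincl (x *+ i) = gincl x *+ i.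
Proof. exact: (morph_Mn (@ginclD _ FrM _ prime_p_submod)). Qed.

Lemma clMn x i : cl (x *+ i) = cl x *+ i.
Proof. exact: (morph_Mn clD). Qed.

Lemma beta_principal g (gE : E -> Lx) b : (forall x, gelt_val (gE x) = g (gelt_val x)) ->
  has_beta zeta iota g b -> forall x c, gincl x = fgen c ->
  local_units zeta iota (iota (gelt_val c)) -> gE x = dpow c b.
Proof.
move=> gEE hb x c xc cU; apply: gelt_val_inj; rewrite gEE -gelt_val_pow.
rewrite -[RHS](hb _ (gelt_valP c) cU); congr (g _).
by rewrite -[RHS]/(gelt_val (fgen c)) -xc.
Qed.

Lemma principal_local_E (x : E) : cl x = 0 -> exists2 c, gincl (x *+ p.-1) = fgen c &
  local_units zeta iota (iota (gelt_val c)).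
Proof.
case/cl0P => a xa.
have pa : prime_p (fgen a) by rewrite -xa; apply: (gelt_valP x).
have [c cE cU] := principal_local pa; exists c => //.
by rewrite cE ginclMn xa.
Qed.

Lemma ideal_beta g (gE : E -> Lx) b h : (0 < h)%N -> (forall y : C, y *+ h = 0) ->
  {morph gE : x y / x + y} -> (forall x, gelt_val (gE x) = g (gelt_val x)) ->
  has_beta zeta iota g b -> forall x, fgen (gE x) = dpow (gincl x) b.
Proof.
move=> h0 hC gD gEE hb x; apply/eqP; rewrite -subr_eq0; apply/eqP.
have cx : cl (x *+ h) = 0 by rewrite clMn.
have [c cE cU] := principal_local_E cx.
have e := beta_principal gEE hb cE cU.
apply: (@frac_tors _ (h * p.-1)); first by rewrite muln_gt0 h0 p1_gt0.
rewrite mulrnBl -fgenMn mulrnA -!(morph_Mn gD) e (dpow_morph fgenD fgenA) -cE.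
by rewrite !ginclMn !dpowMnl mulrnA subrr.
Qed.

Lemma beta_kill g (gE : E -> Lx) b h : (0 < h)%N -> (forall y : C, y *+ h = 0) ->
  {morph gE : x y / x + y} -> (forall x, gelt_val (gE x) = g (gelt_val x)) ->
  has_beta zeta iota g b -> forall y : C, dpow y b = 0.
Proof.
move=> h0 hC gD gEE hb y; have [x <-] := cl_surj y.
rewrite /cl -(dpow_morph (qclD principal_submod) (qclA principal_submod)).
apply/qcl_eq0/inN_principal; exists (gE x).
by rewrite (ideal_beta h0 hC gD gEE hb).
Qed.

Lemma gelt_valX (x : Lx) i : gelt_val (x *+ i) = gelt_val x ^+ i.
Proof. by elim: i => [|i IH] //; rewrite mulrS exprS -IH. Qed.

Section TorsionPsi.
Variables (psi : Delta -> padic p_pr).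
Hypotheses (psi_char : padic_char psi)
  (psi_neq_omega : forall omega : Delta -> padic p_pr,
     teichmuller zeta omega -> psi <> omega).

(* As psi is not the Teichmueller character, psi^-1 omega is a nontrivial
   character modulo p and its values add up to 0 modulo p. *)
Lemma Lx_tors (x : Lx) t N b : (0 < N)%N -> gring_congr N b (idem psi) ->
  x *+ (p ^ t) = 0 -> dpow x b = 0.
Proof.
move=> N0 hb xt.
have z0 : zeta != 0.
  by apply: contra_eq_neq zetap => ->; rewrite expr0n gtn_eqF ?prime_gt0 // eq_sym oner_eq0.
pose Z : Lx := Gelt (z0 : gset LstM zeta).
have [i xE] : exists i, gelt_val x = zeta ^+ i.
  by apply: (@gal_roots_tors _ t); rewrite -gelt_valX xt.
have -> : x = Z *+ i by apply: gelt_val_inj; rewrite xE gelt_valX.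
rewrite dpowMnl; suff -> : dpow Z b = 0 by rewrite mul0rn.
have ex (d : Delta) : exists a : nat, coprime a p /\ d zeta = zeta ^+ a.
  by have [a co e] := gal_zeta d; exists a.
pose a d := projT1 (cid (ex d)).
have aP d : coprime (a d) p /\ d zeta = zeta ^+ a d := projT2 (cid (ex d)).
have Zp0 : Z *+ p = 0 by apply: gelt_val_inj; rewrite gelt_valX.
have aM d e : (a (d * e)%g = a d * a e %[mod p])%N.
  apply/eqP; rewrite -(eq_prim_root_expr zeta_prim) -(aP (d * e)%g).2 galM ?memvf //.
  by rewrite (aP d).2 rmorphXn /= (aP e).2 -exprM mulnC.
have actZ d : dact d Z = Z *+ a d.
  by apply: gelt_val_inj; rewrite gelt_valX -(aP d).2.
have natc (u v : nat) : (u = v %[mod p])%N -> @zp_congr p p_pr 1 u%:R v%:R.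
  by move=> h; apply/(@zp_congr_int p p_pr 1 u%:Z v%:Z); rewrite expn1 !modz_nat h.
(* If psi(d) were congruent to [a d] modulo p for every d, psi would itself satisfy
   [teichmuller]. *)
have [d0 nd0] : exists d0, ~ zp_congr 1 (psi d0) (a d0)%:R.
  apply: contrapT => h; apply: (psi_neq_omega (omega := psi)) => //.
  split=> // c co; apply: (@zp_congr_trans _ _ _ (a (sigma zeta c%:Z))%:R).
    by apply: contrapT => h'; apply: h; exists (sigma zeta c%:Z).
  apply: natc; apply/eqP; rewrite -(eq_prim_root_expr zeta_prim) -(aP _).2.
  by rewrite sigmaE // coprime_sym.
pose r := psi d0 1%N; have hr : zp_congr 1 r%:~R (psi d0) := padic_approx 1 (psi d0).
have hb1 : gring_congr 1 b (idem psi) := gring_congr_le N0 hb.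
pose S : int := \sum_d (a d)%:Z * b d.
have SE : S%:~R = \sum_d (a d)%:R * (b d)%:~R :> padic p_pr.
  by rewrite rmorph_sum; apply: eq_bigr => d _; rewrite rmorphM.
(* The integer [S] is the exponent by which [b] acts on zeta. Shifting its sum by d0 gives a(d0) S =
   psi(d0) S modulo p, so p divides [S]. *)
have cS : zp_congr 1 (((a d0)%:Z * S)%:~R) ((r * S)%:~R : padic p_pr).
  rewrite !rmorphM /= SE; rewrite [in X in zp_congr _ X _](reindex_inj (mulgI d0^-1%g)).
  rewrite !mulr_sumr; apply: zp_congr_sum => e.
  rewrite mulrA mulrCA; apply: zp_congrM.
    by rewrite -natrM; apply: natc; rewrite -aM mulKVg.
  apply: zp_congr_trans (hb1 _) _; rewrite idem_shift //.
  by apply: zp_congr_sym; apply: zp_congrM hr (hb1 e).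
have /eqP := (zp_congr_int p_pr 1 _ _).1 cS.
rewrite eqz_mod_dvd expn1 -mulrBl dvdzE abszM Euclid_dvdM // => /orP[h|pS].
  case: nd0; apply: zp_congr_trans (zp_congr_sym hr) _; apply: zp_congr_sym.
  apply/(@zp_congr_int p p_pr 1 (a d0)%:Z r)/eqP.
  by rewrite eqz_mod_dvd expn1 dvdzE.
have -> : dpow Z b = Z *~ S.
  by rewrite /dpow mulrz_sumr; apply: eq_bigr => d _; rewrite actZ mulrzA.
have /dvdzP[q ->] : (p%:Z %| S)%Z by rewrite dvdzE.
by rewrite mulrC mulrzA -pmulrn Zp0 mul0rz.
Qed.

End TorsionPsi.

Lemma Lpowers_submod q : gsubmodule (M := LstM) (@Lpowers L q).
Proof.
split; first split.
- by move=> _ [x x0 <-]; apply: expf_neq0.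
- by exists 1; [exact: oner_neq0|rewrite expr1n].
- by move=> _ _ [x x0 <-] [y y0 <-]; exists (x * y); [exact: mulf_neq0|rewrite exprMn].
- by move=> _ [x x0 <-]; exists x^-1; rewrite ?exprVn //= invr_eq0.
by move=> d _ [x x0 <-]; exists (d x); rewrite -?rmorphXn //= fmorph_eq0.
Qed.

Lemma inLpowers q (x : Lx) : inN (M := LstM) (@Lpowers L q) x <-> exists y, x = y *+ q.
Proof.
split=> [[a a0 e]|[y ->]].
  by exists (Gelt (a0 : gset LstM a)); apply: gelt_val_inj; rewrite gelt_valX -e.
by exists (gelt_val y); rewrite -?gelt_valX //; apply: (gelt_valP y).
Qed.

Lemma W_submod : gsubmodule (M := LstM) (W zeta iota).
Proof.
have sub : W zeta iota `<=` gset (Lstar L).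
  apply: smallest_sub; last by move=> x [f [I [[[h _] _ _ _] hI ->]]]; apply: h.
  split; first by split=> //; [exact: oner_neq0|exact: mulf_neq0|move=> x; rewrite /= invr_eq0].
  by move=> d x /=; rewrite fmorph_eq0.
split; first split => //.
- by move=> S [[[_ h _ _] _] _].
- by move=> x y hx hy S hS; have [[[_ _ h _] _] _] := hS; apply: h; [apply: hx|apply: hy].
- by move=> x hx S hS; have [[[_ _ _ h] _] _] := hS; apply: h; apply: hx.
by move=> d x hx S hS; have [[_ h] _] := hS; apply: h; apply: hx.
Qed.

Definition WL q : set L := [set w * y | w in W zeta iota & y in @Lpowers L q].

Lemma WL_E q (x : Lx) : WL q (gelt_val x) <->
  exists w y : Lx, W zeta iota (gelt_val w) /\ x = w + y *+ q.
Proof.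
split=> [[w hw [_ [y y0 <-] e]]|[w [y [hw ->]]]].
  have w0 : gset LstM w by have [[h _ _ _] _] := W_submod; apply: h.
  pose Y : Lx := Gelt (y0 : gset LstM y); exists (Gelt w0), Y; split => //.
  by apply: gelt_val_inj; rewrite -e -[RHS]/(w * gelt_val (Y *+ q)) gelt_valX.
exists (gelt_val w) => //; exists (gelt_val (y *+ q)) => //.
by exists (gelt_val y); rewrite ?gelt_valX //; apply: (gelt_valP y).
Qed.

Lemma WL_sub q x : WL q x -> gset LstM x.
Proof.
move=> [w hw [y hy <-]]; have [[h _ _ _] _] := W_submod.
have [[h' _ _ _] _] := Lpowers_submod q.
by apply: mulf_neq0; [apply: h|apply: h'].
Qed.

(** [W_mod] is a quotient of a submodule; here its carrier is seen as a submodule of a quotient of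
    L^*, the form that [gcomp_subP] accepts. *)
Lemma WL_mod q : gsubmodule (M := lquo (Lpowers_submod q))
  [set gcoset (@Lpowers L q : set (Lstar L)) x | x in WL q].
Proof.
have key (X : lquo (Lpowers_submod q)) : [set gcoset (@Lpowers L q : set (Lstar L)) x | x in WL q] X ->
    exists2 x : Lx, WL q (gelt_val x) & X = gelt_val (qcl (Lpowers_submod q) x).
  by move=> [a ha <-]; exists (Gelt (WL_sub ha)).
have mem (x : Lx) : WL q (gelt_val x) ->
    [set gcoset (@Lpowers L q : set (Lstar L)) x | x in WL q] (gelt_val (qcl (Lpowers_submod q) x)).
  by move=> hx; exists (gelt_val x).
have [[_ W1 WM WV] WA] := W_submod.
split; first split.
- by move=> X /key[x _ ->]; apply: (gelt_valP (qcl (Lpowers_submod q) x)).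
- by apply: (mem 0); apply/WL_E; exists 0, 0; rewrite mul0rn addr0.
- move=> X Y /key[x hx ->] /key[y hy ->].
  rewrite -[gmul _ _ _]/(gelt_val (qcl (Lpowers_submod q) x + qcl (Lpowers_submod q) y)) -qclD.
  apply: mem; move/WL_E: hx => [w [u [hw ->]]]; move/WL_E: hy => [w' [u' [hw' ->]]].
  apply/WL_E; exists (w + w'), (u + u'); split; first exact: (WM (gelt_val w) (gelt_val w')).
  by rewrite mulrnDl addrACA.
- move=> X /key[x hx ->].
  rewrite -[ginv _ _]/(gelt_val (- qcl (Lpowers_submod q) x)) -(morph_opp (qclD (Lpowers_submod q))).
  apply: mem; move/WL_E: hx => [w [u [hw ->]]]; apply/WL_E; exists (- w), (- u).
  by split; [exact: (WV (gelt_val w))|rewrite opprD mulNrn].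
move=> d X /key[x hx ->].
rewrite -[Defs.gact _ _ _]/(gelt_val (dact d (qcl (Lpowers_submod q) x))) -qclA.
apply: mem; move/WL_E: hx => [w [u [hw ->]]]; apply/WL_E; exists (dact d w), (dact d u).
by split; [exact: (WA d (gelt_val w))|rewrite dactD dactMn].
Qed.

Lemma powers_principal_E q I : powers_principal_p p zeta q I <->
  exists B P : E, cl P = 0 /\ I = gelt_val (B *+ q + P).
Proof.
split=> [[B hB [P [hP [a a0 PE]] <-]]|[B [P [/cl0P[a PE] ->]]]].
  exists (Gelt (hB : gset (lsub prime_p_submod) B)), (Gelt (hP : gset (lsub prime_p_submod) P)).
  split; last first.
    pose B' : E := Gelt (hB : gset (lsub prime_p_submod) B).
    have e : gexpn (M := ideals_p p zeta) B q = gelt_val (B' *+ q) := gelt_val_expn B' q.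
    by rewrite e.
  by apply/cl0P; exists (Gelt (a0 : gset LstM a)); apply: gelt_val_inj.
exists (gelt_val B); first exact: (gelt_valP B).
exists (gelt_val P); last by rewrite [gexpn _ _](gelt_val_expn B).
split; first exact: (gelt_valP P).
by exists (gelt_val a); [exact: (gelt_valP a)|exact: (congr1 (@gelt_val _ _) PE)].
Qed.

Lemma in_powers_principal q (x : E) :
  inN (M := lsub prime_p_submod) (powers_principal_p p zeta q) x <->
  exists B P : E, cl P = 0 /\ x = B *+ q + P.
Proof.
split=> [/powers_principal_E[B [P [hP e]]]|[B [P [hP ->]]]].
  by exists B, P; split=> //; apply: (@gelt_val_inj _ (lsub prime_p_submod)).
by apply/powers_principal_E; exists B, P.
Qed.

Lemma powers_principal_submod q :
  gsubmodule (M := lsub prime_p_submod) (powers_principal_p p zeta q).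
Proof.
have cl0 : cl 0 = 0 := morph_Mn clD 0 0.
split; first split.
- by move=> I /powers_principal_E[B [P [_ ->]]]; apply: (gelt_valP (B *+ q + P)).
- by apply/powers_principal_E; exists 0, 0; rewrite mul0rn addr0.
- move=> I J /powers_principal_E[B [P [hP ->]]] /powers_principal_E[B' [P' [hP' ->]]].
  apply/powers_principal_E; exists (B + B'), (P + P'); split.
    by rewrite clD hP hP' addr0.
  by rewrite mulrnDl addrACA.
- move=> I /powers_principal_E[B [P [hP ->]]]; apply/powers_principal_E; exists (- B), (- P).
  by rewrite (morph_opp clD) hP oppr0 mulNrn -opprD.
move=> d I /powers_principal_E[B [P [hP ->]]]; apply/powers_principal_E.
exists (dact d B), (dact d P); rewrite clA hP dact0; split => //.
by rewrite -dactMn -dactD.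
Qed.

(** * The isomorphism *)

Section MainTheorem.
Variables (A : set (Cl zeta)) (A_sylow : gsylow p A).
Variables (psi : Delta -> padic p_pr) (psi_char : padic_char psi).
Hypothesis psi_neq_omega : forall omega : Delta -> padic p_pr,
  teichmuller zeta omega -> psi <> omega.
Variables (k : nat) (k_exp : gexponent (gcomp (gsub A) psi) (p ^ k)).
Variables (m : nat) (m_big : (cardinal A < p ^ m)%N).
Variables (n : nat) (n_def : n = (cardinal (gset (Cl zeta)) %/ cardinal A)%N).
Variables (em : Delta -> int) (em_congr : gring_congr m em (idem psi)).
Variables (f : set L -> L) (f_W : calW zeta iota f).
Hypothesis f_beta : has_beta zeta iota f (fun d => (2 * n * p ^ k)%N%:Z * em d).

Let q := (p ^ k)%N.
Let PP := powers_principal_submod (p ^ m).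
Let LP := Lpowers_submod q.

Lemma class_component_iso :
  exists (j : gsub A -> ideals_mod p zeta (p ^ m))
         (F : ideals_mod p zeta (p ^ m) -> L_mod L (p ^ k)),
    [/\ giso j,
        forall I, prime_to_p p zeta I -> A (ideal_class zeta I) ->
          j (ideal_class zeta I) = ideal_mod p zeta (p ^ m) I,
        ghom F,
        forall I, prime_to_p p zeta I ->
          F (ideal_mod p zeta (p ^ m) I) = elt_mod (p ^ k) (f I) &
        giso (F \o j : gcomp (gsub A) psi ->
                       gcomp (W_mod zeta iota (p ^ k)) psi)].
Proof.
have [s [n' [cA nE co C_exp AE]]] := sylow_class A_sylow.
have en : n' = n by rewrite n_def nE.
rewrite {nE}en in co C_exp.
have [fE [fD fA] fEE] := calW_lift f_W.
have p_odd : odd p by case: (even_prime p_pr) p_gt2 => [->|].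
have q_gt0 : (0 < q)%N by rewrite expn_gt0 prime_gt0.
have n_gt0 : (0 < n)%N.
  by rewrite lt0n; apply: contraTneq co => ->; rewrite /coprime gcd0n gtn_eqF.
have h_gt0 : (0 < n * p ^ s)%N by rewrite muln_gt0 n_gt0 expn_gt0 prime_gt0.
have le_sm : (s < m)%N by move: m_big; rewrite cA ltn_exp2l.
have killA (y : C) : A (clval y) -> y *+ (p ^ s) = 0 by move/AE.
have A_sub : gsubmodule (M := lquo principal_submod) A.
  have [A_grp _] := A_sylow; split=> // d X AX.
  have [sub _ _ _] := A_grp.
  have [y _ yE] : exists2 y : C, True & X = clval y.
    by exists (Gelt (sub X AX : gset (lquo principal_submod) X)).
  rewrite yE -[Defs.gact _ _ _]/(clval (dact d y)); apply/AE.
  by rewrite -dactMn killA ?dact0 // -yE.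
have cD := card_gal.
have compA (Y : Cl zeta) : gset (gcomp (gsub A) psi) Y <->
    exists y : C, [/\ y *+ (p ^ s) = 0, eigen psi y & Y = clval y].
  have h := @gcomp_subP _ p p_pr psi s (lquo principal_submod) A Y A_sub gal_abel cD psi_char killA.
  split=> [/h[y [/AE h1 h2 h3]]|[y [/AE h1 h2 h3]]]; first by exists y.
  by apply/h; exists y.
have Wq (x : gdmod (lquo LP)) : x *+ q = 0.
  have [y <-] := qcl_surj x; rewrite -(morph_Mn (qclD LP)).
  by apply/qcl_eq0/inLpowers; exists y.
have compW (Y : set L) : gset (gcomp (W_mod zeta iota q) psi) Y <->
    exists w : Lx, [/\ WL q (gelt_val w), eigen psi (qcl LP w) & Y = gelt_val (qcl LP w)].
  have h : gset (gcomp (W_mod zeta iota q) psi) Y <-> _ :=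
    @gcomp_subP _ p p_pr psi k (lquo LP) _ Y (WL_mod q) gal_abel cD psi_char
      (fun x _ => Wq x).
  split=> [/h[y [[a ha ae] ey ->]]|[w [hw ew wE]]]; last first.
    by apply/h; exists (qcl LP w); split => //; exists (gelt_val w).
  have yE : y = qcl LP (Gelt (WL_sub ha : gset LstM a)) by apply: gelt_val_inj; rewrite -ae.
  by exists (Gelt (WL_sub ha : gset LstM a)); rewrite -yE.
have k_min t : (forall y : C, y *+ (p ^ s) = 0 -> eigen psi y -> y *+ (p ^ t) = 0) -> (k <= t)%N.
  move=> ht; have [_ _ kmin] := k_exp.
  rewrite -(leq_exp2l _ _ p_gt1); apply: kmin; first by rewrite expn_gt0 prime_gt0.
  move=> Y /compA[y [ys ey ->]].
  by rewrite [LHS](gelt_val_expn (y : C)) ht.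
have le_ks : (k <= s)%N by apply: k_min.
have le_km : (k <= m)%N := leq_trans le_ks (ltnW le_sm).
have princ g (gE : E -> Lx) b : (forall x, gelt_val (gE x) = g (gelt_val x)) ->
    has_beta zeta iota g b -> forall x, cl x = 0 -> exists c : Lx,
    fE (x *+ p.-1) = dpow c (fun d => (2 * n * p ^ k)%N%:Z * em d) /\ gE (x *+ p.-1) = dpow c b.
  move=> gEE hb x cx; have [c cE cU] := principal_local_E cx.
  by exists c; rewrite (beta_principal fEE f_beta cE cU) (beta_principal gEE hb cE cU).
have co_p1 : coprime p.-1 p by rewrite -{2}(prednK (prime_gt0 p_pr)) coprimenS.
(* Only the multiple of [x] by p - 1 is known to have a generator in U; Bezout for p - 1 and q
   removes the factor. *)
have f_princ x : cl x = 0 -> exists y, fE x = y *+ q.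
  move=> cx; have [c [fc _]] := princ _ _ _ fEE f_beta x cx.
  have : exists y, fE x *+ p.-1 = y *+ q.
    exists (dpow c em *+ (2 * n)).
    by rewrite -(morph_Mn fD) fc dpowZr -pmulrn mulrnA.
  move=> [y hy]; have /coprimezP[[u v] /= e] : coprimez p.-1 q.
    by rewrite coprimezE coprimeXr.
  exists (y *~ u + fE x *~ v).
  rewrite -[LHS]mulr1z -e mulrzDr [u * _]mulrC [v * _]mulrC !mulrzA -!pmulrn hy mulrnDl.
  by rewrite !pmulrn ![_ *~ q *~ _]mulrzAC.
have f_pp x : inN (M := lsub prime_p_submod) (powers_principal_p p zeta (p ^ m)) x ->
    exists y, fE x = y *+ q.
  move/in_powers_principal => [B [P [hP ->]]].
  have [y hy] := f_princ P hP.
  exists (fE B *+ (p ^ (m - k)) + y).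
  by rewrite fD (morph_Mn fD) hy mulrnDl -mulrnA -expnD subnK.
have qPP (x y : E) : gelt_val (qcl PP x) = gelt_val (qcl PP y) <->
    exists B P : E, cl P = 0 /\ x - y = B *+ (p ^ m) + P.
  by split=> [/gelt_val_inj/qcl_eq/in_powers_principal //|/in_powers_principal/(qcl_eq PP) ->].
have qLP (x y : Lx) : gelt_val (qcl LP x) = gelt_val (qcl LP y) <->
    exists z, x - y = z *+ q.
  by split=> [/gelt_val_inj/qcl_eq/inLpowers //|/inLpowers/(qcl_eq LP) ->].
have quoP (X : ideals_mod p zeta (p ^ m)) : gset (ideals_mod p zeta (p ^ m)) X ->
    exists I : E, X = gelt_val (qcl PP I).
  by move=> [I hI <-]; exists (Gelt (hI : gset (lsub prime_p_submod) I)).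
(* A class is represented by a chosen ideal prime to p, which exists by [cl_surj]; [jE] shows
   independence of the choice. The default [set0] is not met on actual classes. *)
pose j (X : gsub A) : ideals_mod p zeta (p ^ m) :=
  if pselect (exists I : E, X = clval (cl I)) is left ex
  then gelt_val (qcl PP (projT1 (cid ex))) else set0.
have jE I : j (clval (cl I)) = gelt_val (qcl PP I).
  rewrite /j; case: pselect => [ex|[]]; last by exists I.
  move: (projT1 _) (projT2 (cid ex)) => I' /clval_inj e; apply/qPP; exists 0, (I' - I).
  by rewrite mul0rn add0r clD (morph_opp clD) e subrr.
pose F (X : ideals_mod p zeta (p ^ m)) : L_mod L (p ^ k) :=
  if pselect (exists I : E, X = gelt_val (qcl PP I)) is left ex
  then gelt_val (qcl LP (fE (projT1 (cid ex)))) else set0.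
have FE I : F (gelt_val (qcl PP I)) = gelt_val (qcl LP (fE I)).
  rewrite /F; case: pselect => [ex|[]]; last by exists I.
  move: (projT1 _) (projT2 (cid ex)) => I' /qPP/in_powers_principal/f_pp[y hy].
  by apply/qLP; exists (- y); rewrite mulNrn -hy fD (morph_opp fD) opprB.
(* Multiplication by u n sends every class into A and is the identity modulo p^m: it serves as the
   projection of the class group onto A. *)
have n_unit : exists u, exists v, (u * n = 1 + v * p ^ m)%N.
  case: (egcdnP (p ^ m) n_gt0) => u v e _; exists u, v; rewrite e addnC.
  by congr (_ + _)%N; apply/eqP; apply: coprimeXr.
have [u [v uv]] := n_unit.
have Ekill I : cl (I *+ (u * n)) *+ (p ^ s) = 0.
  by rewrite clMn -mulrnA -mulnA mulrnA mulrnAC C_exp mul0rn.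
have cl_rep y : exists I, cl I = y by apply: cl_surj.
have elt_modE (I : E) : elt_mod (p ^ k) (f (gelt_val I)) = gelt_val (qcl LP (fE I)) :> L_mod L (p ^ k).
  by rewrite -fEE.
exists j, F; split.
- split; first split.
  + move=> X AX; have [[subA _ _ _] _] := A_sub.
    have [I IE] := cl_rep (Gelt (subA X AX)).
    have -> : X = clval (cl I) by rewrite IE.
    by rewrite jE; apply: (gelt_valP (qcl PP I)).
  + move=> X Y AX AY; have [[subA _ _ _] _] := A_sub.
    have [I IE] := cl_rep (Gelt (subA X AX)); have [J JE] := cl_rep (Gelt (subA Y AY)).
    have -> : X = clval (cl I) by rewrite IE.
    have -> : Y = clval (cl J) by rewrite JE.
    rewrite -[gmul _ (clval _) _]/(clval (cl I + cl J)) -clD !jE qclD.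
    by [].
  split.
  + move=> X AX; have [[subA _ _ _] _] := A_sub.
    have [I IE] := cl_rep (Gelt (subA X AX)).
    have -> : X = clval (cl I) by rewrite IE.
    by rewrite jE; apply: (gelt_valP (qcl PP I)).
  + move=> X Y /set_mem AX /set_mem AY; have [[subA _ _ _] _] := A_sub.
    have [I IE] := cl_rep (Gelt (subA X AX)); have [J JE] := cl_rep (Gelt (subA Y AY)).
    have XE : X = clval (cl I) by rewrite IE.
    have YE : Y = clval (cl J) by rewrite JE.
    rewrite XE YE !jE => /qPP[B [P [hP e]]].
    have e' : cl I - cl J = cl B *+ (p ^ m).
      by rewrite -(morph_opp clD) -clD e clD hP addr0 clMn.
    (* The difference is a p^m-th multiple with m > s, so n kills it; p^s does as well, and the two
       are coprime. *)
    have zn : (cl I - cl J) *+ n = 0.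
      rewrite e' -(subnK (ltnW le_sm)) expnD -mulrnA mulnC mulnCA mulrnA.
      by rewrite mulrnAC C_exp mul0rn.
    have zs : (cl I - cl J) *+ (p ^ s) = 0.
      by rewrite mulrnBl !killA ?subrr // -?XE -?YE.
    suff -> : cl I = cl J by [].
    have /coprimezP[[a b] /= eab] : coprimez n (p ^ s)%N by rewrite coprimezE coprimeXr.
    apply/eqP; rewrite -subr_eq0 -[_ - _]mulr1z -eab mulrzDr.
    by rewrite [a * _]mulrC [b * _]mulrC !mulrzA -!pmulrn zn zs !mul0rz addr0.
  move=> X /quoP[I ->].
  exists (clval (cl (I *+ (u * n)))); first exact/AE/Ekill.
  rewrite jE; apply/qPP; exists (I *+ v), 0; split; first exact: (morph_Mn clD 0 0).
  by rewrite uv mulrnDr mulr1n [I + _]addrC addrK addr0 -mulrnA.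
- move=> I hI _; exact: (jE (Gelt (hI : gset (lsub prime_p_submod) I))).
- split.
    by move=> X /quoP[I ->]; rewrite FE; apply: (gelt_valP (qcl LP (fE I))).
  move=> X Y /quoP[I ->] /quoP[J ->].
  have -> : gmul (ideals_mod p zeta (p ^ m)) (gelt_val (qcl PP I)) (gelt_val (qcl PP J)) =
    gelt_val (qcl PP (I + J)) by rewrite qclD.
  rewrite !FE fD qclD.
  by [].
- move=> I hI; have := FE (Gelt (hI : gset (lsub prime_p_submod) I)).
  by rewrite -elt_modE.
have f_in_W I : WL q (gelt_val (fE I)).
  apply/WL_E; exists (fE I), 0; rewrite mul0rn addr0; split=> //.
  move=> S [_ h]; apply: h; exists f, (gelt_val I); split => //; exact: (gelt_valP I).
have f_eigen I : cl I *+ (p ^ s) = 0 -> eigen psi (cl I) -> eigen psi (qcl LP (fE I)).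
  move=> Is eI N d r hr xN; pose r' := psi d (s + N)%N.
  have hr' : zp_congr (s + N) r'%:~R (psi d) := padic_approx _ _.
  have e : dact d (cl I) = cl I *~ r'.
    exact: (eI s d r' (zp_congr_le (leq_addr N s) hr') Is).
  have [y hy] : exists y, fE (dact d I - I *~ r') = y *+ q.
    by apply: f_princ; rewrite clD (morph_opp clD) clA (morph_Mz clD) e subrr.
  have -> : dact d (qcl LP (fE I)) = qcl LP (fE I) *~ r'.
    rewrite -qclA -(morph_Mz (qclD LP)); apply/qcl_eq/inLpowers; exists y.
    by rewrite -hy fD (morph_opp fD) fA (morph_Mz fD).
  apply: (mulz_congr xN); apply/(@zp_congr_int p p_pr).
  exact: zp_congr_trans (zp_congr_le (leq_addl s N) hr') (zp_congr_sym hr).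
have FjE I : (F \o j) (clval (cl I)) = gelt_val (qcl LP (fE I)) by rewrite /= jE FE.
have FjW : {homo F \o j : X / gset (gcomp (gsub A) psi) X >->
    gset (gcomp (W_mod zeta iota q) psi) X}.
  move=> X /compA[y [ys ey ->]]; have [I IE] := cl_rep y.
  rewrite -IE FjE; apply/compW; exists (fE I); split=> //.
  by apply: f_eigen; rewrite IE.
split; first split => //.
  move=> X Y /compA[y [_ _ ->]] /compA[z [_ _ ->]].
  have [I <-] := cl_rep y; have [J <-] := cl_rep z.
  rewrite -[gmul _ (clval _) _]/(clval (cl I + cl J)) -clD !FjE fD qclD.
  by [].
split => //.
  move=> X Y /set_mem /compA[y [ys ey ->]] /set_mem /compA[z [zs ez ->]].
  have [I IE] := cl_rep y; have [J JE] := cl_rep z; rewrite -IE -JE !FjE.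
  move=> /qLP[c hc].
  suff -> : cl I = cl J by [].
  apply/eqP; rewrite -subr_eq0 IE JE; apply/eqP.
  set w := y - z; have ws : w *+ (p ^ s) = 0 by rewrite mulrnBl ys zs subrr.
  have wm : w *+ (p ^ m) = 0 by rewrite -(subnKC (ltnW le_sm)) expnD mulrnA ws mul0rn.
  have ew : eigen psi w.
    move=> N d r hr wN; pose r' := psi d (s + N)%N.
    have hr' : zp_congr (s + N) r'%:~R (psi d) := padic_approx _ _.
    have hs := zp_congr_le (leq_addr N s) hr'.
    rewrite /w dactD dactN (ey s d r' hs ys) (ez s d r' hs zs) -mulrzBl -/w.
    apply: (mulz_congr wN); apply/(@zp_congr_int p p_pr).
    exact: zp_congr_trans (zp_congr_le (leq_addl s N) hr') (zp_congr_sym hr).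
  have : fgen c = dpow (gincl (I - J)) em *+ (2 * n).
    apply/eqP; rewrite -subr_eq0; apply/eqP; apply: (frac_tors q_gt0).
    rewrite mulrnBl -fgenMn -hc -(morph_opp fD) -fD.
    rewrite (ideal_beta h_gt0 C_exp fD fEE f_beta) dpowZr -pmulrn mulrnA.
    by rewrite subrr.
  move=> /(congr1 (qcl principal_submod)).
  have -> : qcl principal_submod (fgen c) = 0.
    by apply/qcl_eq0/inN_principal; exists c.
  rewrite (morph_Mn (qclD principal_submod)).
  rewrite (dpow_morph (qclD principal_submod) (qclA principal_submod)).
  rewrite -[qcl _ _]/(cl (I - J)) clD (morph_opp clD) IE JE -/w.
  rewrite (dpow_idem cD psi_char wm ew em_congr) => w2n.
  have /coprimezP[[a b] /= eab] : coprimez (2 * n)%N (p ^ s)%N.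
    by rewrite coprimezE coprimeXr // coprimeMl co coprime2n p_odd.
  rewrite -[w]mulr1z -eab mulrzDr [a * _]mulrC [b * _]mulrC !mulrzA -!pmulrn -w2n ws.
  by rewrite !mul0rz addr0.
move=> Y /compW[w [hw ew ->]].
(* The power p^s kills the classes in A and p^k kills L^* modulo p^k-th powers, so a single lift [b]
   of this precision acts as e_psi on both sides. *)
pose N := (s + k)%N; pose b := approx N (idem psi).
have hb : gring_congr N b (idem psi) := approxP _ _.
(* By minimality of [W] it suffices that the elements whose e_psi-part lies in [f_image] form a
   Galois submodule containing the values of every g. *)
have imW : W zeta iota `<=` [set a | exists2 x : Lx, a = gelt_val x & f_image p k fE (dpow x b)].
  apply: smallest_sub.
    have fi0 : f_image p k fE 0.
      by exists 0, 0; rewrite mul0rn addr0 (morph_Mn fD 0 0).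
    split; first split.
    - by move=> _ [x -> _]; apply: (gelt_valP x).
    - by exists 0 => //; rewrite dpow0l.
    - move=> _ _ [x -> hx] [y -> hy]; exists (x + y) => //.
      by rewrite dpowDl; apply: f_imageD.
    - move=> _ [x -> hx]; exists (- x) => //; rewrite dpowNl.
      by have := f_imageMz fD (-1) hx; rewrite mulrNz mulr1z.
    move=> d _ [x -> hx]; exists (dact d x) => //; rewrite (dpow_act gal_abel).
    have [z [y e]] := hx; exists (dact d z), (dact d y).
    by rewrite e dactD fA dactMn.
  move=> _ [g [I [gW hI ->]]].
  have [gE [gD gA] gEE] := calW_lift gW.
  have [_ _ _ [bg hbg]] := gW.
  pose I' : E := Gelt (hI : gset (lsub prime_p_submod) I).
  exists (gE I'); first by rewrite gEE.
  apply: (f_image_idem gal_abel cD psi_char clD p_odd co C_exp k_min le_km em_congr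
    (Lx_tors psi_char psi_neq_omega) fD fA gD (princ g gE bg gEE hbg)
    (beta_kill h_gt0 C_exp gD gEE hbg) I' (leq_addl s k) hb).
move/WL_E: hw => [w1 [c [/imW[x xE hx] wE]]].
have {xE} xE : w1 = x by apply: gelt_val_inj.
have [z [y zE]] : exists z y, dpow w b = fE z + y *+ q.
  have [z [y e]] := hx; exists z, (y + dpow c b).
  by rewrite wE dpowDl dpowMnl xE e mulrnDl addrA.
have wq : qcl LP w *+ (p ^ N) = 0 by rewrite /N expnD mulnC mulrnA -/q Wq mul0rn.
have wz : qcl LP w = qcl LP (fE z).
  rewrite -(dpow_idem cD psi_char wq ew hb) -(dpow_morph (qclD LP) (qclA LP)) zE.
  by apply/qcl_eq/inLpowers; exists y; rewrite addrC addKr.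
(* The class of [z] need not lie in A(psi): u n moves it into A, and [b] into the psi-component. On
   the image, u n acts as 1 because k <= m, and [b] fixes the eigenvector given by [w]. *)
pose I := dpow (z *+ (u * n)) b.
have clI : cl I = dpow (cl (z *+ (u * n))) b := dpow_morph clD clA _ _.
exists (clval (cl I)).
  apply/compA; exists (cl I); split=> //.
    by rewrite clI -dpowMnl Ekill dpow0l.
  rewrite clI; apply: (eigen_dpow gal_abel psi_char) hb.
  by rewrite /N expnD mulrnA Ekill mul0rn.
rewrite FjE; suff -> : qcl LP (fE I) = qcl LP w by [].
rewrite /I (dpow_morph fD fA) (dpow_morph (qclD LP) (qclA LP)).
rewrite (morph_Mn fD) (morph_Mn (qclD LP)) -wz dpowMnl.
rewrite (dpow_idem cD psi_char wq ew hb) uv mulrnDr mulr1n.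
by rewrite -(subnK le_km) expnD mulnA mulrnA -/q Wq addr0.
Qed.

End MainTheorem.

End Modules.

End Local.

End Cyclotomic.

Theorem theorem3p3 (p : nat) (p_pr : prime p) (p_ge5 : (5 <= p)%N)
  (L : splittingFieldType rat) (zeta : L)
  (zeta_prim : p.-primitive_root zeta)
  (zeta_gen : <<1%AS; zeta>>%VS = fullv :> {vspace L})
  (K : fieldExtType {fraction (padic p_pr)}) (iota : {rmorphism L -> K})
  (K_gen : <<1%AS; iota zeta>>%VS = fullv :> {vspace K})
  (A : set (Cl zeta)) (A_sylow : gsylow p A)
  (psi : gal_of {:L} -> padic p_pr) (psi_char : padic_char psi)
  (psi_odd : psi (sigma zeta (-1)) = -1)
  (psi_neq_omega : forall omega : gal_of {:L} -> padic p_pr,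
     teichmuller zeta omega -> psi <> omega)
  (k : nat) (k_exp : gexponent (gcomp (gsub A) psi) (p ^ k))
  (m : nat) (m_ge1 : (1 <= m)%N) (m_big : (cardinal A < p ^ m)%N)
  (n : nat) (n_def : n = (cardinal (gset (Cl zeta)) %/ cardinal A)%N)
  (em : gal_of {:L} -> int) (em_minus : gring_minus zeta em)
  (em_congr : gring_congr m em (idem psi))
  (f : set L -> L) (f_minus : calW_minus zeta iota f)
  (f_beta : has_beta zeta iota f (fun d => (2 * n * p ^ k)%N%:Z * em d)) :
  exists (j : gsub A -> ideals_mod p zeta (p ^ m))
         (F : ideals_mod p zeta (p ^ m) -> L_mod L (p ^ k)),
    [/\ giso j,
        forall I, prime_to_p p zeta I -> A (ideal_class zeta I) ->
          j (ideal_class zeta I) = ideal_mod p zeta (p ^ m) I,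
        ghom F,
        forall I, prime_to_p p zeta I ->
          F (ideal_mod p zeta (p ^ m) I) = elt_mod (p ^ k) (f I) &
        giso (F \o j : gcomp (gsub A) psi ->
                       gcomp (W_mod zeta iota (p ^ k)) psi)].
Proof.
exact: (class_component_iso zeta_prim zeta_gen (leq_trans _ p_ge5) A_sylow psi_char
  psi_neq_omega k_exp m_big n_def em_congr f_minus.1 f_beta).
Qed.
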